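(* Let $n\ge 1$, let $\Omega\subset\mathbb{C}^n$ be a domain, and let $h\colon \Delta\times S^{2n-1}\to\mathbb{C}^n$ be a local $C^1$ singular foliation at the origin by holomorphic discs, with $h(\Delta\times S^{2n-1})\subset\Omega$. Let $f\colon\Omega\to\mathbb{C}$ be a function satisfying: (A) $f\in C^\infty(0)\cap C^1(\Omega)$; and (B) for every leaf $h(\cdot,v)$, $v\in S^{2n-1}$, the composition $f\circ h(\cdot,v)\colon\Delta\to\mathbb{C}$ is a holomorphic function. Then there is a neighborhood $U$ of the origin in $\mathbb{C}^n$ such that $f$ is holomorphic on $\Omega\cap U$.
   Context: $\Delta\subset\mathbb{C}$ is the open unit disc and $S^{2n-1}=\{z\in\mathbb{C}^n : |z_1|^2+\cdots+|z_n|^2=1\}$ is the unit sphere. A local $C^1$ singular foliation at the origin by holomorphic discs is a $C^1$ map $h\colon\Delta\times S^{2n-1}\to\mathbb{C}^n$ such that: (1) for each $v\in S^{2n-1}$, the map $z\in\Delta\mapsto h(z,v)\in\mathbb{C}^n$ is a holomorphic embedding; (2) $h(0,v)=0$ for every $v\in S^{2n-1}$; (3) the image $h(\Delta\times S^{2n-1})$ contains an open neighborhood of $0$ in $\mathbb{C}^n$; (4) for each $v\in S^{2n-1}$ there exists $r_v>0$ such that $\frac{\partial h}{\partial z}\big|_{(0,v)}=r_v v$; (5) $h(z,e^{i\theta}v)=h(e^{i\theta}z,v)$ for all $\theta\in\mathbb{R}$, $z\in\Delta$, $v\in S^{2n-1}$. The notation $f\in C^\infty(0)$ means: for every positive integer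 $k$ there exists a polynomial $p_k$ (with complex coefficients, in the variables $z_1,\dots,z_n,\bar z_1,\dots,\bar z_n$) such that $f(z)-p_k(z)=o(|z|^k)$ as $z\to 0$. The notation $f\in C^1(\Omega)$ means $f$ is continuously differentiable on $\Omega$ in the real sense. *)

(* Defs.v *)
From HB Require Import structures.
From mathcomp Require Import all_boot all_order all_algebra.
From mathcomp Require Import complex.
From mathcomp Require Import all_classical all_reals all_analysis.
From mathcomp Require mpoly.

Set Implicit Arguments.
Unset Strict Implicit.
Unset Printing Implicit Defensive.

Import Order.TTheory GRing.Theory Num.Theory.
Import numFieldNormedType.Exports.

Local Open Scope classical_set_scope.
Local Open Scope ring_scope.
Local Open Scope complex_scope.

HB.instance Definition _ (R : realType) := NormedModule.copy R[i] R[i]^o.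

(* [realified V] is the complex normed space V seen as a real normed space: it
   keeps the additive group and the uniform structure of V.  As `|x| lives in
   R[i], the real norm is its real part. *)
Definition realified (R : realType) (V : normedModType R[i]) : Type := V.

Section Realified.
Context {R : realType} {V : normedModType R[i]}.
Local Notation E := (realified V).

HB.instance Definition _ := Choice.copy E V.
HB.instance Definition _ := GRing.Zmodule.copy E V.
HB.instance Definition _ := Uniform.copy E V.
HB.instance Definition _ := Pointed.copy E V.

Let scaleE (r : R) (x : E) : E := r%:C *: (x : V).

Fact realified_scalerA (a b : R) (x : E) :
  scaleE a (scaleE b x) = scaleE (a * b) x.
Proof. by rewrite /scaleE scalerA rmorphM. Qed.

Fact realified_scale1r : left_id 1 scaleE.
Proof. by move=> x; rewrite /scaleE rmorph1 scale1r. Qed.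

Fact realified_scalerDr : right_distributive scaleE +%R.
Proof. by move=> a x y; rewrite /scaleE scalerDr. Qed.

Fact realified_scalerDl (x : E) : {morph scaleE^~ x : a b / a + b}.
Proof. by move=> a b; rewrite /scaleE rmorphD scalerDl. Qed.

HB.instance Definition _ := GRing.Zmodule_isLmodule.Build R E
  realified_scalerA realified_scale1r realified_scalerDr realified_scalerDl.

Let normE (x : E) : R := complex.Re `|x : V|.

Fact realified_normE (x : E) : (normE x)%:C = `|x : V|.
Proof. by rewrite /normE RRe_real // normr_real. Qed.

Fact realified_ler_normD (x y : E) : normE (x + y) <= normE x + normE y.
Proof. by rewrite -lecR rmorphD /= !realified_normE ler_normD. Qed.

Fact realified_normr0_eq0 (x : E) : normE x = 0 -> x = 0.
Proof. by move=> x0; apply: (@normr0_eq0 _ V); rewrite -realified_normE x0. Qed.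

Fact realified_normrMn (x : E) n : normE (x *+ n) = normE x *+ n.
Proof.
apply: (@complexI R); rewrite rmorphMn /= !realified_normE; exact: (@normrMn _ V).
Qed.

Fact realified_normrN (x : E) : normE (- x) = normE x.
Proof. by rewrite /normE (@normrN _ V). Qed.

HB.instance Definition _ := Num.Zmodule_isNormed.Build R E
  realified_ler_normD realified_normr0_eq0 realified_normrMn realified_normrN.

Fact realified_entourageE : entourage = entourage_ (ball_ (fun x : E => `|x|)).
Proof.
rewrite -[LHS](@entourage_ballE _ V) predeqE => A; split=> -[e /= e0 eA].
  have er : e = (complex.Re e)%:C by rewrite RRe_real // gtr0_real.
  exists (complex.Re e) => /=; first by rewrite -ltcR -er.
  move=> xy; rewrite /= -ltcR realified_normE -er => xye.
  by apply: eA; rewrite /= -ball_normE.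
exists e%:C => /=; first by rewrite ltcR.
move=> xy; rewrite /= -ball_normE /= -(@realified_normE (xy.1 - xy.2)) ltcR => xye.
exact: eA.
Qed.

HB.instance Definition _ := Uniform_isPseudoMetric.Build R E
  (@ball_norm_center _ E) (@ball_norm_symmetric _ E) (@ball_norm_triangle _ E)
  realified_entourageE.

HB.instance Definition _ := NormedZmod_PseudoMetric_eq.Build R E erefl.

Fact realified_normrZ (a : R) (x : E) : `|a *: x| = `|a| * `|x|.
Proof.
apply: (@complexI R); rewrite rmorphM /= !realified_normE (@normrZ _ V).
by rewrite normc_def /= expr0n addr0 sqrtr_sqr.
Qed.

HB.instance Definition _ :=
  PseudoMetricNormedZmod_Lmodule_isNormedModule.Build R E realified_normrZ.

End Realified.

Definition C1_open (R : realType) (E F : normedModType R)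
    (U : set E) (f : E -> F) :=
  [/\ open U,
      forall x, U x -> differentiable f x &
      forall x, U x -> forall e : R, 0 < e ->
        \forall y \near x, forall u, `|'d f y u - 'd f x u| <= e * `|u|].

Definition real_C1_open (R : realType) (V W : normedModType R[i])
    (U : set V) (f : V -> W) :=
  @C1_open R (realified V) (realified W) U f.

(* On a set that need not be open (such as the disc times the sphere), being C^1
   means being locally the restriction of a C^1 map on an open set of the
   ambient space. *)
Definition real_C1_on (R : realType) (V W : normedModType R[i])
    (A : set V) (f : V -> W) :=
  forall x, A x -> exists (U : set V) (g : V -> W),
    [/\ U x, real_C1_open U g & forall y, A y -> U y -> f y = g y].

(* To be used with U open.  The scalars are R[i], so [differentiable] is complex
   differentiability. *)
Definition holomorphic_on (R : realType) (V W : normedModType R[i])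
    (U : set V) (f : V -> W) :=
  forall x, U x -> differentiable f x.

(* Injective holomorphic immersion that is a homeomorphism onto its image, the
   latter carrying the subspace topology. *)
Definition holomorphic_embedding (R : realType) (W : normedModType R[i])
    (D : set R[i]) (g : R[i] -> W) :=
  [/\ holomorphic_on D g,
      {in D &, injective g},
      forall z, D z -> 'D_1 g z != 0 &
      forall U : set R[i], open U ->
        exists V : set W, open V /\ g @` (D `&` U) = (g @` D) `&` V].

Definition disc (R : realType) : set R[i] := [set z | `|z| < 1].

(* The norm of 'rV[R[i]]_n provided by the library is the maximum norm. *)
Definition hermitian_norm (R : realType) n (z : 'rV[R[i]]_n) : R[i] :=
  sqrtC (\sum_(j < n) `|z 0 j| ^+ 2).

Definition sphere (R : realType) n : set 'rV[R[i]]_n :=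
  [set v | \sum_(j < n) `|v 0 j| ^+ 2 = 1].

Arguments disc : clear implicits.
Arguments sphere : clear implicits.

Definition expi (R : realType) (theta : R) : R[i] := cos theta +i* sin theta.

Definition disc_foliation (R : realType) n
    (h : R[i] -> 'rV[R[i]]_n -> 'rV[R[i]]_n) :=
  real_C1_on (disc R `*` sphere R n)
    (fun zv : R[i] * 'rV[R[i]]_n => h zv.1 zv.2) /\
  [/\ forall v, sphere R n v -> holomorphic_embedding (disc R) (h ^~ v),
      forall v, sphere R n v -> h 0 v = 0,
      nbhs (0 : 'rV[R[i]]_n) [set h z v | z in disc R & v in sphere R n],
      forall v, sphere R n v -> exists2 r : R, 0 < r & 'D_1 (h ^~ v) 0 = r%:C *: v &
      forall (theta : R) z v, disc R z -> sphere R n v ->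
        h z (expi theta *: v) = h (expi theta * z) v].

(* Variables 0, ..., n - 1 of p stand for the z_j, the last n for their
   conjugates. *)
Definition eval_conj (R : realType) n (p : mpoly.mpoly (n + n) R[i])
    (z : 'rV[R[i]]_n) : R[i] :=
  mpoly.meval (fun j => row_mx z (map_mx conjc z) 0 j) p.

Definition smooth_at0 (R : realType) n (f : 'rV[R[i]]_n -> R[i]) :=
  forall k : nat, (0 < k)%N -> exists p : mpoly.mpoly (n + n) R[i],
    (fun z => f z - eval_conj p z) =o_ (0 : 'rV[R[i]]_n)
    (fun z => hermitian_norm z ^+ k).

Definition domain (R : realType) (V : normedModType R[i]) (D : set V) :=
  [/\ open D, connected D & D !=set0].

(* Main.v *)
From HB Require Import structures.
Require Import Defs.
From mathcomp Require Import all_boot all_order all_algebra.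
From mathcomp Require Import complex.
From mathcomp Require Import all_classical all_reals all_analysis.
From mathcomp Require Import ring lra.
Import Order.TTheory GRing.Theory Num.Theory.
Import numFieldNormedType.Exports.
Set Implicit Arguments.
Unset Strict Implicit.
Unset Printing Implicit Defensive.
Local Open Scope classical_set_scope.
Local Open Scope ring_scope.
Local Open Scope complex_scope.

(** The neighbourhood is the interior of the image of [h].  A point of that image has
    the form [h (z, w)]; by the rotation rule it is [h (t, v)] with [t = |z|] real and
    [v] a rotation of [w].  So fix a leaf, that of [v]: it suffices that the
    antiholomorphic derivatives [dbar_l f] vanish at [h (t, v)] for real [t] in
    [(-1, 1)].

    Move the leaf in a one-parameter family.  The derivatives [H_k] and [Y] of the
    coordinates of [h] and of [f \o h] along the family are again holomorphic in
    [z], being locally uniform limits of difference quotients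
    ([variation_disc_holo]).  The chain rule reads
    [Y = \sum_k (d_k f * H_k + dbar_k f * conj H_k)] ([variation_chain]).  With [2n]
    independent families this is a linear system for the [2n] unknowns [d_k f],
    [dbar_k f], of matrix [M = (H | conj H)].  On the real axis [conj H] agrees with
    the holomorphic function [z |-> conj (H (conj z))], so by Cramer's rule
    [\det M * dbar_l f] is, on [(-1, 1)], the restriction of a holomorphic function
    of the disc.

    This function is flat at 0.  Since [f] is holomorphic along every leaf, its Taylor
    polynomials at 0 contain no conjugate variable ([holomorphic_jet]).  Subtracting
    one of them, [P], changes the [d_k f] but not the [dbar_k f], whereas by Schwarz's
    lemma the variations of [(f - P) \o h] vanish at 0 to an order as high as one
    wishes ([variation_flat]).  A flat holomorphic function is zero, so
    [\det M * dbar_l f = 0] on [(-1, 1)] ([det_dbar_vanishes]).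

    Finally the zeros of [\det M] are isolated.  The derivative of the leaf of [w] at
    its centre is [r w * w], hence a family moving [w] in the direction [xi] has
    variation [z * (r v * xi + a * v) + O(z ^ 2)], and [M = t * M0 + O(t ^ 2)] with [M0]
    invertible ([variation_mx_det_neq0]).  By continuity [dbar_l f] vanishes on the
    whole leaf ([dbar_vanishes_on_leaf]).

    The function theory of one variable is built on a single description of
    holomorphy: uniform approximability by polynomials on smaller discs
    ([disc_holo]).  Closure under ring operations and limits is then immediate, and
    Cauchy's estimate is an average over roots of unity.  That the [C^1] functions
    at hand satisfy it holds because their Lagrange interpolants at the [N]-th roots of
    unity converge uniformly ([approx_by_polys_of_differentiable]). *)

(** * The real-valued norm of a complex normed space *)

(** The norm of a normed space over [R[i]] takes its values in [R[i]], which is only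
    partially ordered; estimates are carried out on this real form of it. *)
Definition rn (R : realType) (V : normedModType R[i]) (x : V) : R :=
  complex.Re `|x|.

Section RealNorm.
Context {R : realType} {V : normedModType R[i]}.
Implicit Types x y : V.

Lemma rnE x : (rn x)%:C = `|x|.
Proof. by rewrite /rn RRe_real // normr_real. Qed.

Lemma rn_ge0 x : 0 <= rn x.
Proof. by rewrite -lecR rnE normr_ge0. Qed.

Lemma rn_triangle x y : rn (x + y) <= rn x + rn y.
Proof. by rewrite -lecR rmorphD /= !rnE ler_normD. Qed.

Lemma rn0 : rn (0 : V) = 0.
Proof. by rewrite /rn normr0. Qed.

Lemma rn0_eq0 x : rn x = 0 -> x = 0.
Proof. by move=> h; apply/normr0_eq0; rewrite -rnE h. Qed.

Lemma rnN x : rn (- x) = rn x.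
Proof. by rewrite /rn normrN. Qed.

Lemma rn_distC x y : rn (x - y) = rn (y - x).
Proof. by rewrite -rnN opprB. Qed.

Lemma rnZ (c : R[i]) x : rn (c *: x) = rn c * rn x.
Proof. by apply: (@complexI R); rewrite rmorphM /= !rnE normrZ. Qed.

Lemma rn_sum I (r : seq I) (P : pred I) (F : I -> V) :
  rn (\sum_(i <- r | P i) F i) <= \sum_(i <- r | P i) rn (F i).
Proof.
elim/big_rec2: _ => [|i b a _ h]; first by rewrite rn0.
by apply: le_trans (rn_triangle _ _) _; rewrite lerD2l.
Qed.

Lemma rn_sub_triangle x y z : rn (x - z) <= rn (x - y) + rn (y - z).
Proof. by apply: le_trans (rn_triangle _ _); rewrite addrA subrK. Qed.

End RealNorm.

Section ComplexModulus.
Context {R : realType}.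
Local Notation C := R[i].
Implicit Types x y z : C.

Lemma rnM x y : rn (x * y) = rn x * rn y.
Proof. by apply: (@complexI R); rewrite rmorphM /= !rnE normrM. Qed.

Lemma rn1 : rn (1 : C) = 1.
Proof. by rewrite /rn normr1. Qed.

Lemma rnX x n : rn (x ^+ n) = rn x ^+ n.
Proof. by elim: n => [|n IH]; rewrite ?expr0 ?rn1// !exprS rnM IH. Qed.

Lemma rnV x : rn x^-1 = (rn x)^-1.
Proof. by apply: (@complexI R); rewrite rnE normfV fmorphV /= rnE. Qed.

Lemma rn_real (t : R) : rn t%:C = `|t|.
Proof. by rewrite /rn normc_def /= expr0n addr0 sqrtr_sqr. Qed.

Lemma rn_conj z : rn z^*%C = rn z.
Proof. by rewrite /rn normcJ. Qed.

Lemma rn_i : rn ('i : C) = 1.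
Proof. by rewrite /rn normc_def /= expr0n expr1n add0r sqrtr1. Qed.

Lemma normRe_le z : `|complex.Re z| <= rn z.
Proof. by rewrite -lecR rnE; exact: normc_ge_Re. Qed.

Lemma normIm_le z : `|complex.Im z| <= rn z.
Proof.
rewrite (_ : complex.Im z = complex.Re (- 'i * z)) ?(le_trans (normRe_le _))//.
  by rewrite rnM rnN rn_i mul1r.
by case: z => a b /=; rewrite oppr0 mul0r mulN1r sub0r opprK.
Qed.

Lemma rn_ReIm z : rn z <= `|complex.Re z| + `|complex.Im z|.
Proof.
rewrite {1}(complexE z) (le_trans (rn_triangle _ _))// rnM rn_i mul1r.
by rewrite !rn_real.
Qed.

Lemma rn_gt0 z : (0 < rn z) = (z != 0).
Proof.
have [->|z0] := eqVneq z 0; first by rewrite rn0 ltxx.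
rewrite lt_neqAle rn_ge0 andbT; apply/eqP => /esym/rn0_eq0 h.
by rewrite h eqxx in z0.
Qed.

End ComplexModulus.

(** * Roots of unity *)
Section RootsOfUnity.
Context {R : realType}.
Local Notation C := R[i].

Lemma expiD (a b : R) : expi (a + b) = expi a * expi b.
Proof.
rewrite /expi cosD sinD; apply/eqP; rewrite eq_complex /= eqxx /=.
by apply/eqP; ring.
Qed.

Lemma expi0 : expi 0 = 1 :> C.
Proof. by rewrite /expi cos0 sin0. Qed.

Lemma expi_mulrn (a : R) k : expi (a *+ k) = expi a ^+ k.
Proof.
by elim: k => [|k IH]; rewrite ?mulr0n ?expi0// mulrS expiD IH exprS.
Qed.

Lemma rn_expi (a : R) : rn (expi a) = 1.
Proof. by rewrite /rn normc_def /= cos2Dsin2 sqrtr1. Qed.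

Lemma sqr_rn (z : C) : rn z ^+ 2 = complex.Re z ^+ 2 + complex.Im z ^+ 2.
Proof. by rewrite /rn normc_def /= sqr_sqrtr // addr_ge0 // sqr_ge0. Qed.

Lemma polar (z : C) : exists a : R, z = (rn z)%:C * expi a.
Proof.
have [->|z0] := eqVneq z 0; first by exists 0; rewrite rn0 mul0r.
have rz : rn z != 0 by rewrite gt_eqF // rn_gt0.
set x := complex.Re z / rn z; set y := complex.Im z / rn z.
have xy : x ^+ 2 + y ^+ 2 = 1.
  by rewrite /x /y !expr_div_n -mulrDl -sqr_rn divff // expf_eq0.
have x1 : -1 <= x <= 1.
  by rewrite -ler_norml -(@expr_le1 _ 2) // real_normK ?num_real // -xy lerDl sqr_ge0.
have hx : x * rn z = complex.Re z by rewrite /x divfK.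
have hy : y * rn z = complex.Im z by rewrite /y divfK.
have sy : Num.sqrt (1 - x ^+ 2) = `|y| by rewrite -xy addrC addKr sqrtr_sqr.
have [y0|y0] := leP 0 y.
  exists (acos x); rewrite /expi acosK // sin_acos // sy ger0_norm //.
  by apply/eqP; rewrite eq_complex /= -hx -hy; apply/andP; split; apply/eqP; ring.
exists (- acos x); rewrite /expi cosN sinN acosK // sin_acos // sy ltr0_norm //.
by apply/eqP; rewrite eq_complex /= -hx -hy; apply/andP; split; apply/eqP; ring.
Qed.

(** The chord between neighbouring N-th roots of unity shrinks with N. *)
Lemma fine_primitive_root (K : nat) (e : R) : 0 < e ->
  exists N (w : C), [/\ (K < N)%N, N.-primitive_root w, rn w = 1 & rn (w - 1) <= e].
Proof.
move=> e0.
have [d d0 hd] : exists2 d : R, 0 < d &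
    forall a, `|a| < d -> rn (expi a - 1) <= e.
  have e20 : 0 < e / 2 by rewrite divr_gt0.
  have /cvgrPdist_lt /(_ _ e20) hc := @continuous_cos R 0.
  have /cvgrPdist_lt /(_ _ e20) hs := @continuous_sin R 0.
  have [d /= d0 hd] := filterI hc hs; exists d => // a ad.
  have [] := hd a; first by rewrite /ball /= sub0r normrN.
  rewrite cos0 sin0 sub0r normrN distrC => h1 h2.
  apply: le_trans (rn_ReIm _) _; rewrite /= subr0.
  by rewrite (splitr e) ltW // ltrD.
have pi2 : 0 < 2 * pi :> R by rewrite mulr_gt0 // pi_gt0.
pose N := (maxn K.+1 (Num.truncn (2 * pi / d)).+1).
have N0 : (0 < N)%N by rewrite leq_max.
have NR0 : 0 < N%:R :> R by rewrite ltr0n.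
pose a : R := 2 * pi / N%:R.
have a0 : 0 < a by rewrite divr_gt0.
have aN : a *+ N = 2 * pi by rewrite -[a *+ N]mulr_natr /a divfK // gt_eqF.
have wN : expi a ^+ N = 1 :> C.
  rewrite -expi_mulrn aN mulr_natl /expi.
  by rewrite -[pi *+ 2]add0r cosD2pi sinD2pi cos0 sin0.
exists N, (expi a); split => //; last 2 first.
- exact: rn_expi.
- apply: hd; rewrite gtr0_norm // ltr_pdivrMr // [d * _]mulrC -ltr_pdivrMr //.
  apply: lt_le_trans (truncnS_gt _) _.
  by rewrite ler_nat /N leq_max leqnn orbT.
- by rewrite /N leq_max leqnn.
apply/andP; split; first by [].
apply/forallP => i; apply/eqP; have [->|iN] := eqVneq i.+1 N.
  by rewrite unity_rootE wN eqxx.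
have iN' : (i.+1 < N)%N by rewrite ltn_neqAle iN ltn_ord.
apply/negbTE/negP => /unity_rootP; rewrite -expi_mulrn => h.
have := congr1 (@complex.Re R) h; rewrite /= => hc.
have sin_half : sin (a *+ i.+1 / 2) = 0.
  have : cos ((a *+ i.+1 / 2) *+ 2) = 1.
    by rewrite -[RHS]hc; congr cos; rewrite -[_ *+ 2]mulr_natr divfK // pnatr_eq0.
  by rewrite cos_mulr2n cos2sin2 => hh; apply/eqP; rewrite -sqrf_eq0; apply/eqP; lra.
have : 0 < sin (a *+ i.+1 / 2).
  apply: sin_gt0_pi; apply/andP; split; first by apply: divr_gt0 => //; rewrite pmulrn_rgt0.
  by rewrite ltr_pdivrMr // [pi * 2]mulrC -aN -!(mulr_natr a) ltr_pM2l // ltr_nat.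
by rewrite sin_half ltxx.
Qed.

Lemma sum_powers_root (z : C) N : z ^+ N = 1 -> z != 1 -> \sum_(j < N) z ^+ j = 0.
Proof.
move=> zN z1; have := subrX1 z N; rewrite zN subrr => /esym/eqP.
by rewrite mulf_eq0 subr_eq0 (negbTE z1) /= => /eqP.
Qed.

End RootsOfUnity.

(** * Approximation by polynomials *)

(** Mean value inequality, by real induction on [[0, 1]]: a local bound on the growth
    at every time, with one constant, adds up along the interval. *)
Lemma growth_bound (R : realType) (V : normedModType R[i]) (g : R -> V) (M : R) :
  (forall t, 0 <= t <= 1 -> exists2 d, 0 < d &
     forall s, 0 <= s <= 1 -> `|s - t| < d -> rn (g s - g t) <= M * `|s - t|) ->
  rn (g 1 - g 0) <= M.
Proof.
move=> hg; pose T := [set t | 0 <= t <= 1 /\ rn (g t - g 0) <= M * t].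
have T0 : T 0 by split; rewrite ?lexx ?ler01 // subrr rn0 mulr0.
have ubT : ubound T 1 by move=> t [/andP[]].
have supT : has_sup T by split; [exists 0|exists 1].
pose u := sup T.
have u0 : 0 <= u by apply: ub_le_sup => //; exists 1.
have u1 : u <= 1 by apply: ge_sup => //; exists 0.
have u01 : 0 <= u <= 1 by rewrite u0.
have [d d0 hd] := hg u u01.
have Tu : rn (g u - g 0) <= M * u.
  have [t [t01 tT] tu] := sup_adherent d0 supT.
  have tleu : t <= u by apply: ub_le_sup => //; exists 1.
  have ad : `|t - u| < d by rewrite distrC ger0_norm ?subr_ge0 //; move: tu; rewrite -/u; lra.
  have := hd t t01 ad; rewrite rn_distC distrC ger0_norm ?subr_ge0 // => h.
  apply: le_trans (rn_sub_triangle _ (g t) _) _; lra.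
have [u1'|u1'] := leP 1 u.
  have -> : 1 = u by apply/le_anti; rewrite u1 u1'.
  apply: le_trans Tu _; have -> : u = 1 by apply/le_anti; rewrite u1 u1'.
  by rewrite mulr1.
pose s := Num.min 1 (u + d / 2).
have d20 : 0 < d / 2 by rewrite divr_gt0.
have us : u < s by rewrite lt_min u1' ltrDl.
have s1 : s <= 1 by rewrite ge_min lexx.
have sd : s <= u + d / 2 by rewrite ge_min lexx orbT.
have s01 : 0 <= s <= 1 by rewrite s1 (le_trans u0) // ltW.
have nsu : `|s - u| = s - u by rewrite ger0_norm // subr_ge0 ltW.
have := hd s s01; rewrite nsu => /(_ _) h.
have {}h : rn (g s - g u) <= M * (s - u) by apply: h; lra.
have Ts : T s.
  split => //; apply: le_trans (rn_sub_triangle _ (g u) _) _; lra.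
have : s <= u by apply: ub_le_sup => //; exists 1.
by rewrite leNgt us.
Qed.

Section Interpolation.
Context {R : realType}.
Local Notation C := R[i].
Implicit Types (g : C -> C) (rho : R).

Definition approx_by_polys rho g :=
  forall e : R, 0 < e -> exists P : {poly C}, forall z, rn z <= rho -> rn (g z - P.[z]) <= e.

(** By compactness, this is what continuity of the derivative [g'] amounts to on the
    closed disc. *)
Definition uniformly_differentiable rho g (g' : C -> C) :=
  forall e : R, 0 < e -> exists2 d : R, 0 < d & forall x y : C,
    rn x <= rho -> rn y <= rho -> rn (y - x) <= d ->
    rn (g y - g x - g' x * (y - x)) <= e * rn (y - x).

Lemma rn_le_convex (x y : C) (l rho : R) : 0 <= l <= 1 -> rn x <= rho -> rn y <= rho ->
  rn (x + l%:C * (y - x)) <= rho.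
Proof.
move=> /andP[l0 l1] hx hy.
have -> : x + l%:C * (y - x) = (1 - l)%:C * x + l%:C * y.
  by rewrite rmorphB rmorph1; ring.
apply: le_trans (rn_triangle _ _) _; rewrite !rnM !rn_real !ger0_norm ?subr_ge0 //.
have -> : rho = (1 - l) * rho + l * rho by ring.
by apply: lerD; apply: ler_wpM2l; rewrite ?subr_ge0.
Qed.

(** The Lagrange interpolants of [g] at the points [rho * w ^ j], with [w] a
    primitive [N]-th root of unity, converge uniformly to [g] on the whole closed
    disc.  For [x] in the disc let [S l] be the weighted sum of the values of [g]
    at the nodes contracted towards [x] by the factor [l]: then [S 0 = g x], while
    [S 1] is the interpolant.  The derivative of [S] is a multiple of the sum of
    [g' * z] over a regular polygon, a discrete contour integral of [g'], which telescopes up to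
    the error of the linear approximation of [g]. *)
Lemma approx_by_polys_of_differentiable rho g g' : 0 < rho ->
  uniformly_differentiable rho g g' -> approx_by_polys rho g.
Proof.
move=> r0 hg e e0; pose e1 := e / (4 * rho).
have e10 : 0 < e1 by rewrite divr_gt0 // mulr_gt0.
have [d d0 hd] := hg _ e10.
have dr0 : 0 < d / rho by rewrite divr_gt0.
have [N [w [N1 wprim rw wd]]] := fine_primitive_root 1 dr0.
have N0 : (0 < N)%N by apply: ltn_trans N1.
have NR0 : 0 < N%:R :> R by rewrite ltr0n.
have NC : (N%:R : C) != 0 by rewrite pnatr_eq0 -lt0n.
have wN : w ^+ N = 1 by apply: prim_expr_order.
have w0 : w != 0 by rewrite -rn_gt0 rw.
have w1 : w != 1.
  apply/eqP => h; have := prim_order_dvd wprim 1; rewrite h expr1n eqxx.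
  by rewrite dvdn1 => /eqP h1; rewrite h1 in N1.
pose z (j : nat) : C := rho%:C * w ^+ j.
have rz j : rn (z j) = rho by rewrite rnM rnX rw expr1n mulr1 rn_real gtr0_norm.
have z0 j : z j != 0 by rewrite -rn_gt0 rz.
have zS j : z j.+1 - z j = (w - 1) * z j by rewrite /z exprS; ring.
pose P := \poly_(k < N) (N%:R^-1 * \sum_(j < N) g (z j) * (z j)^-1 ^+ k).
exists P => x rx.
pose D j : C := \sum_(k < N) (x / z j) ^+ k.
pose X (l : R) j : C := x + l%:C * (z j - x).
pose S (l : R) : C := N%:R^-1 * \sum_(j < N) g (X l j) * D j.
have S1 : S 1 = P.[x].
  rewrite horner_poly /S mulr_sumr.
  under eq_bigr => j _ do rewrite /X mul1r subrKC /D mulr_sumr mulr_sumr.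
  rewrite exchange_big /=; apply: eq_bigr => k _.
  rewrite mulr_sumr mulr_suml; apply: eq_bigr => j _.
  by rewrite exprMn; ring.
have S0 : S 0 = g x.
  rewrite /S; under eq_bigr => j _ do rewrite /X mul0r addr0 /D.
  rewrite -mulr_sumr exchange_big /=.
  rewrite (bigD1 (Ordinal N0)) //= [X in _ + X]big1 => [|k k0].
    rewrite addr0; under eq_bigr => j _ do rewrite expr0.
    by rewrite sumr_const card_ord mulrCA mulVf ?mulr1.
  have -> : \sum_(j < N) (x / z j) ^+ k =
            (x / rho%:C) ^+ k * \sum_(j < N) (w^-1 ^+ k) ^+ j.
    rewrite mulr_sumr; apply: eq_bigr => j _.
    by rewrite -exprM mulnC exprM -exprMn /z invfM exprVn mulrA.
  rewrite sum_powers_root ?mulr0 //.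
    by rewrite -exprM mulnC exprM exprVn wN invr1 expr1n.
  rewrite exprVn invr_eq1 -(prim_order_dvd wprim).
  have kn0 : (0 < k)%N by rewrite lt0n.
  by apply/negP => /(dvdn_leq kn0); rewrite leqNgt ltn_ord.
rewrite -S1 -S0 rn_distC.
(* the kernel D is designed to clear the denominator z j - x *)
have HD j : D j * (z j - x) = z j * (1 - (x / rho%:C) ^+ N).
  have := subrX1 (x / z j) N; rewrite -/(D j) => h.
  have -> : (x / rho%:C) ^+ N = (x / z j) ^+ N.
    rewrite !exprMn /z; congr (_ * _); rewrite !exprVn; congr (_^-1).
    by rewrite exprMn -exprM mulnC exprM wN expr1n mulr1.
  have -> : 1 - (x / z j) ^+ N = - ((x / z j - 1) * D j) by rewrite -h opprB.
  have -> : z j * - ((x / z j - 1) * D j) = z j * D j - x * D j * (z j / z j) by ring.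
  by rewrite divff //; ring.
have rnD j : rn (D j) <= N%:R.
  apply: le_trans (rn_sum _ _ _) _; rewrite -[N in N%:R]card_ord -sumr_const.
  apply: ler_sum => k _; rewrite rnX exprn_ile1 ?rn_ge0 //.
  by rewrite rnM rnV rz ler_pdivrMr // mul1r.
have rX l j : 0 <= l <= 1 -> rn (X l j) <= rho.
  by move=> hl; apply: rn_le_convex => //; rewrite rz.
have claim1 l : 0 <= l <= 1 -> rn (\sum_(j < N) g' (X l j) * z j) <= N%:R * (rho * e1).
  move=> l01; have /andP[l0 l1] := l01.
  have [->|ln0] := eqVneq l 0.
    under eq_bigr => j _ do rewrite /X mul0r addr0 /z.
    rewrite -!mulr_sumr sum_powers_root // !mulr0 rn0.
    by apply: mulr_ge0 => //; apply: mulr_ge0; apply: ltW.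
  have lp : 0 < l by rewrite lt_neqAle eq_sym ln0.
  have XS j : X l j.+1 - X l j = (l%:C * (w - 1)) * z j.
    rewrite -mulrA -zS /X; ring.
  pose err j := g (X l j.+1) - g (X l j) - g' (X l j) * (X l j.+1 - X l j).
  have lw0 : 0 < l * rn (w - 1) by rewrite mulr_gt0 // rn_gt0 subr_eq0.
  have herr j : rn (err j) <= l * rn (w - 1) * (rho * e1).
    have hx : rn (X l j.+1 - X l j) = l * rn (w - 1) * rho.
      by rewrite XS rnM rz rnM rn_real gtr0_norm.
    apply: le_trans (hd _ _ (rX _ _ l01) (rX _ _ l01) _) _; last by rewrite hx; lra.
    rewrite hx; apply: (@le_trans _ _ (1 * (d / rho) * rho)); last by rewrite mul1r divfK ?gt_eqF.
    by apply: ler_wpM2r; rewrite ?(ltW r0) //; apply: ler_pM; rewrite ?rn_ge0.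
  have sumerr : \sum_(j < N) err j = - ((l%:C * (w - 1)) * \sum_(j < N) g' (X l j) * z j).
    rewrite /err sumrB mulr_sumr.
    have -> : \sum_(j < N) (g (X l j.+1) - g (X l j)) = 0.
      rewrite -(big_mkord xpredT (fun j => g (X l j.+1) - g (X l j))).
      by rewrite telescope_sumr // /X /z wN expr0 subrr.
    rewrite sub0r; congr (- _); apply: eq_bigr => j _; rewrite XS; ring.
  have : rn (\sum_(j < N) err j) <= N%:R * (l * rn (w - 1) * (rho * e1)).
    apply: le_trans (rn_sum _ _ _) _; rewrite -[N in N%:R]card_ord mulr_natl -sumr_const.
    by apply: ler_sum => j _.
  rewrite sumerr rnN !rnM rn_real gtr0_norm // mulrCA ler_pM2l //.
apply: (@le_trans _ _ (4 * rho * e1)); last first.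
  by rewrite /e1 mulrC divfK // gt_eqF // mulr_gt0.
apply: growth_bound => t t01.
have [d2 d20 hd2] := hg (e1 / N%:R) (divr_gt0 e10 NR0).
have rho20 : 0 < 2 * rho by rewrite mulr_gt0.
have step a b : 0 <= a <= 1 -> 0 <= b <= 1 -> a <= b -> b - a < d2 / (2 * rho) ->
    rn (S b - S a) <= 4 * rho * e1 * (b - a).
  move=> ha hb ab hab.
  have ba0 : 0 <= b - a by rewrite subr_ge0.
  pose err j := g (X b j) - g (X a j) - g' (X a j) * (X b j - X a j).
  have hX j : X b j - X a j = (b - a)%:C * (z j - x) by rewrite /X rmorphB; ring.
  have hr j : rn (z j - x) <= 2 * rho.
    by apply: le_trans (rn_triangle _ _) _; rewrite rnN rz; lra.
  have hrX j : rn (X b j - X a j) <= (b - a) * (2 * rho).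
    by rewrite hX rnM rn_real ger0_norm // ler_wpM2l.
  have herr j : rn (err j) <= e1 / N%:R * ((b - a) * (2 * rho)).
    apply: le_trans (hd2 _ _ (rX _ _ ha) (rX _ _ hb) _) _.
      by apply: le_trans (hrX j) _; rewrite -ler_pdivlMr // ltW.
    by rewrite ler_wpM2l // divr_ge0 // ltW.
  have -> : S b - S a = N%:R^-1 *
      ((b - a)%:C * (1 - (x / rho%:C) ^+ N) * (\sum_(j < N) g' (X a j) * z j)
       + \sum_(j < N) err j * D j).
    rewrite /S -mulrBr; congr (_ * _); rewrite -sumrB mulr_sumr -big_split /=.
    apply: eq_bigr => j _; rewrite /err hX.
    have := HD j; set h := (x / _) ^+ _ => hh.
    have -> : (b - a)%:C * (1 - h) * (g' (X a j) * z j) =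
       (b - a)%:C * g' (X a j) * (D j * (z j - x)) by rewrite hh; ring.
    ring.
  rewrite rnM rnV /rn normr_nat -/(rn _).
  have -> : complex.Re (N%:R : C) = N%:R by rewrite -(rmorph_nat (real_complex R)).
  rewrite mulrC ler_pdivrMr //.
  apply: le_trans (rn_triangle _ _) _.
  have h1 : rn ((b - a)%:C * (1 - (x / rho%:C) ^+ N) * (\sum_(j < N) g' (X a j) * z j))
      <= (b - a) * 2 * (N%:R * (rho * e1)).
    rewrite !rnM; apply: ler_pM; rewrite ?mulr_ge0 ?rn_ge0 //; last exact: claim1.
    rewrite rn_real ger0_norm // ler_wpM2l //.
    apply: le_trans (rn_triangle _ _) _; rewrite rnN rn1 rnX.
    have : rn (x / rho%:C) ^+ N <= 1.
      apply: exprn_ile1; rewrite ?rn_ge0 // rnM rnV rn_real gtr0_norm //.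
      by rewrite ler_pdivrMr // mul1r.
    lra.
  have h2 : rn (\sum_(j < N) err j * D j) <= N%:R * (e1 / N%:R * ((b - a) * (2 * rho)) * N%:R).
    apply: le_trans (rn_sum _ _ _) _; rewrite -[N in N%:R * _]card_ord mulr_natl -sumr_const.
    by apply: ler_sum => j _; rewrite rnM; apply: ler_pM; rewrite ?rn_ge0.
  have h3 : N%:R * (e1 / N%:R * ((b - a) * (2 * rho)) * N%:R) = N%:R * (2 * rho * e1 * (b - a)).
    by field; rewrite gt_eqF.
  rewrite h3 in h2; lra.
exists (d2 / (2 * rho)); first by rewrite divr_gt0.
move=> s s01 hs; have [ts|st] := leP t s.
  rewrite ger0_norm ?subr_ge0 //; apply: step => //.
  by move: hs; rewrite ger0_norm ?subr_ge0.
rewrite rn_distC distrC ger0_norm ?subr_ge0 ?(ltW st) //; apply: step => //; first exact: ltW.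
by move: hs; rewrite distrC ger0_norm ?subr_ge0 ?(ltW st).
Qed.

End Interpolation.

(** * Taylor expansions and Schwarz's lemma *)

Section TaylorExpansion.
Context {R : realType}.
Local Notation C := R[i].
Implicit Types (g : C -> C) (rho A : R) (P : {poly C}).

Lemma rn_natr (n : nat) : rn (n%:R : C) = n%:R.
Proof. by rewrite -(rmorph_nat (real_complex R)) rn_real normr_nat. Qed.

(** Averaging over roots of unity isolates one coefficient: Cauchy's estimate. *)
Lemma cauchy_estimate P rho A k : 0 < rho ->
  (forall z, rn z <= rho -> rn P.[z] <= A) -> rn P`_k * rho ^+ k <= A.
Proof.
move=> r0 hP.
have [N [w [N1 wprim rw _]]] := fine_primitive_root (maxn (size P) k) (@ltr01 R).
move: N1; rewrite gtn_max => /andP[PN kN].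
have N0 : (0 < N)%N by apply: leq_ltn_trans kN.
have NR0 : 0 < N%:R :> R by rewrite ltr0n.
have wN : w ^+ N = 1 by apply: prim_expr_order.
have w0 : w != 0 by rewrite -rn_gt0 rw.
pose z (j : nat) : C := rho%:C * w ^+ j.
have rz j : rn (z j) = rho by rewrite rnM rnX rw expr1n mulr1 rn_real gtr0_norm.
have sumE : \sum_(j < N) P.[z j] * (w ^- k) ^+ j = N%:R * (P`_k * rho%:C ^+ k).
  under eq_bigr => j _ do rewrite (@horner_coef_wide _ N) 1?ltnW// mulr_suml.
  rewrite exchange_big /= (bigD1 (Ordinal kN)) //= [X in _ + X]big1 => [|i ik].
    rewrite addr0; under eq_bigr => j _.
      have -> : P`_k * z j ^+ k * w ^- k ^+ j = P`_k * rho%:C ^+ k * ((w ^+ k) ^+ j * w ^- k ^+ j).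
        by rewrite /z exprMn -!exprM [(j * k)%N]mulnC !mulrA.
      rewrite -exprMn divff ?expf_neq0 // expr1n mulr1; over.
    by rewrite sumr_const card_ord mulr_natl.
  have -> : \sum_(j < N) P`_i * z j ^+ i * (w ^- k) ^+ j =
     P`_i * rho%:C ^+ i * \sum_(j < N) (w ^+ i * w ^- k) ^+ j.
    rewrite mulr_sumr; apply: eq_bigr => j _.
    by rewrite /z !exprMn -!exprM [(j * i)%N]mulnC !mulrA.
  rewrite sum_powers_root ?mulr0 //.
    by rewrite exprMn exprVn -!exprM ![(_ * N)%N]mulnC !exprM wN !expr1n invr1 mulr1.
  apply/eqP => h; have : w ^+ i == w ^+ k.
    by rewrite -subr_eq0 -(mulIr_eq0 _ (mulIf (invr_neq0 (expf_neq0 k w0)))) mulrBl h divff ?subrr // expf_neq0.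
  rewrite (eq_prim_root_expr wprim) !modn_small // => ik'.
  by rewrite -val_eqE /= ik' in ik.
have bound : N%:R * (rn P`_k * rho ^+ k) <= N%:R * A.
  have -> : N%:R * (rn P`_k * rho ^+ k) = rn (N%:R * (P`_k * rho%:C ^+ k)).
    by rewrite !rnM rnX rn_real gtr0_norm // rn_natr.
  rewrite -sumE; apply: le_trans (rn_sum _ _ _) _.
  rewrite -[N in N%:R]card_ord mulr_natl -sumr_const; apply: ler_sum => j _.
  by rewrite rnM rnX rnV rnX rw expr1n invr1 expr1n mulr1 hP // rz.
by rewrite ler_pM2l in bound.
Qed.

Lemma geometric_sum_le2 (q : R) m : 0 <= q <= 2^-1 -> \sum_(i < m) q ^+ i <= 2.
Proof.
move=> /andP[q0 q1]; have := subrX1 q m; have : 0 <= q ^+ m by apply: exprn_ge0.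
have : 0 <= \sum_(i < m) q ^+ i by apply: sumr_ge0 => i _; apply: exprn_ge0.
set S := \sum_(_ < _) _; nra.
Qed.

Lemma poly_taylor_remainder P rho A K z : 0 < rho ->
  (forall z, rn z <= rho -> rn P.[z] <= A) -> rn z <= rho / 2 ->
  rn (P.[z] - \sum_(k < K) P`_k * z ^+ k) <= 2 * A * (rn z / rho) ^+ K.
Proof.
move=> r0 hP hz; rewrite (@horner_coef_wide _ (K + size P)) ?leq_addl //.
rewrite big_split_ord /= addrAC subrr add0r.
set q := rn z / rho.
have q0 : 0 <= q by rewrite divr_ge0 ?rn_ge0 // ltW.
have q01 : 0 <= q <= 2^-1.
  by rewrite q0 /q ler_pdivrMr // mulrC.
have A0 : 0 <= A by apply: le_trans (rn_ge0 _) (hP 0 _); rewrite rn0 ltW.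
apply: le_trans (rn_sum _ _ _) _.
apply: (@le_trans _ _ (\sum_(i < size P) A * q ^+ K * q ^+ i)).
  apply: ler_sum => i _; rewrite rnM rnX.
  have := cauchy_estimate (K + i) r0 hP; rewrite -mulrA -exprD.
  have -> : rn z = rho * q by rewrite /q mulrC divfK // gt_eqF.
  rewrite exprMn mulrA => h; apply: ler_wpM2r => //; exact: exprn_ge0.
rewrite -mulr_sumr.
have := geometric_sum_le2 (size P) q01; have : 0 <= A * q ^+ K by rewrite mulr_ge0 // exprn_ge0.
set S := \sum_(_ < _) _; nra.
Qed.

Lemma le_of_harmonic (x y B : R) : (forall n, x <= y + B * harmonic n) -> x <= y.
Proof.
move=> h; apply/ler_addgt0Pr => e e0.
have [B0|B0] := leP B 0.
  apply: le_trans (h 0%N) _; have := harmonic_gt0 (R := R) 0; nra.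
pose n := Num.truncn (B / e).
apply: le_trans (h n) _; rewrite lerD2l /harmonic /= ler_pdivrMr // mulrC -ler_pdivrMr //.
exact: ltW (truncnS_gt _).
Qed.

(** The limit is the supremum of the lower bounds [u n - e n]. *)
Lemma real_limit (u e : nat -> R) : (forall n m, `|u n - u m| <= e n + e m) ->
  exists l, forall n, `|u n - l| <= e n.
Proof.
move=> h; pose T := range (fun n => u n - e n).
have hub n : ubound T (u n + e n).
  by move=> _ [m _ <-]; have := h m n; rewrite ler_norml => /andP[_]; lra.
have hT : has_sup T by split; [exists (u 0%N - e 0%N), 0%N | exists (u 0%N + e 0%N)].
exists (sup T) => n; have h1 : sup T <= u n + e n.
  by apply: ge_sup; [exists (u 0%N - e 0%N), 0%N | exact: hub].
have h2 : u n - e n <= sup T.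
  by apply: ub_le_sup; [exists (u 0%N + e 0%N) | exists n].
by rewrite ler_norml; apply/andP; split; lra.
Qed.

Lemma complex_limit (u : nat -> C) (e : nat -> R) :
  (forall n m, rn (u n - u m) <= e n + e m) ->
  exists l, forall n, rn (u n - l) <= 2 * e n.
Proof.
move=> h.
have ReB (x y : C) : complex.Re (x - y) = complex.Re x - complex.Re y.
  by case: x y => ? ? [].
have ImB (x y : C) : complex.Im (x - y) = complex.Im x - complex.Im y.
  by case: x y => ? ? [].
have [|a ha] := @real_limit (fun n => complex.Re (u n)) e.
  by move=> n m; apply: le_trans (h n m); rewrite -ReB normRe_le.
have [|b hb] := @real_limit (fun n => complex.Im (u n)) e.
  by move=> n m; apply: le_trans (h n m); rewrite -ImB normIm_le.
exists (a +i* b) => n; apply: le_trans (rn_ReIm _) _.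
rewrite ReB ImB /=; have := ha n; have := hb n; lra.
Qed.

(** By Cauchy's estimate the coefficients of the approximating polynomials form Cauchy
    sequences; the remainder estimates, uniform in the polynomial, pass to the limit. *)
Lemma taylor_expansion g rho A : 0 < rho -> approx_by_polys rho g ->
  (forall z, rn z <= rho -> rn (g z) <= A) ->
  exists c : nat -> C, (forall k, rn (c k) * rho ^+ k <= A) /\
    forall K z, rn z <= rho / 2 ->
      rn (g z - \sum_(k < K) c k * z ^+ k) <= 2 * A * (rn z / rho) ^+ K.
Proof.
move=> r0 hg hA.
have [P hP] := choice (fun n => hg (harmonic n) (harmonic_gt0 (R := R) n)).
have bP n z : rn z <= rho -> rn (P n).[z] <= A + harmonic n.
  move=> hz; have := hP n z hz; have := hA z hz; rewrite (rn_distC (g z)).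
  have := rn_triangle ((P n).[z] - g z) (g z); rewrite subrK; lra.
have rk0 k : 0 < rho ^+ k by apply: exprn_gt0.
have cP k n m : rn ((P n)`_k * rho%:C ^+ k - (P m)`_k * rho%:C ^+ k) <= harmonic n + harmonic m.
  rewrite -mulrBl rnM rnX rn_real gtr0_norm // -coefB.
  apply: cauchy_estimate => // z hz; rewrite hornerD hornerN.
  apply: le_trans (rn_sub_triangle _ (g z) _) _; rewrite rn_distC.
  by apply: lerD; apply: hP.
have [l hl] := choice (fun k => complex_limit (cP k)).
pose c k := l k / rho%:C ^+ k.
have rC k : (rho%:C : C) ^+ k != 0 by rewrite expf_neq0 // -rn_gt0 rn_real gtr0_norm.
have hc k n : rn ((P n)`_k - c k) * rho ^+ k <= 2 * harmonic n.
  have := hl k n; have -> : l k = c k * rho%:C ^+ k by rewrite /c divfK.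
  by rewrite -mulrBl rnM rnX rn_real gtr0_norm.
exists c; split => [k|K z hz].
  apply: (@le_of_harmonic _ _ 3) => n.
  have := cauchy_estimate k r0 (bP n); have := hc k n; rewrite rn_distC.
  have := rn_triangle (c k - (P n)`_k) ((P n)`_k); rewrite subrK.
  have := rk0 k; nra.
set q := rn z / rho.
have q0 : 0 <= q by rewrite divr_ge0 ?rn_ge0 // ltW.
have q12 : q <= 2^-1 by rewrite /q ler_pdivrMr // mulrC.
have hz1 : rn z <= rho by apply: le_trans hz _; lra.
apply: (@le_of_harmonic _ _ (7)) => n.
have h1 := hP n z hz1.
have h2 := poly_taylor_remainder K r0 (bP n) hz.
have h3 : rn (\sum_(k < K) (P n)`_k * z ^+ k - \sum_(k < K) c k * z ^+ k) <= 4 * harmonic n.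
  rewrite -sumrB; apply: le_trans (rn_sum _ _ _) _.
  apply: (@le_trans _ _ (\sum_(k < K) 2 * harmonic n * q ^+ k)).
    apply: ler_sum => k _; rewrite -mulrBl rnM rnX.
    have -> : rn z = rho * q by rewrite /q mulrC divfK // gt_eqF.
    by rewrite exprMn mulrA ler_wpM2r ?exprn_ge0.
  rewrite -mulr_sumr.
  have := geometric_sum_le2 K (q := q); rewrite q0 q12 => /(_ isT).
  have := harmonic_gt0 (R := R) n; nra.
have h4 : q ^+ K <= 1 by apply: exprn_ile1 => //; lra.
have h5 : 0 <= q ^+ K by apply: exprn_ge0.
apply: le_trans (rn_sub_triangle _ (P n).[z] _) _.
have := rn_sub_triangle (P n).[z] (\sum_(k < K) (P n)`_k * z ^+ k) (\sum_(k < K) c k * z ^+ k).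
have := harmonic_gt0 (R := R) n; rewrite -/q in h2; nra.
Qed.

(** The restriction of [g] to the positive real axis is [o(t ^ m)] at 0. *)
Definition flat_to m g :=
  forall e : R, 0 < e -> exists2 d : R, 0 < d & forall t : R, 0 < t < d -> rn (g t%:C) <= e * t ^+ m.

Lemma taylor_coef_flat g rho B (c : nat -> C) m : 0 < rho ->
  (forall K z, rn z <= rho / 2 ->
      rn (g z - \sum_(k < K) c k * z ^+ k) <= B * (rn z / rho) ^+ K) ->
  flat_to m g -> forall k, (k <= m)%N -> c k = 0.
Proof.
move=> r0 hg hm; elim/ltn_ind => k IH km.
have B0 : 0 <= B.
  by have := hg 0%N 0; rewrite rn0 expr0 mulr1 => h; apply: le_trans (rn_ge0 _) (h _); lra.
have ck : rn (c k) <= 0.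
  apply/ler_addgt0Pr => e e0; rewrite add0r.
  have e20 : 0 < e / 2 by lra.
  have [d d0 hd] := hm _ e20.
  pose M := B / rho ^+ k.+1.
  have M0 : 0 <= M by rewrite divr_ge0 // exprn_ge0 // ltW.
  pose t := Num.min (Num.min (d / 2) 1) (Num.min (rho / 2) (e / (2 * (M + 1)))).
  have M10 : 0 < 2 * (M + 1) by lra.
  have t0 : 0 < t by rewrite !lt_min ltr01 !divr_gt0.
  have [td t1 tr te] : [/\ t <= d / 2, t <= 1, t <= rho / 2 & t <= e / (2 * (M + 1))].
    by split; rewrite /t !ge_min lexx ?orbT.
  have htd : 0 < t < d by rewrite t0; lra.
  have tr' : rn (t%:C : C) <= rho / 2 by rewrite rn_real gtr0_norm.
  have := hg k.+1 t%:C tr'; rewrite rn_real gtr0_norm // big_ord_recr /= big1 => [|i _]; last first.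
    by rewrite (IH i) ?mul0r // (leq_trans (ltnW (ltn_ord i))).
  rewrite add0r expr_div_n => h1.
  have {}h1 : rn (g t%:C - c k * t%:C ^+ k) <= M * t ^+ k.+1 by rewrite /M mulrAC -mulrA.
  have h2 := hd t htd.
  have tk0 : 0 < t ^+ k by apply: exprn_gt0.
  have tm : t ^+ m <= t ^+ k by rewrite ler_wiXn2l // ltW.
  have h3 : rn (c k) * t ^+ k <= e / 2 * t ^+ k + M * t * t ^+ k.
    have <- : rn (c k * t%:C ^+ k) = rn (c k) * t ^+ k by rewrite rnM rnX rn_real gtr0_norm.
    have := rn_sub_triangle 0 (g t%:C) (c k * t%:C ^+ k); rewrite !sub0r !rnN.
    rewrite exprS mulrA in h1; nra.
  rewrite -mulrDl ler_pM2r // in h3.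
  have : M * t <= e / 2.
    have : t * (2 * (M + 1)) <= e by rewrite -ler_pdivlMr //; lra.
    nra.
  lra.
apply: rn0_eq0; apply/le_anti; rewrite ck; exact: rn_ge0.
Qed.

(** Schwarz's lemma with a zero of order [m.+1]; the constant depends only on the
    bound of [g], which is what allows passing to limits of difference quotients. *)
Lemma schwarz g rho A m z : 0 < rho -> approx_by_polys rho g ->
  (forall z, rn z <= rho -> rn (g z) <= A) -> flat_to m g -> rn z <= rho / 2 ->
  rn (g z) <= 2 * A * (rn z / rho) ^+ m.+1.
Proof.
move=> r0 hg hA hm hz; have [c [_ hc]] := taylor_expansion r0 hg hA.
have := hc m.+1 z hz; rewrite big1 ?subr0 // => k _.
by rewrite (taylor_coef_flat r0 hc hm) ?mul0r // -ltnS.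
Qed.

End TaylorExpansion.

(** * Holomorphic functions of the unit disc *)

Section DiscHolomorphic.
Context {R : realType}.
Local Notation C := R[i].
Implicit Types (f g : C -> C) (rho A : R).

Lemma poly_bounded (P : {poly C}) rho : exists A, forall z, rn z <= rho -> rn P.[z] <= A.
Proof.
exists (\sum_(k < size P) rn P`_k * rho ^+ k) => z hz; rewrite horner_coef.
apply: le_trans (rn_sum _ _ _) _; apply: ler_sum => k _.
by rewrite rnM rnX ler_wpM2l ?rn_ge0 // lerXn2r ?nnegrE ?rn_ge0 // (le_trans (rn_ge0 z)).
Qed.

Lemma approx_bounded g rho : approx_by_polys rho g ->
  exists2 A : R, 0 < A & forall z, rn z <= rho -> rn (g z) <= A.
Proof.
move=> /(_ 1 ltr01)[P hP]; have [A hA] := poly_bounded P rho.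
exists (`|A| + 1) => [|z hz]; first by rewrite ltr_wpDl.
have := rn_triangle (g z - P.[z]) P.[z]; rewrite subrK => h; apply: le_trans h _.
by rewrite addrC lerD ?hP // (le_trans (hA z hz)) // ler_norm.
Qed.

Lemma approx_poly rho (P : {poly C}) : approx_by_polys rho (horner P).
Proof. by move=> e e0; exists P => z _; rewrite subrr rn0 ltW. Qed.

Lemma approx_eq rho f g : (forall z, rn z <= rho -> f z = g z) ->
  approx_by_polys rho f -> approx_by_polys rho g.
Proof. by move=> fg hf e /hf[P hP]; exists P => z hz; rewrite -fg // hP. Qed.

Lemma approxD rho f g : approx_by_polys rho f -> approx_by_polys rho g ->
  approx_by_polys rho (fun z => f z + g z).
Proof.
move=> hf hg e e0; have e20 : 0 < e / 2 by lra.
have [P hP] := hf _ e20; have [Q hQ] := hg _ e20.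
exists (P + Q) => z hz; rewrite hornerD opprD addrACA.
apply: le_trans (rn_triangle _ _) _; have := hP z hz; have := hQ z hz; lra.
Qed.

Lemma approxM rho f g : approx_by_polys rho f -> approx_by_polys rho g ->
  approx_by_polys rho (fun z => f z * g z).
Proof.
move=> hf hg e e0.
have [A A0 hA] := approx_bounded hf; have [B B0 hB] := approx_bounded hg.
pose d := Num.min 1 (e / (2 * (A + B + 1))).
have d0 : 0 < d by rewrite lt_min ltr01 divr_gt0 //; lra.
have d1 : d <= 1 by rewrite ge_min lexx.
have de : d * (2 * (A + B + 1)) <= e by rewrite -ler_pdivlMr; [rewrite ge_min lexx orbT | lra].
have [P hP] := hf _ d0; have [Q hQ] := hg _ d0.
exists (P * Q) => z hz; rewrite hornerM.
have -> : f z * g z - P.[z] * Q.[z] = f z * (g z - Q.[z]) + (f z - P.[z]) * Q.[z] by ring.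
apply: le_trans (rn_triangle _ _) _; rewrite !rnM.
have := hP z hz; have := hQ z hz; have := hA z hz; have := hB z hz.
have := rn_triangle (Q.[z] - g z) (g z); rewrite subrK (rn_distC Q.[z]).
have := rn_ge0 (f z); have := rn_ge0 (g z - Q.[z]); have := rn_ge0 (f z - P.[z]); have := rn_ge0 Q.[z].
nra.
Qed.

Lemma approx_shift rho rho' (a : C) g : rn a + rho' <= rho -> approx_by_polys rho g ->
  approx_by_polys rho' (fun z => g (z + a)).
Proof.
move=> har hg e /hg[P hP]; exists (P \Po ('X + a%:P)) => z hz.
rewrite horner_comp hornerD hornerX hornerC; apply: hP.
by apply: le_trans (rn_triangle _ _) _; lra.
Qed.

Lemma approx_scale rho rho' (a : C) g : rn a * rho' <= rho -> approx_by_polys rho g ->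
  approx_by_polys rho' (fun z => g (z * a)).
Proof.
move=> har hg e /hg[P hP]; exists (P \Po ('X * a%:P)) => z hz.
rewrite horner_comp hornerM hornerX hornerC; apply: hP.
by apply: le_trans har; rewrite rnM mulrC ler_wpM2l ?rn_ge0.
Qed.

Lemma approx_limit rho g :
  (forall e : R, 0 < e -> exists2 f, approx_by_polys rho f &
     forall z, rn z <= rho -> rn (g z - f z) <= e) -> approx_by_polys rho g.
Proof.
move=> hg e e0; have e20 : 0 < e / 2 by lra.
have [f /(_ _ e20)[P hP] hf] := hg _ e20; exists P => z hz.
apply: le_trans (rn_sub_triangle _ (f z) _) _; have := hP z hz; have := hf z hz; lra.
Qed.

(** Holomorphic functions of the unit disc, described through Runge approximation:
    closure under sums, products and locally uniform limits is immediate. *)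
Definition disc_holo g := forall rho, 0 < rho < 1 -> approx_by_polys rho g.

Lemma disc_holo_eq f g : (forall z, rn z < 1 -> f z = g z) -> disc_holo f -> disc_holo g.
Proof.
move=> fg hf rho r01; apply: approx_eq (hf _ r01) => z hz; apply: fg.
by apply: le_lt_trans hz _; case/andP: r01.
Qed.

Lemma disc_holo_poly (P : {poly C}) : disc_holo (horner P).
Proof. by move=> rho _; apply: approx_poly. Qed.

Lemma disc_holo_cst (c : C) : disc_holo (fun=> c).
Proof.
by apply: disc_holo_eq (disc_holo_poly c%:P) => z _; rewrite hornerC.
Qed.

Lemma disc_holoD f g : disc_holo f -> disc_holo g -> disc_holo (fun z => f z + g z).
Proof. by move=> hf hg rho r; apply: approxD; [apply: hf|apply: hg]. Qed.

Lemma disc_holoM f g : disc_holo f -> disc_holo g -> disc_holo (fun z => f z * g z).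
Proof. by move=> hf hg rho r; apply: approxM; [apply: hf|apply: hg]. Qed.

Lemma disc_holo_sum I (r : seq I) (P : pred I) (F : I -> C -> C) :
  (forall i, P i -> disc_holo (F i)) -> disc_holo (fun z => \sum_(i <- r | P i) F i z).
Proof.
move=> hF; elim: r => [|i r IH].
  by apply: disc_holo_eq (disc_holo_cst 0) => z _; rewrite big_nil.
have [Pi|nPi] := boolP (P i); last first.
  by apply: disc_holo_eq IH => z _; rewrite big_cons (negbTE nPi).
by apply: disc_holo_eq (disc_holoD (hF i Pi) IH) => z _; rewrite big_cons Pi.
Qed.

Lemma disc_holo_prod I (r : seq I) (P : pred I) (F : I -> C -> C) :
  (forall i, P i -> disc_holo (F i)) -> disc_holo (fun z => \prod_(i <- r | P i) F i z).
Proof.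
move=> hF; elim: r => [|i r IH].
  by apply: disc_holo_eq (disc_holo_cst 1) => z _; rewrite big_nil.
have [Pi|nPi] := boolP (P i); last first.
  by apply: disc_holo_eq IH => z _; rewrite big_cons (negbTE nPi).
by apply: disc_holo_eq (disc_holoM (hF i Pi) IH) => z _; rewrite big_cons Pi.
Qed.

Lemma disc_holo_det n (M : C -> 'M[C]_n) : (forall i j, disc_holo (fun z => M z i j)) ->
  disc_holo (fun z => \det (M z)).
Proof.
move=> hM; apply: disc_holo_sum => s _; apply: disc_holoM; first exact: disc_holo_cst.
by apply: disc_holo_prod => i _.
Qed.

Lemma disc_holo_adj n (M : C -> 'M[C]_n) : (forall i j, disc_holo (fun z => M z i j)) ->
  forall i j, disc_holo (fun z => \adj (M z) i j).
Proof.
move=> hM i j; apply: (@disc_holo_eq (fun z => cofactor (M z) j i)) => [z _|].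
  by rewrite mxE.
apply: disc_holoM; first exact: disc_holo_cst.
apply: disc_holo_det => a b; apply: disc_holo_eq (hM (lift j a) (lift i b)) => z _.
by rewrite !mxE.
Qed.

(** On the real axis this is the complex conjugate of [g]: conjugation there does
    not leave the class of restrictions of holomorphic functions. *)
Definition reflect_conj g (z : C) : C := (g z^*%C)^*%C.

Lemma disc_holo_conj g : disc_holo g -> disc_holo (reflect_conj g).
Proof.
move=> hg rho r01 e e0; have [P hP] := hg rho r01 e e0.
exists (map_poly conjc P) => z hz.
rewrite -{2}(conjcK z) horner_map /= /reflect_conj -rmorphB rn_conj.
by apply: hP; rewrite rn_conj.
Qed.

(** Either all Taylor coefficients at [t0] vanish, or the first nonzero one dominates
    the remainder. *)
Lemma disc_holo_local g (t0 : R) : disc_holo g -> `|t0| < 1 ->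
  (exists2 d, 0 < d & forall t : R, `|t - t0| < d -> g t%:C = 0) \/
  (exists (m : nat) (c d : R), [/\ 0 < c, 0 < d & forall t : R, 0 < `|t - t0| < d ->
     c * `|t - t0| ^+ m <= rn (g t%:C)]).
Proof.
move=> hg ht0; pose rho := (1 - `|t0|) / 2.
have r0 : 0 < rho by rewrite divr_gt0 // subr_gt0.
have hr : approx_by_polys rho (fun z => g (z + t0%:C)).
  apply: (@approx_shift (rho + `|t0|)).
    by rewrite rn_real addrC.
  by apply: hg; have := normr_ge0 t0; move: r0; rewrite /rho; lra.
have [A A0 hA] := approx_bounded hr; have [c [_ hc]] := taylor_expansion r0 hr hA.
have gE (t : R) : g t%:C = g ((t - t0)%:C + t0%:C) by rewrite -rmorphD subrK.
have [c0|] := pselect (forall k, c k = 0).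
  left; exists (rho / 2) => [|t ht]; first by lra.
  rewrite gE; apply: rn0_eq0; apply/le_anti; rewrite rn_ge0 andbT.
  apply: (@le_of_harmonic _ _ _ (2 * A)) => k; rewrite add0r.
  have hz : rn ((t - t0)%:C : C) <= rho / 2 by rewrite rn_real ltW.
  have := hc k _ hz; rewrite big1 => [|i _]; last by rewrite c0 mul0r.
  rewrite subr0 => h; apply: le_trans h _; apply: ler_wpM2l; first by lra.
  apply: (@le_trans _ _ (2^-1 ^+ k)).
    rewrite lerXn2r ?nnegrE //; first by rewrite divr_ge0 ?rn_ge0 // ltW.
    by rewrite ler_pdivrMr // mulrC.
  rewrite exprVn /harmonic /= lef_pV2 ?posrE ?exprn_gt0 // -natrX ler_nat.
  exact: ltn_expl.
move=> /existsNP hex.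
have [m cm mmin] : exists2 m, c m != 0 & forall k, (k < m)%N -> c k = 0.
  have ex : exists k, c k != 0 by case: hex => k /eqP ck; exists k.
  case: (ex_minnP ex) => m cm hm; exists m => // k km; apply/eqP; apply: contraTT km => ck.
  by rewrite -leqNgt hm.
right; have cm0 : 0 < rn (c m) by rewrite rn_gt0.
pose B := 2 * A / rho ^+ m.+1.
have B0 : 0 < B by rewrite divr_gt0 ?exprn_gt0 // mulr_gt0.
exists m, (rn (c m) / 2), (Num.min (rho / 2) (rn (c m) / (2 * B))); split.
- by lra.
- by rewrite lt_min; apply/andP; split; apply: divr_gt0 => //; apply: mulr_gt0.
move=> t /andP[tt0]; rewrite lt_min => /andP[t1 t2].
have hz : rn ((t - t0)%:C : C) <= rho / 2 by rewrite rn_real ltW.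
rewrite gE; have := hc m.+1 _ hz; rewrite big_ord_recr /= big1 => [|i _]; last first.
  by rewrite mmin ?mul0r.
rewrite add0r expr_div_n mulrA mulrAC -/B rn_real.
have := rn_triangle (c m * (t - t0)%:C ^+ m - g ((t - t0)%:C + t0%:C)) (g ((t - t0)%:C + t0%:C)).
rewrite subrK rn_distC rnM rnX rn_real exprS.
have : 0 < `|t - t0| ^+ m by apply: exprn_gt0.
have : B * `|t - t0| <= rn (c m) / 2.
  have : `|t - t0| * (2 * B) < rn (c m) by rewrite -ltr_pdivlMr // mulr_gt0.
  nra.
set x := `|t - t0| ^+ m; set y := rn (g _); set u := rn (_ - _).
nra.
Qed.

Definition vanishes_near g (t0 : R) := exists2 d : R, 0 < d & forall t : R, `|t - t0| < d -> g t%:C = 0.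

(** [vanishes_near g] is locally constant on [(-1, 1)], so its indicator does not
    grow along a segment. *)
Lemma identity_principle g (a b : R) : disc_holo g -> `|a| < 1 -> `|b| < 1 ->
  vanishes_near g a -> vanishes_near g b.
Proof.
move=> hg ha hb hva; pose T (s : R) := a + s * (b - a).
pose chi (s : R) : C := if `[< vanishes_near g (T s) >] then 0 else 1.
have : rn (chi 1 - chi 0) <= 0.
  apply: growth_bound => t /andP[t0 t1].
  have hT : `|T t| < 1.
    have -> : T t = (1 - t) * a + t * b by rewrite /T; ring.
    move: ha hb; rewrite !ltr_norml => /andP[? ?] /andP[? ?].
    by have [ab|ab] := leP a b; apply/andP; split; nra.
  pose K := `|b - a| + 1.
  have K0 : 0 < K by rewrite ltr_wpDl.
  have TK (s d : R) : `|s - t| < d / K -> `|T s - T t| < d.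
    move=> hs; have -> : T s - T t = (s - t) * (b - a) by rewrite /T; ring.
    rewrite normrM; have : `|s - t| * K < d by rewrite -ltr_pdivlMr.
    by rewrite /K; have := normr_ge0 (s - t); nra.
  have [[d d0 hd]|[m [c [d [c0 d0 hd]]]]] := disc_holo_local hg hT.
    exists (d / 2 / K) => [|s _ /TK hs]; first by rewrite !divr_gt0.
    have van u : `|u - T t| < d / 2 -> vanishes_near g u.
      move=> hu; exists (d / 2) => [|v hv]; first by lra.
      apply: hd; have := ler_distD u v (T t); lra.
    rewrite /chi !asboolT ?subrr ?rn0 ?mul0r //; apply: van => //; last by rewrite subrr normr0; lra.
  exists (d / 2 / K) => [|s _ /TK hs]; first by rewrite !divr_gt0.
  have nvan u : `|u - T t| < d / 2 -> ~ vanishes_near g u.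
    move=> hu [d' d'0 hv]; pose e := Num.min (d / 2) d' / 2.
    have e0 : 0 < e by rewrite divr_gt0 // lt_min d'0; lra.
    have [ed ed'] : e < d / 2 /\ e < d'.
      by split; rewrite /e ltr_pdivrMr // gt_min; apply/orP; [left|right]; lra.
    have [v [hv1 hv2]] : exists v, `|v - u| < d' /\ 0 < `|v - T t| < d.
      have [Tu|uT] := leP (T t) u.
        exists (u + e); rewrite addrAC subrr add0r gtr0_norm //; split => //.
        move: hu; rewrite ger0_norm ?subr_ge0 // => hu.
        rewrite ger0_norm; last by lra.
        by apply/andP; split; lra.
      exists (u - e); rewrite addrAC subrr add0r normrN gtr0_norm //; split => //.
      move: hu; rewrite ltr0_norm ?subr_lt0 // => hu.
      rewrite ltr0_norm; last by lra.
      by apply/andP; split; lra.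
    have := hd v hv2; rewrite hv // rn0; apply/negP; rewrite -ltNge mulr_gt0 // exprn_gt0 //.
    by case/andP: hv2.
  rewrite /chi !asboolF ?subrr ?rn0 ?mul0r //; apply: nvan => //; rewrite subrr normr0; lra.
rewrite /chi {2}/T mul0r addr0 (asboolT hva) subr0 /T mul1r subrKC.
by case: asboolP => // _; rewrite rn1 ler10.
Qed.

Lemma flat_vanishes g : disc_holo g -> (forall m, flat_to m g) ->
  forall t : R, `|t| < 1 -> g t%:C = 0.
Proof.
move=> hg hf t ht; have h0 : `|0 : R| < 1 by rewrite normr0 ltr01.
have v0 : vanishes_near g 0.
  have [//|[m [c [d [c0 d0 hd]]]]] := disc_holo_local hg h0.
  have c20 : 0 < c / 2 by lra.
  have [d' d'0 hd'] := hf m _ c20.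
  pose s := Num.min d d' / 2.
  have s0 : 0 < s by rewrite divr_gt0 // lt_min d0.
  have sd : s < d by rewrite /s ltr_pdivrMr // gt_min; apply/orP; left; lra.
  have sd' : s < d' by rewrite /s ltr_pdivrMr // gt_min; apply/orP; right; lra.
  have := hd s; have := hd' s; rewrite subr0 gtr0_norm // s0 sd sd' => /(_ isT) h1 /(_ isT) h2.
  have := exprn_gt0 m s0; nra.
have [d d0 hd] := identity_principle hg h0 ht v0.
by apply: hd; rewrite subrr normr0.
Qed.

(** A function vanishing identically near some [t] would vanish near 0. *)
Lemma isolated_zeros g (d : R) : disc_holo g -> 0 < d ->
  (forall t, 0 < t < d -> g t%:C != 0) ->
  forall t : R, `|t| < 1 ->
  exists2 d', 0 < d' & forall s : R, 0 < `|s - t| < d' -> g s%:C != 0.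
Proof.
move=> hg d0 hd t ht; have h0 : `|0 : R| < 1 by rewrite normr0 ltr01.
have [vt|[m [c [d' [c0 d'0 hd']]]]] := disc_holo_local hg ht.
  have [d' d'0 hd'] := identity_principle hg ht h0 vt.
  pose s := Num.min d d' / 2.
  have s0 : 0 < s by rewrite divr_gt0 // lt_min d0.
  have sd : s < d by rewrite /s ltr_pdivrMr // gt_min; apply/orP; left; lra.
  have sd' : s < d' by rewrite /s ltr_pdivrMr // gt_min; apply/orP; right; lra.
  have := hd s; rewrite s0 sd => /(_ isT); rewrite hd' ?eqxx // subr0 gtr0_norm //.
exists d' => // s hs; rewrite -rn_gt0; apply: lt_le_trans (hd' s hs).
by rewrite mulr_gt0 // exprn_gt0 //; case/andP: hs.
Qed.

End DiscHolomorphic.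

(** * Strict differentiability of real C1 maps *)

Section Realification.
Context {R : realType}.

Lemma diff_estimate (K : numFieldType) (V W : normedModType K) (f : V -> W) (x : V) (e : K) :
  differentiable f x -> 0 < e -> 
  \forall h \near (0 : V), `|f (h + x) - f x - 'd f x h| <= e * `|h|.
Proof.
move=> /diff_locallyP[_ /eqaddoP h] e0; have := h e e0.
apply: filterS => y; rewrite !fctE /= /cst /=.
by rewrite opprD addrA.
Qed.

Lemma near_rn (V : normedModType R[i]) (x : V) (P : V -> Prop) :
  (\forall y \near x, P y) <-> exists2 d : R, 0 < d & forall y, rn (y - x) < d -> P y.
Proof.
split=> [/nbhs_ballP[d /= d0 hd]|[d d0 hd]].
  have dr : d = (complex.Re d)%:C by rewrite RRe_real // gtr0_real.
  exists (complex.Re d); first by rewrite -ltcR -dr.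
  move=> y hy; apply: hd; rewrite -ball_normE /= distrC -rnE dr ltcR //.
apply/nbhs_ballP; exists d%:C; first by rewrite /= ltcR.
by move=> y; rewrite -ball_normE /= distrC -rnE ltcR; exact: hd.
Qed.

Lemma near_realified (V : normedModType R[i]) (x : V) (P : V -> Prop) :
  (\forall y \near (x : realified V), P y) <-> (\forall y \near x, P y).
Proof. by []. Qed.

Lemma realified_norm (V : normedModType R[i]) (x : V) : `|x : realified V| = rn x.
Proof. by []. Qed.

Definition bounded_real_linear (V W : normedModType R[i]) (L : V -> W) :=
  [/\ forall x y, L (x + y) = L x + L y,
      forall (a : R) x, L (a%:C *: x) = a%:C *: L x &
      exists2 K : R, 0 < K & forall x, rn (L x) <= K * rn x].

(** The form in which [C^1] regularity is used on sets without interior, such as the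
    product of the disc and the sphere: unlike [real_C1_on] it mentions no extension, and
    it is stable under composition and products. *)
Definition strictly_differentiable (V W : normedModType R[i]) (A : set V) (f : V -> W) (x0 : V) :=
  exists2 L : V -> W, bounded_real_linear L &
    forall e : R, 0 < e -> exists2 d : R, 0 < d & forall x y, A x -> A y ->
      rn (x - x0) < d -> rn (y - x0) < d ->
      rn (f y - f x - L (y - x)) <= e * rn (y - x).

Lemma bounded_real_linearB (V W : normedModType R[i]) (L : V -> W) x y :
  bounded_real_linear L -> L (x - y) = L x - L y.
Proof.
case=> LD LZ _; rewrite LD; congr (_ + _).
by have := LZ (-1) y; rewrite rmorphN rmorph1 !scaleN1r.
Qed.

(** Both notions are stated for abstract spaces over [R] so that they can be applied to
    [realified V], which unfolds to the complex space [V]: there a bare differential may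
    be read over [R[i]]. *)
Definition differential (E F : normedModType R) (f : E -> F) (x : E) : E -> F := 'd f x.

Definition has_differential (E F : normedModType R) (f : E -> F) (x : E) : Prop :=
  differentiable f x.

Lemma differential_linear (E F : normedModType R) (f : E -> F) (x : E) :
  has_differential f x ->
  [/\ forall y z, differential f x (y + z) = differential f x y + differential f x z,
      forall a y, differential f x (a *: y) = a *: differential f x y &
      exists2 k, 0 < k & forall y, `|differential f x y| <= k * `|y|].
Proof.
move=> df; split => [y z|a y|]; [exact: linearD | exact: linearZZ |].
exact: linear_lipschitz (diff_continuous df).
Qed.

Definition real_diff (V W : normedModType R[i]) (f : V -> W) (x : V) : V -> W :=
  @differential (realified V) (realified W) f x.

Lemma real_diff_linear (V W : normedModType R[i]) (f : V -> W) (x : V) :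
  @has_differential (realified V) (realified W) f x ->
  bounded_real_linear (real_diff f x).
Proof. by move=> /differential_linear[]. Qed.

Lemma real_diff_estimate (V W : normedModType R[i]) (f : V -> W) (x : V) (e : R) :
  @has_differential (realified V) (realified W) f x -> 0 < e ->
  exists2 d, 0 < d & forall h, rn h < d ->
    rn (f (h + x) - f x - real_diff f x h) <= e * rn h.
Proof.
move=> df e0; have /near_rn[d d0 hd] := diff_estimate df e0.
by exists d => // h hh; apply: hd; rewrite subr0.
Qed.

Lemma segment_sub (V : normedModType R[i]) (x y z : V) (t : R) :
  x + t%:C *: (y - x) - z = (1 - t)%:C *: (x - z) + t%:C *: (y - z).
Proof.
rewrite rmorphB rmorph1 scalerBl scale1r -[RHS]addrA [- _ + _]addrC -scalerBr.
by rewrite opprB addrA subrK addrAC.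
Qed.

(** Mean value inequality for [f - L] on a segment, [L] being the differential at
    [x0]. *)
Lemma C1_strictly_differentiable (V W : normedModType R[i]) (U : set V) (f : V -> W) (x0 : V) :
  real_C1_open U f -> U x0 -> strictly_differentiable setT f x0.
Proof.
move=> [Uo df dc] Ux0.
exists (real_diff f x0); first exact/real_diff_linear/df.
move=> e e0; have e20 : 0 < e / 2 by lra.
have hU : \forall y \near x0, U y by apply: open_nbhs_nbhs.
have := dc x0 Ux0 _ e20; rewrite near_realified => hd.
have [d d0 {hU}hd] := (iffLR (near_rn _ _)) (filterI hU hd).
exists d => // x y _ _ hx hy.
pose L := real_diff f x0.
pose g (t : R) : W := f (x + t%:C *: (y - x)) - L (t%:C *: (y - x)).
have LL : bounded_real_linear L by exact/real_diff_linear/df.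
have -> : f y - f x - L (y - x) = g 1 - g 0.
  rewrite /g rmorph1 scale1r rmorph0 scale0r addr0 subrKC.
  have -> : L 0 = 0 by rewrite -(subrr (0 : V)) (bounded_real_linearB _ _ LL) subrr.
  by rewrite subr0 addrAC.
apply: growth_bound => t /andP[t0 t1].
set xt := x + t%:C *: (y - x).
have hxt : rn (xt - x0) < d.
  rewrite segment_sub.
  apply: le_lt_trans (rn_triangle _ _) _; rewrite !rnZ !rn_real !ger0_norm ?subr_ge0 //.
  by have [h|h] := leP (rn (x - x0)) (rn (y - x0)); nra.
have [Uxt dxt] := hd _ hxt.
have [d1 d10 hd1] := real_diff_estimate (df _ Uxt) e20.
pose K := rn (y - x) + 1.
have K0 : 0 < K by rewrite ltr_wpDl ?rn_ge0.
exists (d1 / K) => [|s _ hs]; first by rewrite divr_gt0.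
set h : V := (s - t)%:C *: (y - x).
have rh : rn h = `|s - t| * rn (y - x) by rewrite rnZ rn_real.
have hh : rn h < d1.
  rewrite rh; have : `|s - t| * K < d1 by rewrite -ltr_pdivlMr.
  by rewrite /K; have := normr_ge0 (s - t); nra.
have xs : x + s%:C *: (y - x) = h + xt.
  by rewrite /h /xt rmorphB scalerBl addrCA subrK.
have -> : g s - g t = (f (h + xt) - f xt - real_diff f xt h)
                       + (real_diff f xt h - L h).
  have Lh : L h = L (s%:C *: (y - x)) - L (t%:C *: (y - x)).
    by rewrite -(bounded_real_linearB _ _ LL) /h rmorphB scalerBl.
  rewrite addrA subrK Lh /g xs !opprB addrACA [RHS]addrACA; congr (_ + _).
  exact: addrC.
apply: le_trans (rn_triangle _ _) _.
have h1 : rn (f (h + xt) - f xt - real_diff f xt h) <= e / 2 * rn h.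
  exact: hd1 hh.
have h2 : rn (real_diff f xt h - L h) <= e / 2 * rn h by exact: dxt.
rewrite rh in h1 h2; lra.
Qed.

End Realification.

Section StrictDifferentiability.
Context {R : realType}.
Local Notation C := R[i].

Lemma real_linear0 (V W : normedModType C) (L : V -> W) : bounded_real_linear L -> L 0 = 0.
Proof. by move=> hL; rewrite -(subrr 0) bounded_real_linearB // subrr. Qed.

Lemma strict_lipschitz (V W : normedModType C) (A : set V) (f : V -> W) x0 :
  strictly_differentiable A f x0 -> exists K d : R, [/\ 0 < K, 0 < d &
    forall x y, A x -> A y -> rn (x - x0) < d -> rn (y - x0) < d -> rn (f y - f x) <= K * rn (y - x)].
Proof.
move=> [L [_ _ [K K0 hK]] hL]; have [d d0 hd] := hL 1 ltr01.
exists (K + 1), d; split => // [|x y Ax Ay hx hy]; first by lra.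
have := hd x y Ax Ay hx hy; have := hK (y - x).
have := rn_triangle (f y - f x - L (y - x)) (L (y - x)); rewrite subrK; lra.
Qed.

Lemma strictly_differentiable_comp (U V W : normedModType C) (A : set U) (f : U -> V) (g : V -> W) x0 :
  A x0 -> strictly_differentiable A f x0 -> strictly_differentiable setT g (f x0) ->
  strictly_differentiable A (g \o f) x0.
Proof.
move=> Ax0 hf [M [MD MZ [B B0 hB]] hM].
have [K [d1 [K0 d10 lipf]]] := strict_lipschitz hf.
have [L [LD LZ [D D0 hD]] hL] := hf.
have MB x y : M (x - y) = M x - M y by apply: bounded_real_linearB; split => //; exists B.
exists (M \o L).
  split => [x y|a x|] /=; rewrite ?LD ?MD ?LZ ?MZ //.
  exists (B * D) => [|x]; first by rewrite mulr_gt0.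
  by apply: le_trans (hB _) _; rewrite -mulrA ler_pM2l.
move=> e e0.
have [d2 d20 hd2] := hM (e / (2 * K)) (divr_gt0 e0 (mulr_gt0 (ltr0n _ 2) K0)).
have [d3 d30 hd3] := hL (e / (2 * B)) (divr_gt0 e0 (mulr_gt0 (ltr0n _ 2) B0)).
exists (Num.min d1 (Num.min d3 (d2 / K))) => [|x y Ax Ay].
  by rewrite !lt_min d10 d30 divr_gt0.
rewrite !lt_min => /and3P[x1 x3 x2] /and3P[y1 y3 y2] /=.
have near z : A z -> rn (z - x0) < d1 -> rn (z - x0) < d2 / K -> rn (f z - f x0) < d2.
  move=> Az z1 z2; have := lipf x0 z Ax0 Az; rewrite subrr rn0 => /(_ d10 z1) h.
  by apply: le_lt_trans h _; rewrite mulrC -ltr_pdivlMr.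
have h2 := hd2 (f x) (f y) I I (near x Ax x1 x2) (near y Ay y1 y2).
have h3 := hd3 x y Ax Ay x3 y3.
have h1 := lipf x y Ax Ay x1 y1.
apply: le_trans (rn_sub_triangle _ (M (f y - f x)) _) _.
rewrite -MB; have hB' := hB (f y - f x - L (y - x)).
have e1 : e / (2 * K) * (K * rn (y - x)) = e / 2 * rn (y - x) by field; rewrite gt_eqF.
have e2 : B * (e / (2 * B) * rn (y - x)) = e / 2 * rn (y - x) by field; rewrite gt_eqF.
have h4 : e / (2 * K) * rn (f y - f x) <= e / (2 * K) * (K * rn (y - x)).
  by rewrite ler_wpM2l // divr_ge0 ?mulr_ge0 // ltW.
have h5 : B * rn (f y - f x - L (y - x)) <= B * (e / (2 * B) * rn (y - x)) by rewrite ler_pM2l.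
lra.
Qed.

Lemma strictly_differentiable_linear (V W : normedModType C) (A : set V) (L : V -> W) x0 :
  bounded_real_linear L -> strictly_differentiable A L x0.
Proof.
move=> hL; exists L => // e e0; exists 1 => // x y _ _ _ _.
by rewrite bounded_real_linearB // subrr rn0 mulr_ge0 ?rn_ge0 // ltW.
Qed.

Lemma strictly_differentiable_cst (V W : normedModType C) (A : set V) (c : W) x0 :
  strictly_differentiable A (fun=> c) x0.
Proof.
exists (fun=> 0).
  split=> [x y|a x|]; rewrite ?addr0 ?scaler0 //.
  by exists 1 => // x; rewrite rn0 mul1r rn_ge0.
move=> e e0; exists 1 => // x y _ _ _ _.
by rewrite !subrr rn0 mulr_ge0 ?rn_ge0 // ltW.
Qed.

Lemma strictly_differentiableD (V W : normedModType C) (A : set V) (f g : V -> W) x0 :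
  strictly_differentiable A f x0 -> strictly_differentiable A g x0 ->
  strictly_differentiable A (fun x => f x + g x) x0.
Proof.
move=> [L [LD LZ [K K0 hK]] hL] [M [MD MZ [B B0 hB]] hM].
exists (fun x => L x + M x).
  split=> [x y|a x|]; rewrite ?LD ?MD ?LZ ?MZ ?scalerDr // 1?addrACA //.
  exists (K + B) => [|x]; first exact: addr_gt0.
  by rewrite mulrDl (le_trans (rn_triangle _ _)) // lerD.
move=> e e0; have e20 : 0 < e / 2 by lra.
have [d1 d10 hd1] := hL _ e20; have [d2 d20 hd2] := hM _ e20.
exists (Num.min d1 d2) => [|x y Ax Ay]; first by rewrite lt_min d10.
rewrite !lt_min => /andP[x1 x2] /andP[y1 y2].
rewrite 2!opprD (addrACA (f y)) (addrACA (f y - f x)).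
apply: le_trans (rn_triangle _ _) _.
have := hd1 x y Ax Ay x1 y1; have := hd2 x y Ax Ay x2 y2; lra.
Qed.

Lemma strictly_differentiableM (V : normedModType C) (A : set V) (f g : V -> C) x0 : A x0 ->
  strictly_differentiable A f x0 -> strictly_differentiable A g x0 ->
  strictly_differentiable A (fun x => f x * g x) x0.
Proof.
move=> Ax0 hf hg.
have [K1 [d1 [K10 d10 lf]]] := strict_lipschitz hf.
have [K2 [d2 [K20 d20 lg]]] := strict_lipschitz hg.
have [L [LD LZ [K K0 hK]] hL] := hf; have [M [MD MZ [B B0 hB]] hM] := hg.
exists (fun x => f x0 * M x + g x0 * L x).
  split=> [x y|a x|]; first by rewrite LD MD; ring.
    by rewrite LZ MZ /GRing.scale /=; ring.
  exists (rn (f x0) * B + rn (g x0) * K + 1) => [|x].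
    by rewrite ltr_wpDl // addr_ge0 // mulr_ge0 ?rn_ge0 // ltW.
  apply: le_trans (rn_triangle _ _) _; rewrite !rnM.
  have := hK x; have := hB x; have := rn_ge0 (f x0); have := rn_ge0 (g x0); have := rn_ge0 x.
  nra.
move=> e e0.
pose F := rn (f x0) + 1; pose G := rn (g x0) + 1.
have F0 : 0 < F by rewrite ltr_wpDl ?rn_ge0.
have G0 : 0 < G by rewrite ltr_wpDl ?rn_ge0.
pose e1 := e / (4 * F); pose e2 := e / (4 * G).
have e10 : 0 < e1 by rewrite divr_gt0 // mulr_gt0.
have e20 : 0 < e2 by rewrite divr_gt0 // mulr_gt0.
have [d3 d30 hd3] := hL _ e20; have [d4 d40 hd4] := hM _ e10.
have [d5 [d50 [a1 a2 a3 a4]]] : exists d5 : R, 0 < d5 /\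
    [/\ d5 * K1 <= 1, d5 * (4 * B * K1) <= e, d5 * K2 <= 1 & d5 * (4 * K * K2) <= e].
  exists (Num.min (Num.min (1 / K1) (e / (4 * B * K1))) (Num.min (1 / K2) (e / (4 * K * K2)))).
  split; first by rewrite !lt_min !divr_gt0 // !mulr_gt0.
  by split; rewrite -ler_pdivlMr ?mulr_gt0 // !ge_min lexx ?orbT.
exists (Num.min (Num.min d1 d2) (Num.min (Num.min d3 d4) d5)) => [|x y Ax Ay].
  by rewrite !lt_min d10 d20 d30 d40.
rewrite (lt_min (rn (x - x0))) (lt_min (rn (y - x0))) => /andP[x12 x345] /andP[y12 y345].
move: x12 y12 x345 y345; rewrite 2!lt_min => /andP[x1 x2] /andP[y1 y2].
rewrite !(lt_min _ (Num.min d3 d4)) !(lt_min _ d3) => /andP[/andP[x3 x4] x5] /andP[/andP[y3 y4] y5].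
have lf1 z : A z -> rn (z - x0) < d1 -> rn (z - x0) < d5 -> rn (f z - f x0) <= d5 * K1.
  move=> Az z1 z5; have := lf x0 z Ax0 Az; rewrite subrr rn0 => /(_ d10 z1) h.
  by apply: le_trans h _; rewrite mulrC ler_pM2r // ltW.
have lg1 z : A z -> rn (z - x0) < d2 -> rn (z - x0) < d5 -> rn (g z - g x0) <= d5 * K2.
  move=> Az z1 z5; have := lg x0 z Ax0 Az; rewrite subrr rn0 => /(_ d20 z1) h.
  by apply: le_trans h _; rewrite mulrC ler_pM2r // ltW.
have fy : rn (f y) <= F.
  have := lf1 y Ay y1 y5; have := rn_triangle (f y - f x0) (f x0).
  by rewrite subrK /F; clear - a1; lra.
have gx : rn (g x) <= G.
  have := lg1 x Ax x2 x5; have := rn_triangle (g x - g x0) (g x0).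
  by rewrite subrK /G; clear - a3; lra.
have -> : f y * g y - f x * g x - (f x0 * M (y - x) + g x0 * L (y - x)) =
   (f y * (g y - g x - M (y - x)) + g x * (f y - f x - L (y - x)))
   + ((f y - f x0) * M (y - x) + (g x - g x0) * L (y - x)) by ring.
set r := rn (y - x); have r0 : 0 <= r by exact: rn_ge0.
have b1 : rn (f y * (g y - g x - M (y - x))) <= e / 4 * r.
  rewrite rnM; have := hd4 x y Ax Ay x4 y4; rewrite -/r => h.
  apply: le_trans (_ : F * (e1 * r) <= _); first by apply: ler_pM; rewrite ?rn_ge0.
  by rewrite mulrA /e1 le_eqVlt; apply/orP; left; apply/eqP; field; rewrite gt_eqF.
have b2 : rn (g x * (f y - f x - L (y - x))) <= e / 4 * r.
  rewrite rnM; have := hd3 x y Ax Ay x3 y3; rewrite -/r => h.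
  apply: le_trans (_ : G * (e2 * r) <= _); first by apply: ler_pM; rewrite ?rn_ge0.
  by rewrite mulrA /e2 le_eqVlt; apply/orP; left; apply/eqP; field; rewrite gt_eqF.
have b3 : rn ((f y - f x0) * M (y - x)) <= e / 4 * r.
  rewrite rnM; apply: le_trans (_ : d5 * K1 * (B * r) <= _).
    by apply: ler_pM; rewrite ?rn_ge0 // lf1.
  by clear - a2 r0; nra.
have b4 : rn ((g x - g x0) * L (y - x)) <= e / 4 * r.
  rewrite rnM; apply: le_trans (_ : d5 * K2 * (K * r) <= _).
    by apply: ler_pM; rewrite ?rn_ge0 // lg1.
  by clear - a4 r0; nra.
apply: le_trans (rn_triangle _ _) _.
have := rn_triangle (f y * (g y - g x - M (y - x))) (g x * (f y - f x - L (y - x))).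
have := rn_triangle ((f y - f x0) * M (y - x)) ((g x - g x0) * L (y - x)).
by clear - b1 b2 b3 b4; lra.
Qed.

Lemma real_C1_on_strictly_differentiable (V W : normedModType C) (A : set V) (f : V -> W) x0 :
  real_C1_on A f -> A x0 -> strictly_differentiable A f x0.
Proof.
move=> hf Ax0; have [U [g [Ux0 hg fg]]] := hf x0 Ax0.
have Uo : open U by case: hg.
have [d d0 hd] := (iffLR (near_rn _ _)) (open_nbhs_nbhs (conj Uo Ux0)).
have [L bL hL] := C1_strictly_differentiable hg Ux0.
exists L => // e /hL[d1 d10 hd1]; exists (Num.min d d1) => [|x y Ax Ay].
  by rewrite lt_min d0.
rewrite !lt_min => /andP[x1 x2] /andP[y1 y2].
by rewrite !fg //; [apply: hd1| exact: hd | exact: hd].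
Qed.

End StrictDifferentiability.

(** * Functions holomorphic along the leaves *)

Section LeafwiseFunctions.
Context {R : realType}.
Local Notation C := R[i].

(** Compactness of the closed disc, in the form of a common radius. *)
Lemma uniform_on_disc (rho : R) (P : C -> R -> Prop) :
  (forall z0 : C, rn z0 <= rho -> exists2 d : R, 0 < d &
     forall (z : C) (s : R), rn (z - z0) < d -> rn z <= rho -> 0 < s < d -> P z s) ->
  exists2 d : R, 0 < d & forall (z : C) (s : R), rn z <= rho -> 0 < s < d -> P z s.
Proof.
move=> hP; pose box : set (R * R)%type := `[- rho, rho] `*` `[- rho, rho].
have cbox : compact box by have h := @segment_compact R (- rho) rho; have := compact_setX h h.
pose toC (p : R * R) : C := p.1 +i* p.2.
pose Q (s : R) (p : R * R) := rn (toC p) <= rho -> P (toC p) s.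
have toCB p q : rn (toC p - toC q) <= `|p.1 - q.1| + `|p.2 - q.2|.
  exact: rn_ReIm.
have nearp (p : R * R) (d : R) : 0 < d -> \forall q \near p, rn (toC q - toC p) < d.
  move=> d0; apply/nbhs_ballP; exists (d / 2) => /=; first by lra.
  move=> q [] /=; rewrite /ball /= => h1 h2; apply: le_lt_trans (toCB _ _) _.
  rewrite (distrC q.1) (distrC q.2); lra.
have : \forall s \near 0^'+, box `<=` Q s.
  have cov := iffLR (compact_near_coveringP _) cbox.
  have at0 := at_right_proper_filter (0 : R).
  apply: (cov R (at_right (0 : R)) Q) => p _.
  have [hp|hp] := leP (rn (toC p)) rho.
    have [d d0 hd] := hP _ hp.
    exists ([set q | rn (toC q - toC p) < d], [set s : R | 0 < s < d]) => /=.
      split; first exact: nearp.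
      apply: filterS (filterI (nbhs_right_gt (0 : R)) (nbhs_right_lt d0)) => s [].
      by move=> /= -> ->.
    by move=> [q s] /= [hq hs] hq'; apply: hd.
  have d0 : 0 < rn (toC p) - rho by rewrite subr_gt0.
  exists ([set q | rn (toC q - toC p) < rn (toC p) - rho], setT) => /=.
    by split; [exact: nearp | exact: filterT].
  move=> [q s] /= [hq _] hq'; exfalso.
  have := rn_triangle (toC p - toC q) (toC q); rewrite subrK rn_distC; lra.
move=> /nbhs_ballP[d /= d0 hd]; exists d => // z s hz /andP[s0 sd].
have hb : box (complex.Re z, complex.Im z).
  split; rewrite /= in_itv /= -ler_norml; apply: le_trans hz.
    exact: normRe_le.
  exact: normIm_le.
have := hd s _ _ _ hb; rewrite /Q /toC /=.
have -> : complex.Re z +i* complex.Im z = z by case: (z).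
apply => //.
by rewrite /ball /= sub0r normrN gtr0_norm.
Qed.

Definition has_complex_derivative (W : normedModType C) (g : C -> W) (z : C) (c : W) :=
  forall e : R, 0 < e -> exists2 d : R, 0 < d & forall h : C, rn h < d ->
    rn (g (h + z) - g z - h *: c) <= e * rn h.

Lemma differentiable_complex_derivative (W : normedModType C) (g : C -> W) (z : C) :
  differentiable g z -> has_complex_derivative g z ('D_1 g z).
Proof.
move=> dg e e0; have ec0 : 0 < e%:C by rewrite ltcR.
have /near_rn[d d0 hd] := diff_estimate dg ec0.
exists d => // h hh; have := hd h; rewrite subr0 => /(_ hh).
have -> : 'D_1 g z = 'd g z 1 by exact: deriveE.
have -> : h *: 'd g z 1 = 'd g z h by rewrite -linearZZ /GRing.scale /= mulr1.
by rewrite -!rnE -rmorphM lecR.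
Qed.

Lemma discP (z : C) : disc R z <-> rn z < 1.
Proof. by rewrite /disc /= -rnE -(rmorph1 (real_complex R)) ltcR. Qed.

Section Pairs.
Context {V W : normedModType C}.
Implicit Types p : V * W.

Lemma rn_pair p : rn p = Num.max (rn p.1) (rn p.2).
Proof.
apply: (@complexI R); rewrite rnE prod_normE -!rnE.
have [h|h] := leP (rn p.1) (rn p.2).
  by rewrite max_r // lecR.
by rewrite max_l // lecR ltW.
Qed.

Lemma rn_pair_le p : rn p <= rn p.1 + rn p.2.
Proof. by rewrite rn_pair ge_max lerDl lerDr !rn_ge0. Qed.

End Pairs.

Context {n : nat}.
Local Notation V := 'rV[C]_n.

(** Meant for the coordinates of [h] and for [f \o h], with the variables of the disc and
    of the sphere kept separate. *)
Definition leafwise (Q : C * V -> C) :=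
  (forall x, (disc R `*` sphere R n) x -> strictly_differentiable (disc R `*` sphere R n) Q x) /\
  forall v (z : C), sphere R n v -> rn z < 1 ->
    exists c : C, has_complex_derivative (fun z => Q (z, v)) z c.

Lemma leafwise_cst (c : C) : leafwise (fun=> c).
Proof.
split=> [x _|v z _ _]; first exact: strictly_differentiable_cst.
exists 0 => e e0; exists 1 => // h _.
by rewrite scaler0 subrr subr0 rn0 mulr_ge0 ?rn_ge0 // ltW.
Qed.

Lemma leafwiseD Q1 Q2 : leafwise Q1 -> leafwise Q2 -> leafwise (fun x => Q1 x + Q2 x).
Proof.
move=> [s1 h1] [s2 h2]; split=> [x Ax|v z sv hz].
  by apply: strictly_differentiableD; [apply: s1|apply: s2].
have [c1 hc1] := h1 v z sv hz; have [c2 hc2] := h2 v z sv hz.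
exists (c1 + c2) => e e0; have e20 : 0 < e / 2 by lra.
have [d1 d10 hd1] := hc1 _ e20; have [d2 d20 hd2] := hc2 _ e20.
exists (Num.min d1 d2) => [|h]; first by rewrite lt_min d10.
rewrite lt_min => /andP[r1 r2].
have := hd1 h r1; have := hd2 h r2; set u := _ - _ - _; set w := _ - _ - _ => hu hw.
rewrite (_ : _ - _ - _ = w + u); last by rewrite /w /u /GRing.scale /=; ring.
apply: le_trans (rn_triangle _ _) _; lra.
Qed.

Lemma leafwiseM Q1 Q2 : leafwise Q1 -> leafwise Q2 -> leafwise (fun x => Q1 x * Q2 x).
Proof.
move=> [s1 h1] [s2 h2]; split=> [x Ax|v z sv hz].
  by apply: strictly_differentiableM => //; [apply: s1|apply: s2].
have [c1 hc1] := h1 v z sv hz; have [c2 hc2] := h2 v z sv hz.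
exists (c1 * Q2 (z, v) + Q1 (z, v) * c2) => e e0.
pose A := rn c1 + 1; pose q1 := rn (Q1 (z, v)); pose q2 := rn (Q2 (z, v)).
pose B := rn c2 + 1.
have [q10 q20] : 0 <= q1 /\ 0 <= q2 by split; exact: rn_ge0.
have [c10 c20] : 0 <= rn c1 /\ 0 <= rn c2 by split; exact: rn_ge0.
pose M := q1 + q2 + 1.
have M0 : 0 < M by rewrite /M; lra.
pose e1 := Num.min 1 (e / (2 * M)).
have e10 : 0 < e1 by rewrite lt_min ltr01 divr_gt0 // mulr_gt0.
have e11 : e1 <= 1 by rewrite ge_min lexx.
have e1M : e1 * (2 * M) <= e by rewrite -ler_pdivlMr ?mulr_gt0 // ge_min lexx orbT.
have [d1 d10 hd1] := hc1 _ e10; have [d2 d20 hd2] := hc2 _ e10.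
have AB0 : 0 < 2 * (A * B) by rewrite !mulr_gt0 // /A /B; lra.
exists (Num.min (Num.min d1 d2) (e / (2 * (A * B)))) => [|h].
  by rewrite !lt_min d10 d20 divr_gt0.
rewrite !lt_min => /andP[/andP[r1 r2] r3].
have rAB : rn h * (2 * (A * B)) <= e by rewrite -ler_pdivlMr // ltW.
have := hd1 h r1; have := hd2 h r2.
set x1 := Q1 (h + z, v); set y1 := Q1 (z, v); set x2 := Q2 (h + z, v); set y2 := Q2 (z, v).
rewrite /GRing.scale /= => u2 u1.
have -> : x1 * x2 - y1 * y2 - h * (c1 * y2 + y1 * c2) =
  (x1 - y1 - h * c1) * y2 + y1 * (x2 - y2 - h * c2) + (x1 - y1) * (x2 - y2) by ring.
have r0 := rn_ge0 h.
have l1 : rn (x1 - y1) <= A * rn h.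
  have := rn_triangle (x1 - y1 - h * c1) (h * c1); rewrite subrK rnM /A; nra.
have l2 : rn (x2 - y2) <= B * rn h.
  have := rn_triangle (x2 - y2 - h * c2) (h * c2); rewrite subrK rnM /B; nra.
have t1 : rn ((x1 - y1 - h * c1) * y2) <= e1 * rn h * q2 by rewrite rnM ler_wpM2r.
have t2 : rn (y1 * (x2 - y2 - h * c2)) <= q1 * (e1 * rn h) by rewrite rnM ler_wpM2l.
have t3 : rn ((x1 - y1) * (x2 - y2)) <= A * rn h * (B * rn h).
  by rewrite rnM; apply: ler_pM; rewrite ?rn_ge0.
apply: le_trans (rn_triangle _ _) _.
have := rn_triangle ((x1 - y1 - h * c1) * y2) (y1 * (x2 - y2 - h * c2)).
have s1' : e1 * rn h * q2 + q1 * (e1 * rn h) <= e / 2 * rn h.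
  by rewrite /M in e1M; clear - e1M e10 r0; nra.
have s2' : A * rn h * (B * rn h) <= e / 2 * rn h by clear - rAB r0; nra.
by clear - t1 t2 t3 s1' s2'; lra.
Qed.

Lemma leafwiseB Q1 Q2 : leafwise Q1 -> leafwise Q2 -> leafwise (fun x => Q1 x - Q2 x).
Proof.
move=> h1 h2; have := leafwiseD h1 (leafwiseM (leafwise_cst (-1)) h2).
by under eq_fun do rewrite mulN1r.
Qed.

Lemma leafwise_uniform Q (v : V) (rho : R) : leafwise Q -> sphere R n v -> rho < 1 ->
  exists g', uniformly_differentiable rho (fun z => Q (z, v)) g'.
Proof.
move=> [sQ hQ] sv r1.
have ex (z : C) : exists c : C, rn z < 1 -> has_complex_derivative (fun z => Q (z, v)) z c.
  have [hz|hz] := ltP (rn z) 1; last by exists 0.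
  by have [c hc] := hQ v z sv hz; exists c.
have [g' hg'] := choice ex.
exists g' => e e0.
pose P (z : C) (s : R) := forall y : C, rn y <= rho -> rn (y - z) <= s ->
   rn (Q (y, v) - Q (z, v) - g' z * (y - z)) <= e * rn (y - z).
have [|d d0 hd] := uniform_on_disc (rho := rho) (P := P); last first.
  exists (d / 2) => [|x y hx hy xy]; first by lra.
  by apply: (hd x (d / 2)) => //; apply/andP; split; lra.
move=> z0 hz0; have z01 : rn z0 < 1 by apply: le_lt_trans r1.
have Az0 : (disc R `*` sphere R n) (z0, v) by split => //=; apply/discP.
have [L [LD LZ _] hL] := sQ _ Az0.
have e20 : 0 < e / 2 by lra.
have [d d0 hd] := hL _ e20.
have rpair (a b : C) : rn ((a, v) - (b, v)) = rn (a - b).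
  by rewrite rn_pair /= subrr rn0 max_l // rn_ge0.
have local x y : rn (x - z0) < d -> rn (y - z0) < d -> rn x < 1 -> rn y < 1 ->
    rn (Q (y, v) - Q (x, v) - L (y - x, 0)) <= e / 2 * rn (y - x).
  move=> hx hy x1 y1; have := hd (x, v) (y, v); rewrite !rpair.
  have -> : (y, v) - (x, v) = (y - x, 0) by congr pair; rewrite subrr.
  by apply => //; split => //=; apply/discP.
exists (Num.min (d / 2) (1 - rho)) => [|z s hz hzr]; first by rewrite lt_min subr_gt0 r1 andbT; lra.
rewrite lt_min in hz; case/andP: hz => hz _.
rewrite lt_min => /andP[s0 /andP[sd _]] y hy hyz.
have z1 : rn z < 1 by apply: le_lt_trans r1.
have y1 : rn y < 1 by apply: le_lt_trans r1.
have hyd : rn (y - z0) < d by apply: le_lt_trans (rn_sub_triangle _ z _) _; clear - hz hyz sd; lra.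
have h1 : rn (Q (y, v) - Q (z, v) - L (y - z, 0)) <= e / 2 * rn (y - z).
  by apply: local => //; clear - hz d0; lra.
have [->|yz] := eqVneq y z; first by rewrite !subrr mulr0 subrr rn0 mulr0.
have ryz : 0 < rn (y - z) by rewrite rn_gt0 subr_eq0.
(* along the segment from z to y the increment of Q is approximated both by the
   complex derivative at z and by the real differential at z0 *)
have h2 : rn (L (y - z, 0) - g' z * (y - z)) <= e / 2 * rn (y - z).
  apply/ler_addgt0Pr => k k0.
  have kr0 : 0 < k / rn (y - z) by rewrite divr_gt0.
  have [d1 d10 hd1] := hg' z z1 _ kr0.
  pose t := Num.min 1 (d1 / 2 / rn (y - z)).
  have t0 : 0 < t by rewrite lt_min ltr01 !divr_gt0.
  have t1 : t <= 1 by rewrite ge_min lexx.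
  have td : t * rn (y - z) <= d1 / 2 by rewrite -ler_pdivlMr // ge_min lexx orbT.
  set w := z + t%:C * (y - z).
  have w1 : rn w <= rho by apply: rn_le_convex => //; rewrite t1 ltW.
  have wz : w - z = t%:C * (y - z) by rewrite /w addrAC subrr add0r.
  have rwz : rn (w - z) = t * rn (y - z) by rewrite wz rnM rn_real gtr0_norm.
  have hw : rn (w - z0) < d.
    apply: le_lt_trans (rn_sub_triangle _ z _) _; rewrite rwz.
    have : t * rn (y - z) <= rn (y - z) by rewrite ler_piMl // ltW.
    by clear - hz hyz sd; lra.
  have a1 := local z w _ hw z1 (le_lt_trans w1 r1).
  have {}a1 : rn (Q (w, v) - Q (z, v) - t%:C * L (y - z, 0)) <= e / 2 * (t * rn (y - z)).
    rewrite -rwz; have -> : t%:C * L (y - z, 0) = L (w - z, 0).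
      rewrite -[t%:C * _]/(t%:C *: _) -LZ wz; congr L; congr pair; exact: scaler0.
    by apply: a1; clear - hz d0; lra.
  have a2 : rn (Q (w, v) - Q (z, v) - (t%:C * (y - z)) * g' z) <= k * t.
    have := hd1 (t%:C * (y - z)); rewrite -wz subrK wz rnM rn_real gtr0_norm // => h.
    apply: le_trans (h _) _; first by clear - td d10; lra.
    by rewrite le_eqVlt; apply/orP; left; apply/eqP; field; rewrite gt_eqF.
  have := rn_sub_triangle (t%:C * L (y - z, 0)) (Q (w, v) - Q (z, v)) (t%:C * (y - z) * g' z).
  rewrite rn_distC in a1.
  have -> : t%:C * L (y - z, 0) - t%:C * (y - z) * g' z = t%:C * (L (y - z, 0) - g' z * (y - z)) by ring.
  rewrite (rnM t%:C) rn_real gtr0_norm // => a3.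
  by rewrite -(ler_pM2l t0); clear - a1 a2 a3; lra.
by apply: le_trans (rn_sub_triangle _ (L (y - z, 0)) _) _; clear - h1 h2; lra.
Qed.

Lemma leafwise_disc_holo Q (v : V) : leafwise Q -> sphere R n v -> disc_holo (fun z => Q (z, v)).
Proof.
move=> hQ sv rho /andP[r0 r1]; have [g' hg'] := leafwise_uniform hQ sv r1.
exact: approx_by_polys_of_differentiable hg'.
Qed.

End LeafwiseFunctions.

(** * Variations of the leaves *)

Section Variations.
Context {R : realType} {n : nat}.
Local Notation C := R[i].
Local Notation V := 'rV[C]_n.
Implicit Types (Q : C * V -> C) (lam : R -> C) (sig : R -> V).

(** A one-parameter family of leaves [z |-> (z * lam s, sig s)], starting at the
    leaf of [v] with velocity [(lam1, sig1)]. *)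
Definition leaf_curve lam sig (v : V) (lam1 : C) (sig1 : V) :=
  [/\ sphere R n v, forall s : R, 0 < s < 1 -> sphere R n (sig s) &
      forall e : R, 0 < e -> exists2 d : R, 0 < d & forall s : R, 0 < s < d ->
        rn (lam s - 1 - s%:C * lam1) <= e * s /\ rn (sig s - v - s%:C *: sig1) <= e * s].

(** [D] is the derivative of [Q] along the family at [s = 0]; as the error is uniform for
    [z] near [z0], the difference quotients converge locally uniformly. *)
Definition is_variation lam sig v Q (D : C -> C) :=
  forall z0 : C, rn z0 < 1 -> forall e : R, 0 < e -> exists2 d : R, 0 < d &
    forall (z : C) (s : R), rn (z - z0) < d -> 0 < s < d ->
      rn (Q (z * lam s, sig s) - Q (z, v) - s%:C * D z0) <= e * s.

Lemma leaf_curve_scale_near lam sig v (lam1 : C) (sig1 : V) (rho : R) :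
  leaf_curve lam sig v lam1 sig1 -> 1 < rho ->
  exists2 d : R, 0 < d & forall s : R, 0 < s < d -> rn (lam s) <= rho.
Proof.
move=> [_ _ hc] r1; have [d d0 hd] := hc 1 ltr01.
pose M := rn lam1 + 1.
have M0 : 0 < M by rewrite ltr_wpDl ?rn_ge0.
exists (Num.min d ((rho - 1) / M)) => [|s /andP[s0]].
  by rewrite lt_min d0 divr_gt0 // subr_gt0.
rewrite lt_min ltr_pdivlMr // => /andP[sd sM].
have sd' : 0 < s < d by rewrite s0.
have [h _] := hd s sd'.
have := rn_triangle (lam s - 1 - s%:C * lam1) (1 + s%:C * lam1).
have -> : lam s - 1 - s%:C * lam1 + (1 + s%:C * lam1) = lam s by ring.
have := rn_triangle (1 : C) (s%:C * lam1); rewrite rn1 rnM rn_real gtr0_norm //.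
rewrite /M in sM; nra.
Qed.

(** If [L] is the strict differential of [Q] at [(z0, v)], then
    [D z0 = L (z0 * lam1, sig1)]. *)
Lemma variation_exists lam sig v (lam1 : C) (sig1 : V) Q :
  leaf_curve lam sig v lam1 sig1 -> leafwise Q -> exists D, is_variation lam sig v Q D.
Proof.
move=> hcurve [sQ _]; have [sv ssig hc] := hcurve.
suff ex (z0 : C) : exists l : C, rn z0 < 1 -> forall e : R, 0 < e -> exists2 d : R, 0 < d &
    forall (z : C) (s : R), rn (z - z0) < d -> 0 < s < d ->
      rn (Q (z * lam s, sig s) - Q (z, v) - s%:C * l) <= e * s.
  by have [D hD] := choice ex; exists D.
have [z01|z01] := ltP (rn z0) 1; last by exists 0.
have Az0 : (disc R `*` sphere R n) (z0, v) by split => //=; apply/discP.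
have [L [LD LZ [K K0 hK]] hL] := sQ _ Az0.
have LB x y : L (x - y) = L x - L y by apply: bounded_real_linearB; split => //; exists K.
exists (L (z0 * lam1, sig1)) => _ e e0.
pose M := rn lam1 + rn sig1 + 4.
have M0 : 0 < M by rewrite /M; have := rn_ge0 lam1; have := rn_ge0 sig1; lra.
have e1 : 0 < e / (2 * M) by rewrite divr_gt0 // mulr_gt0.
have [d1 d10 hd1] := hL _ e1.
have [e3 [e2 e31 e3M]] : exists e3 : R, [/\ 0 < e3, e3 <= 1 & e3 * (4 * K * M) <= e].
  exists (Num.min 1 (e / (4 * K * M))); split.
  - by rewrite lt_min ltr01 divr_gt0 // !mulr_gt0.
  - by rewrite ge_min lexx.
  - by rewrite -ler_pdivlMr ?mulr_gt0 // ge_min lexx orbT.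
have [d2 d20 hd2] := hc _ e2.
have [d [d_gt0 [dd2 dd1 de3 dz d11]]] : exists d : R, 0 < d /\
   [/\ d <= d2, d * (2 * M) <= d1, d <= e3, d * (2 * M) <= 1 - rn z0 & d <= 1].
  exists (Num.min (Num.min d2 (d1 / (2 * M))) (Num.min e3 (Num.min ((1 - rn z0) / (2 * M)) 1))).
  split; first by rewrite !lt_min d20 e2 ltr01 !divr_gt0 ?mulr_gt0 ?subr_gt0.
  by split; rewrite -?ler_pdivlMr ?mulr_gt0 // !ge_min lexx ?orbT.
exists d => // z s hz hs; have /andP[s0 sd] := hs.
have M4 : 4 <= M by rewrite /M; have := rn_ge0 lam1; have := rn_ge0 sig1; lra.
have hs2 : 0 < s < d2 by rewrite s0; exact: lt_le_trans sd dd2.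
have [hlam hsig] := hd2 s hs2.
clear hcurve sQ hL hc hd2.
have e3s : e3 * s <= s by rewrite ler_piMl // ltW.
have dM4 : d * 4 <= d * M by rewrite ler_pM2l.
have z1 : rn z < 1.
  by have := rn_triangle (z - z0) z0; rewrite subrK; clear - hz dz dM4 d_gt0; lra.
have lsz : rn (z * lam s - z) <= s * (rn lam1 + 1).
  have -> : z * lam s - z = z * ((lam s - 1 - s%:C * lam1) + s%:C * lam1) by ring.
  rewrite rnM; have := rn_triangle (lam s - 1 - s%:C * lam1) (s%:C * lam1).
  rewrite (rnM s%:C) rn_real gtr0_norm // => h.
  apply: le_trans (_ : 1 * (s * (rn lam1 + 1)) <= _); last by rewrite mul1r.
  apply: ler_pM; rewrite ?rn_ge0 ?(ltW z1) //; apply: le_trans h _.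
  by clear - hlam e3s; lra.
have ssz : rn (sig s - v) <= s * (rn sig1 + 1).
  have := rn_triangle (sig s - v - s%:C *: sig1) (s%:C *: sig1).
  by rewrite subrK rnZ rn_real gtr0_norm //; clear - hsig e3s; lra.
have sM : s * M <= d * M by rewrite ler_pM2r // ltW.
have dB (a b : C) (u w : V) : (a, u) - (b, w) = (a - b, u - w) by [].
have r1 := rn_ge0 lam1; have r2 := rn_ge0 sig1; have r3 := rn_ge0 z0.
have zl1 : rn (z * lam s) < 1.
  have := rn_triangle (z * lam s - z) z; rewrite subrK.
  have := rn_triangle (z - z0) z0; rewrite subrK.
  by rewrite /M in sM dz dM4; clear - lsz hz dz sM dM4 r2 s0 d_gt0; nra.
have hA : (disc R `*` sphere R n) (z, v) by split => //=; apply/discP.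
have hB : (disc R `*` sphere R n) (z * lam s, sig s).
  by split => /=; [apply/discP | apply: ssig; rewrite s0; exact: lt_le_trans sd d11].
have xd : rn ((z, v) - (z0, v)) < d1.
  rewrite dB; apply: le_lt_trans (rn_pair_le _) _; rewrite /= subrr rn0.
  by clear - hz dd1 dM4 d_gt0; lra.
have yd : rn ((z * lam s, sig s) - (z0, v)) < d1.
  rewrite dB; apply: le_lt_trans (rn_pair_le _) _ => /=.
  have := rn_sub_triangle (z * lam s) z z0.
  by rewrite /M in sM dd1 dM4; clear - lsz ssz hz dd1 dM4 sM s0 d_gt0; lra.
have := hd1 _ _ hA hB xd yd; clear hd1 xd yd hA hB ssig.
set u := (z * lam s, sig s) - (z, v) => hu.
have ru : rn u <= s * M.
  by apply: le_trans (rn_pair_le _) _ => /=; rewrite /M; clear - lsz ssz s0; lra.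
pose w : C * V := (s%:C * (z0 * lam1), s%:C *: sig1).
have rw : rn (u - w) <= s * (e3 * M).
  have -> : u - w = (z * (lam s - 1 - s%:C * lam1) + s%:C * lam1 * (z - z0),
                     sig s - v - s%:C *: sig1).
    by rewrite /u /w; congr pair => //=; ring.
  apply: le_trans (rn_pair_le _) _ => /=.
  have := rn_triangle (z * (lam s - 1 - s%:C * lam1)) (s%:C * lam1 * (z - z0)).
  rewrite !rnM rn_real gtr0_norm // => h.
  have h1 : rn z * rn (lam s - 1 - s%:C * lam1) <= e3 * s.
    by apply: le_trans hlam; rewrite ler_piMl ?rn_ge0 // ltW.
  have h2 : s * rn lam1 * rn (z - z0) <= s * rn lam1 * e3.
    apply: ler_wpM2l; [exact: mulr_ge0 (ltW s0) r1 | exact: le_trans (ltW hz) de3].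
  have h3 : 0 <= s * (rn sig1 + 2) * e3.
    by rewrite !mulr_ge0 ?(ltW s0) ?(ltW e2) // addr_ge0.
  by rewrite /M; clear - h h1 h2 h3 hsig; lra.
have Lw : s%:C * L (z0 * lam1, sig1) = L w by rewrite -[LHS]/(s%:C *: _) -LZ.
rewrite Lw; apply: le_trans (rn_sub_triangle _ (L u) _) _.
rewrite -LB; have hK' := hK (u - w).
have f1 : e / (2 * M) * rn u <= e / 2 * s.
  apply: le_trans (_ : e / (2 * M) * (s * M) <= _); first by rewrite ler_wpM2l // ltW.
  by rewrite le_eqVlt; apply/orP; left; apply/eqP; field; rewrite gt_eqF.
have f2 : K * rn (u - w) <= e / 2 * s.
  apply: le_trans (_ : K * (s * (e3 * M)) <= _); first by rewrite ler_pM2l.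
  by clear - e3M s0 e0; nra.
by clear - hu f1 f2 hK'; lra.
Qed.

Lemma variation_pointwise lam sig v Q D (z : C) : is_variation lam sig v Q D -> rn z < 1 ->
  forall e : R, 0 < e -> exists2 d : R, 0 < d & forall s : R, 0 < s < d ->
    rn (Q (z * lam s, sig s) - Q (z, v) - s%:C * D z) <= e * s.
Proof.
move=> hD hz e e0; have [d d0 hd] := hD z hz e e0; exists d => // s hs.
by apply: hd => //; rewrite subrr rn0.
Qed.

Lemma variation_uniform lam sig v Q D (rho : R) : is_variation lam sig v Q D -> rho < 1 ->
  forall e : R, 0 < e -> exists2 d : R, 0 < d & forall (z : C) (s : R), rn z <= rho -> 0 < s < d ->
    rn (Q (z * lam s, sig s) - Q (z, v) - s%:C * D z) <= e * s.
Proof.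
move=> hD r1 e e0; apply: uniform_on_disc => z0 hz0.
have z01 : rn z0 < 1 by apply: le_lt_trans r1.
have e20 : 0 < e / 2 by lra.
have [d d0 hd] := hD z0 z01 _ e20; exists d => // z s hz hzr hs.
have z1 : rn z < 1 by apply: le_lt_trans r1.
have DD : rn (D z - D z0) <= e / 2.
  apply/ler_addgt0Pr => k k0.
  have [d' d'0 hd'] := variation_pointwise hD z1 k0.
  pose t := Num.min d d' / 2.
  have t0 : 0 < t by rewrite divr_gt0 // lt_min d0.
  have td : 0 < t < d by rewrite t0 /t ltr_pdivrMr // gt_min; apply/orP; left; lra.
  have td' : 0 < t < d' by rewrite t0 /t ltr_pdivrMr // gt_min; apply/orP; right; lra.
  have h1 := hd z t hz td; have h2 := hd' t td'.
  have := rn_sub_triangle (t%:C * D z) (Q (z * lam t, sig t) - Q (z, v)) (t%:C * D z0).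
  have -> : rn (t%:C * D z - t%:C * D z0) = t * rn (D z - D z0).
    by rewrite -mulrBr rnM rn_real gtr0_norm.
  rewrite (rn_distC (t%:C * D z)) => h.
  rewrite -(ler_pM2l t0); lra.
have s0 : 0 < s by case/andP: hs.
have := rn_sub_triangle (Q (z * lam s, sig s) - Q (z, v)) (s%:C * D z0) (s%:C * D z).
have -> : rn (s%:C * D z0 - s%:C * D z) = s * rn (D z - D z0).
  by rewrite -mulrBr rnM rn_real gtr0_norm // (rn_distC (D z0)).
have := hd z s hz hs; nra.
Qed.

Lemma leafwise_family_approx lam sig v (lam1 : C) (sig1 : V) Q (rho : R) :
  leaf_curve lam sig v lam1 sig1 -> leafwise Q -> 0 < rho < 1 ->
  exists2 d : R, 0 < d & forall s : R, 0 < s < d ->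
    approx_by_polys rho (fun z => Q (z * lam s, sig s)).
Proof.
move=> hcurve hQ /andP[r0 r1]; have [sv ssig _] := hcurve.
have hr : 1 < (1 + rho) / 2 / rho by rewrite ltr_pdivlMr // mul1r; lra.
have [d d0 hd] := leaf_curve_scale_near hcurve hr.
exists (Num.min d 1) => [|s /andP[s0]]; first by rewrite lt_min d0 ltr01.
rewrite lt_min => /andP[sd s1].
apply: (@approx_scale R ((1 + rho) / 2) rho (lam s) (fun z => Q (z, sig s))).
  by rewrite -ler_pdivlMr // hd // s0.
apply: (leafwise_disc_holo hQ); first by apply: ssig; rewrite s0.
by apply/andP; split; lra.
Qed.

Lemma variation_disc_holo lam sig v (lam1 : C) (sig1 : V) Q D :
  leaf_curve lam sig v lam1 sig1 -> leafwise Q -> is_variation lam sig v Q D -> disc_holo D.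
Proof.
move=> hcurve hQ hD rho r01; have /andP[r0 r1] := r01; have [sv _ _] := hcurve.
apply: approx_limit => e e0.
have [d1 d10 hd1] := leafwise_family_approx hcurve hQ r01.
have [d2 d20 hd2] := variation_uniform hD r1 e0.
pose s := Num.min d1 d2 / 2.
have s0 : 0 < s by rewrite divr_gt0 // lt_min d10.
have sd1 : 0 < s < d1 by rewrite s0 /s ltr_pdivrMr // gt_min; apply/orP; left; lra.
have sd2 : 0 < s < d2 by rewrite s0 /s ltr_pdivrMr // gt_min; apply/orP; right; lra.
have sC : s%:C != 0 by rewrite -rn_gt0 rn_real gtr0_norm.
exists (fun z => (Q (z * lam s, sig s) + (-1) * Q (z, v)) * s%:C^-1).
  apply: approxM; last by apply: approx_eq (approx_poly rho (s%:C^-1)%:P) => z _; rewrite hornerC.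
  apply: approxD; first exact: hd1.
  apply: approxM; first by apply: approx_eq (approx_poly rho (-1)%:P) => z _; rewrite hornerC.
  exact: leafwise_disc_holo r01.
move=> z hz; have := hd2 z s hz sd2; rewrite rn_distC.
have -> : s%:C * D z - (Q (z * lam s, sig s) - Q (z, v)) =
  (D z - (Q (z * lam s, sig s) + -1 * Q (z, v)) / s%:C) * s%:C by field.
by rewrite rnM rn_real gtr0_norm // ler_pM2r.
Qed.

End Variations.

(** * Coordinates and pullbacks *)

Section Foliation.
Context {R : realType} {n : nat}.
Local Notation C := R[i].
Local Notation V := 'rV[C]_n.

Lemma rn_coord (x : V) j : rn (x 0 j) <= rn x.
Proof.
rewrite -lecR !rnE [leRHS]/Num.norm /= mx_normE.
have : (`|x 0 j|%:nng <= \big[Num.max/0%:nng]_i `|x i.1 i.2|%:nng)%R.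
  by apply/bigmax_geP; right; exists (0, j).
by rewrite -num_le.
Qed.

Lemma rn_row_le (x : V) (M : R) : 0 <= M -> (forall j, rn (x 0 j) <= M) -> rn x <= M.
Proof.
move=> M0 h; have [x0|] := eqVneq (mx_norm x) 0.
  by rewrite /rn [`|x|]/Num.norm /= x0.
move=> /mx_norm_neq0[[a j] /=]; rewrite ord1 => hx.
by rewrite /rn [`|x|]/Num.norm /= hx -/(rn _).
Qed.

Lemma coord_linear j : bounded_real_linear (fun x : V => x 0 j).
Proof.
split=> [x y|a x|]; rewrite ?mxE //.
by exists 1 => // x; rewrite mul1r rn_coord.
Qed.

Lemma complex_derivative_coord (g : C -> V) z (c : V) j :
  has_complex_derivative g z c -> has_complex_derivative (fun z => g z 0 j) z (c 0 j).
Proof.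
move=> hg e e0; have [d d0 hd] := hg e e0; exists d => // u hu.
have -> : g (u + z) 0 j - g z 0 j - u *: c 0 j = (g (u + z) - g z - u *: c) 0 j.
  by rewrite !mxE.
exact: le_trans (rn_coord _ _) (hd u hu).
Qed.

Lemma complex_derivative_holomorphic (W : normedModType C) (g : C -> W) (z : C) :
  holomorphic_on (disc R) g -> rn z < 1 -> has_complex_derivative g z ('D_1 g z).
Proof. by move=> hg hz; apply: differentiable_complex_derivative; apply: hg; apply/discP. Qed.

Variable h : C -> V -> V.
Hypothesis foliation : disc_foliation h.

Lemma foliation_strict x : (disc R `*` sphere R n) x ->
  strictly_differentiable (disc R `*` sphere R n) (fun zv : C * V => h zv.1 zv.2) x.
Proof. by case: foliation => hC1 _; exact: real_C1_on_strictly_differentiable. Qed.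

Lemma foliation_holomorphic v : sphere R n v -> holomorphic_on (disc R) (h ^~ v).
Proof. by case: foliation => _ [+ _ _ _ _] sv => /(_ v sv)[]. Qed.

Lemma coordinate_leafwise j : leafwise (fun zv : C * V => h zv.1 zv.2 0 j).
Proof.
split=> [x Ax|v z sv hz].
  apply: (@strictly_differentiable_comp R _ _ _ _ (fun zv : C * V => h zv.1 zv.2) (fun x : V => x 0 j)) => //.
    exact: foliation_strict.
  exact/strictly_differentiable_linear/coord_linear.
exists (('D_1 (h ^~ v) z) 0 j); apply: complex_derivative_coord.
by apply: complex_derivative_holomorphic => //; apply: foliation_holomorphic.
Qed.

Lemma pullback_leafwise (Omega : set V) (f : V -> C) :
  [set h z v | z in disc R & v in sphere R n] `<=` Omega ->
  real_C1_open Omega f ->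
  (forall v, sphere R n v -> holomorphic_on (disc R) (fun z => f (h z v))) ->
  leafwise (fun zv : C * V => f (h zv.1 zv.2)).
Proof.
move=> hO fC1 hf; split=> [x Ax|v z sv hz].
  apply: (@strictly_differentiable_comp R _ _ _ _ (fun zv : C * V => h zv.1 zv.2) f) => //.
    exact: foliation_strict.
  apply: C1_strictly_differentiable fC1 _; apply: hO.
  by case: Ax => Ax1 Ax2; exists x.1 => //; exists x.2.
exists ('D_1 (fun z => f (h z v)) z).
by apply: complex_derivative_holomorphic => //; apply: hf.
Qed.

Lemma foliation_radius : exists r : V -> R, forall v, sphere R n v ->
  [/\ 0 < r v, h 0 v = 0 & has_complex_derivative (h ^~ v) 0 ((r v)%:C *: v)].
Proof.
have [_ [_ h0 _ hr _]] := foliation.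
have ex v : exists a : R, sphere R n v -> [/\ 0 < a, h 0 v = 0 & has_complex_derivative (h ^~ v) 0 (a%:C *: v)].
  have [sv|nsv] := pselect (sphere R n v); last by exists 0.
  have [a a0 ha] := hr v sv; exists a => _; split => //; first exact: h0.
  rewrite -ha; apply: complex_derivative_holomorphic; first exact: foliation_holomorphic.
  by rewrite rn0.
by have [r hr'] := choice ex; exists r.
Qed.

End Foliation.

(** * Curves on the sphere *)

Section SphereCurves.
Context {R : realType} {n : nat}.
Local Notation C := R[i].
Local Notation V := 'rV[C]_n.

Lemma sphereP (v : V) : sphere R n v <-> \sum_k rn (v 0 k) ^+ 2 = 1.
Proof.
have -> : sphere R n v = ((\sum_k rn (v 0 k) ^+ 2)%:C = 1).
  rewrite /sphere /= rmorph_sum /=; congr (_ = _); apply: eq_bigr => k _.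
  by rewrite rmorphXn /= rnE.
by split=> [h|->//]; apply: (@complexI R); rewrite h.
Qed.

Lemma sphere_coord_le1 (v : V) k : sphere R n v -> rn (v 0 k) <= 1.
Proof.
move=> /sphereP sv; rewrite -(@expr_le1 _ 2) ?rn_ge0 // -sv.
by rewrite (bigD1 k) //= lerDl sumr_ge0 // => i _; apply: exprn_ge0; apply: rn_ge0.
Qed.

Lemma sphere_coord_neq0 (v : V) : sphere R n v -> exists k, v 0 k != 0.
Proof.
move=> /sphereP sv; apply/not_existsP => h.
move: sv; rewrite big1 => [/esym/eqP|k _]; first by rewrite oner_eq0.
by have := h k => /negP/negPn/eqP ->; rewrite rn0 expr0n.
Qed.

(** Stereographic projection from [- v]: the second intersection with the sphere
    of the line through [- v] in the direction [2 *: v + s *: (e *: delta_j)], a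
    rational curve through [v] with velocity the tangential part of
    [e *: delta_j]. *)
Definition stereo_tau (v : V) j (e : C) (s : R) : R :=
  let c := complex.Re ((v 0 j)^*%C * e) in
  (4 + 2 * s * c) / (4 + 4 * s * c + s ^+ 2).

Definition stereo (v : V) j (e : C) (s : R) : V :=
  let t := stereo_tau v j e s in
  (2 * t - 1)%:C *: v + (t * s)%:C *: (e *: delta_mx 0 j).

Section Stereo.
Variables (v : V) (j : 'I_n) (e : C).
Hypotheses (sv : sphere R n v) (e1 : rn e = 1).
Let c := complex.Re ((v 0 j)^*%C * e).
Let tau := stereo_tau v j e.

Lemma stereo_c_le1 : `|c| <= 1.
Proof.
apply: le_trans (normRe_le _) _; rewrite rnM rn_conj e1 mulr1.
exact: sphere_coord_le1.
Qed.

Lemma stereo_den s : 0 < s < 1 -> 1 <= 4 + 4 * s * c + s ^+ 2.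
Proof.
move=> /andP[s0 s1]; have := stereo_c_le1; rewrite ler_norml => /andP[c1 c2]; nra.
Qed.

Lemma stereo_tauE s : 0 < s < 1 -> tau s * (4 + 4 * s * c + s ^+ 2) = 4 + 2 * s * c.
Proof.
by move=> hs; rewrite /tau /stereo_tau -/c divfK // gt_eqF // (lt_le_trans ltr01) // stereo_den.
Qed.

Lemma stereo_sphere s : 0 < s < 1 -> sphere R n (stereo v j e s).
Proof.
move=> hs; apply/sphereP; rewrite (bigD1 j) //=.
have tE := stereo_tauE hs.
under eq_bigr => k kj.
  rewrite !mxE eqxx (negbTE kj) /= mulr0 mulr0 addr0 rnM exprMn rn_real real_normK ?num_real //; over.
rewrite -mulr_sumr.
have /sphereP := sv; rewrite (bigD1 j) //= => /(canRL (addKr _)) ->.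
rewrite !mxE !eqxx mulr1 !sqr_rn.
have := e1 => /(congr1 (fun x => x ^+ 2)); rewrite expr1n sqr_rn.
rewrite -/(tau s); set t := tau s in tE *; move: tE; rewrite /c.
case: (v 0 j) => a b; case: (e) => p q /=.
rewrite !mul0r !subr0 !addr0 => tE pq.
have -> : p = p * 1 by rewrite mulr1.
set x := 2 * t - 1.
set cc := a * p - - b * q in tE.
transitivity (x ^+ 2 + 2 * x * (t * s) * cc + (t * s) ^+ 2 * (p ^+ 2 + q ^+ 2)).
  by rewrite /cc; ring.
rewrite pq mulr1.
transitivity (1 + t * (t * (4 + 4 * s * cc + s ^+ 2) - (4 + 2 * s * cc))).
  by rewrite /x; ring.
by rewrite tE subrr mulr0 addr0.
Qed.

Lemma stereo_tau_near s : 0 < s < 1 -> `|tau s - 1| <= 3 * s.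
Proof.
move=> hs; have D1 := stereo_den hs; have tE := stereo_tauE hs.
have /andP[s0 s1] := hs; have := stereo_c_le1; rewrite ler_norml => /andP[c1 c2].
have h : (tau s - 1) * (4 + 4 * s * c + s ^+ 2) = - (2 * s * c) - s ^+ 2 by rewrite mulrBl tE; ring.
have : `|(tau s - 1) * (4 + 4 * s * c + s ^+ 2)| <= 3 * s.
  by rewrite h ler_norml; apply/andP; split; nra.
rewrite normrM => h2; apply: le_trans h2.
by rewrite ler_peMr // ger0_norm //; lra.
Qed.

Lemma stereo_mu_near s : 0 < s < 1 -> `|2 * tau s - 1 - 1 + s * c| <= 7 * s ^+ 2.
Proof.
move=> hs; have D1 := stereo_den hs; have tE := stereo_tauE hs.
have /andP[s0 s1] := hs; have := stereo_c_le1; rewrite ler_norml => /andP[c1 c2].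
have h : (2 * tau s - 1 - 1 + s * c) * (4 + 4 * s * c + s ^+ 2) =
   s ^+ 2 * (- 2 + 4 * c ^+ 2 + s * c).
  have -> : (2 * tau s - 1 - 1 + s * c) * (4 + 4 * s * c + s ^+ 2) =
   2 * (tau s * (4 + 4 * s * c + s ^+ 2)) + (s * c - 2) * (4 + 4 * s * c + s ^+ 2) by ring.
  by rewrite tE; ring.
have : `|(2 * tau s - 1 - 1 + s * c) * (4 + 4 * s * c + s ^+ 2)| <= 7 * s ^+ 2.
  rewrite h normrM ger0_norm ?sqr_ge0 // mulrC ler_wpM2r ?sqr_ge0 //.
  by rewrite ler_norml; apply/andP; split; nra.
rewrite normrM => h2; apply: le_trans h2.
by rewrite ler_peMr // ger0_norm //; lra.
Qed.

Lemma stereo_curve :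
  leaf_curve (fun=> 1) (stereo v j e) v 0 (e *: delta_mx 0 j - c%:C *: v).
Proof.
split => // [s hs|a a0]; first exact: stereo_sphere.
set xi : V := e *: delta_mx 0 j.
pose M := 7 * rn v + 3 * rn xi + 1.
have M0 : 0 < M by rewrite /M; have := rn_ge0 v; have := rn_ge0 xi; lra.
exists (Num.min 1 (a / M)) => [|s /andP[s0]]; first by rewrite lt_min ltr01 divr_gt0.
rewrite lt_min ltr_pdivlMr // => /andP[s1 sM].
have hs : 0 < s < 1 by rewrite s0.
split; first by rewrite mulr0 subrr subrr rn0 mulr_ge0 // ltW.
have -> : stereo v j e s - v - s%:C *: (xi - c%:C *: v) =
   (2 * tau s - 1 - 1 + s * c)%:C *: v + ((tau s - 1) * s)%:C *: xi.
  rewrite /stereo -/(tau s) -/xi; apply/rowP => k; rewrite !mxE.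
  by rewrite !(rmorphD, rmorphB, rmorphM, rmorph1, rmorph_nat) /=; ring.
apply: le_trans (rn_triangle _ _) _; rewrite (rnZ _ v) (rnZ _ xi) !rn_real normrM (gtr0_norm s0).
have A : `|2 * tau s - 1 - 1 + s * c| * rn v <= 7 * s ^+ 2 * rn v.
  by rewrite ler_wpM2r ?rn_ge0 // stereo_mu_near.
have B : `|tau s - 1| * s * rn xi <= 3 * s * s * rn xi.
  by rewrite ler_wpM2r ?rn_ge0 // ler_wpM2r ?stereo_tau_near // ltW.
apply: le_trans (lerD A B) _.
have : s * (s * M) <= s * a by rewrite ler_pM2l // ltW.
rewrite /M; move: (rn v) (rn xi) => q p h; nra.
Qed.

End Stereo.

(** Rotating and rescaling the parameter of one leaf. *)
Lemma dilation_curve (v : V) (e : C) : sphere R n v ->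
  leaf_curve (fun s => 1 + s%:C * e) (fun=> v) v e 0.
Proof.
move=> sv; split => // a a0; exists 1 => // s /andP[s0 _].
by rewrite addrAC addrK subrr rn0 scaler0 subr0 subrr rn0 mulr_ge0 // ltW.
Qed.

End SphereCurves.

(** * First-order term of a variation *)

Section FirstOrder.
Context {R : realType}.
Local Notation C := R[i].

Lemma taylor_first_order (g : C -> C) (rho A : R) : 0 < rho -> approx_by_polys rho g ->
  (forall z, rn z <= rho -> rn (g z) <= A) ->
  exists c : C, rn c * rho <= A /\
    forall z, rn z <= rho / 2 -> rn (g z - g 0 - z * c) <= 2 * A * (rn z / rho) ^+ 2.
Proof.
move=> r0 hg hA; have [c [hc1 hc2]] := taylor_expansion r0 hg hA.
exists (c 1%N); split=> [|z hz]; first exact: (hc1 1%N).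
have g0 : g 0 = c 0%N.
  apply/eqP; rewrite -subr_eq0; apply/eqP/rn0_eq0/le_anti; rewrite rn_ge0 andbT.
  have := hc2 1%N 0; rewrite rn0 big_ord_recr big_ord0 /= expr0 mulr1 add0r mul0r expr1 mulr0.
  by apply; lra.
have := hc2 2%N z hz; rewrite !big_ord_recr big_ord0 /= expr0 mulr1 add0r expr1.
by rewrite g0 opprD addrA (mulrC z).
Qed.

Lemma complex_derivative_of_quadratic (g : C -> C) (c : C) (B d : R) : 0 < d ->
  (forall z, rn z <= d -> rn (g z - g 0 - z * c) <= B * rn z ^+ 2) ->
  has_complex_derivative g 0 c.
Proof.
move=> d0 hg e e0; pose M := `|B| + 1.
have M0 : 0 < M by rewrite ltr_wpDl.
exists (Num.min d (e / M)) => [|z]; first by rewrite lt_min d0 divr_gt0.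
rewrite lt_min ltr_pdivlMr // => /andP[z1 z2]; rewrite addr0.
apply: le_trans (hg z (ltW z1)) _.
have := ler_norm B; have := rn_ge0 z; move: z2; rewrite /M; move: (rn z) => x.
have := normr_ge0 B; move: `|B| => b b0 xb x0 Bb; nra.
Qed.

Lemma complex_derivative_unique (g : C -> C) (z c1 c2 : C) :
  has_complex_derivative g z c1 -> has_complex_derivative g z c2 -> c1 = c2.
Proof.
move=> h1 h2; apply/eqP; rewrite -subr_eq0; apply/eqP/rn0_eq0/le_anti; rewrite rn_ge0 andbT.
apply/ler_addgt0Pr => e e0; rewrite add0r; have e20 : 0 < e / 2 by lra.
have [d1 d10 hd1] := h1 _ e20; have [d2 d20 hd2] := h2 _ e20.
pose t := Num.min d1 d2 / 2.
have t0 : 0 < t by rewrite divr_gt0 // lt_min d10.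
have td1 : t < d1 by rewrite /t ltr_pdivrMr // gt_min; apply/orP; left; lra.
have td2 : t < d2 by rewrite /t ltr_pdivrMr // gt_min; apply/orP; right; lra.
have rt : rn (t%:C : C) = t by rewrite rn_real gtr0_norm.
have := hd1 t%:C; have := hd2 t%:C; rewrite rt => /(_ td2) a2 /(_ td1) a1.
have := rn_sub_triangle (t%:C * c1) (g (t%:C + z) - g z) (t%:C * c2).
rewrite -mulrBr rnM rt rn_distC => h; rewrite -(ler_pM2l t0).
rewrite /GRing.scale /= in a1 a2; lra.
Qed.

(** Cauchy's estimate for the first Taylor coefficient, which is the derivative. *)
Lemma cauchy_derivative (g : C -> C) (rho A : R) (c : C) : 0 < rho -> approx_by_polys rho g ->
  (forall z, rn z <= rho -> rn (g z) <= A) -> has_complex_derivative g 0 c -> rn c * rho <= A.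
Proof.
move=> r0 hg hA hc; have [c' [hc1 hc2]] := taylor_first_order r0 hg hA.
suff -> : c = c' by [].
apply: complex_derivative_unique hc _.
apply: (@complex_derivative_of_quadratic _ _ (2 * A / rho ^+ 2) (rho / 2)); first by lra.
by move=> z hz; apply: le_trans (hc2 z hz) _; rewrite expr_div_n mulrA mulrAC.
Qed.

Lemma complex_derivativeB (g1 g2 : C -> C) z (c1 c2 : C) :
  has_complex_derivative g1 z c1 -> has_complex_derivative g2 z c2 ->
  has_complex_derivative (fun z => g1 z - g2 z) z (c1 - c2).
Proof.
move=> h1 h2 e e0; have e20 : 0 < e / 2 by lra.
have [d1 d10 hd1] := h1 _ e20; have [d2 d20 hd2] := h2 _ e20.
exists (Num.min d1 d2) => [|u]; first by rewrite lt_min d10.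
rewrite lt_min => /andP[/hd1 u1 /hd2 u2].
rewrite (_ : _ - _ - _ = (g1 (u + z) - g1 z - u *: c1) - (g2 (u + z) - g2 z - u *: c2)); last first.
  by rewrite /GRing.scale /=; ring.
apply: le_trans (rn_triangle _ _) _; rewrite rnN; lra.
Qed.

Lemma complex_derivative_scale (g : C -> C) (c a : C) :
  has_complex_derivative g 0 c -> has_complex_derivative (fun z => g (z * a)) 0 (a * c).
Proof.
move=> h e e0; pose M := rn a + 1.
have M0 : 0 < M by rewrite ltr_wpDl ?rn_ge0.
have eM : 0 < e / M by rewrite divr_gt0.
have [d d0 hd] := h _ eM; exists (d / M) => [|u]; first by rewrite divr_gt0.
rewrite ltr_pdivlMr // => hu.
have ua : rn (u * a) < d.
  by rewrite rnM; apply: le_lt_trans hu; rewrite ler_wpM2l ?rn_ge0 // lerDl.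
have := hd _ ua; rewrite !addr0 mul0r /GRing.scale /= mulrA => h1; apply: le_trans h1 _.
rewrite rnM mulrA mulrAC mulrC mulrA mulrAC -mulrA mulrC.
rewrite ler_wpM2r ?rn_ge0 //.
by rewrite mulrC -mulrA ler_piMr ?(ltW e0) // mulrC ler_pdivrMr // mul1r lerDl.
Qed.

Lemma complex_derivative_mull (g : C -> C) (c a : C) z :
  has_complex_derivative g z c -> has_complex_derivative (fun z => a * g z) z (a * c).
Proof.
move=> h e e0; pose M := rn a + 1.
have M0 : 0 < M by rewrite ltr_wpDl ?rn_ge0.
have eM : 0 < e / M by rewrite divr_gt0.
have [d d0 hd] := h _ eM; exists d => // u /hd.
have -> : a * g (u + z) - a * g z - u *: (a * c) = a * (g (u + z) - g z - u *: c).
  by rewrite /GRing.scale /=; ring.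
move=> hu; rewrite rnM; apply: le_trans (_ : M * (e / M * rn u) <= _).
  by apply: ler_pM; rewrite ?rn_ge0 // lerDl.
by rewrite le_eqVlt; apply/orP; left; apply/eqP; field; rewrite gt_eqF.
Qed.

Lemma disc_holo_first_order (g : C -> C) : disc_holo g -> exists (c : C) (B : R),
  has_complex_derivative g 0 c /\ forall z, rn z <= 4^-1 -> rn (g z - g 0 - z * c) <= B * rn z ^+ 2.
Proof.
move=> hg; have h2 : 0 < (2^-1 : R) < 1 by apply/andP; split; lra.
have [A A0 hA] := approx_bounded (hg _ h2).
have [c [_ hc]] := taylor_first_order (andP h2).1 (hg _ h2) hA.
have h (z : C) : rn z <= 4^-1 -> rn (g z - g 0 - z * c) <= 8 * A * rn z ^+ 2.
  move=> hz; apply: le_trans (hc z _) _; first by lra.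
  by rewrite invrK exprMn; lra.
exists c, (8 * A); split => //=.
by apply: complex_derivative_of_quadratic h; rewrite invr_gt0.
Qed.

Context {n : nat}.
Local Notation V := 'rV[C]_n.

(** Cauchy's estimate lets the variation commute with the derivative at the centre
    of the discs. *)
Lemma variation_derivative (lam : R -> C) (sig : R -> V) (v : V) (lam1 : C) (sig1 : V)
    (Q : C * V -> C) (D : C -> C) (q : V -> C) (c : C) :
  leaf_curve lam sig v lam1 sig1 -> leafwise Q -> is_variation lam sig v Q D ->
  (forall w, sphere R n w -> has_complex_derivative (fun z => Q (z, w)) 0 (q w)) ->
  has_complex_derivative D 0 c ->
  forall e : R, 0 < e -> exists2 d : R, 0 < d & forall s : R, 0 < s < d ->
    rn (lam s * q (sig s) - q v - s%:C * c) <= e * s.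
Proof.
move=> hcurve hQ hD hq hc e e0; have [sv ssig _] := hcurve.
have h2 : 0 < (2^-1 : R) < 1 by apply/andP; split; lra.
have e20 : 0 < e / 2 by lra.
have [d1 d10 hd1] := variation_uniform hD (andP h2).2 e20.
have [d2 d20 hd2] := leafwise_family_approx hcurve hQ h2.
exists (Num.min 1 (Num.min d1 d2)) => [|s /andP[s0]]; first by rewrite !lt_min ltr01 d10.
rewrite !lt_min => /and3P[s1 sd1 sd2].
pose g z := Q (z * lam s, sig s) - Q (z, v) - s%:C * D z.
have hg : has_complex_derivative g 0 (lam s * q (sig s) - q v - s%:C * c).
  apply: complex_derivativeB; last exact: complex_derivative_mull.
  apply: complex_derivativeB; last exact: hq.
  apply: (complex_derivative_scale (g := fun z => Q (z, sig s))).
  by apply: hq; apply: ssig; rewrite s0.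
have ag : approx_by_polys (2^-1) g.
  have -> : g = (fun z => (Q (z * lam s, sig s) + -1 * Q (z, v)) + (- s%:C) * D z).
    by apply/funext => z; rewrite /g mulN1r mulNr.
  have ac a : approx_by_polys (2^-1) (fun=> a : C).
    by apply: approx_eq (approx_poly _ a%:P) => z _; rewrite hornerC.
  apply: approxD; last by apply: approxM => //; apply: (variation_disc_holo hcurve hQ hD).
  apply: approxD; first by apply: hd2; rewrite s0.
  by apply: approxM => //; apply: leafwise_disc_holo h2.
have := cauchy_derivative (andP h2).1 ag _ hg => /(_ (e / 2 * s)) h.
have {}h : rn (lam s * q (sig s) - q v - s%:C * c) / 2 <= e / 2 * s.
  by apply: h => z hz; apply: hd1 => //; rewrite s0.
lra.
Qed.

Section RadialDerivative.
Variables (v : V) (r : V -> R) (Q : 'I_n -> C * V -> C).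
Hypotheses (sv : sphere R n v) (hQ : forall k, leafwise (Q k))
  (r0 : forall w, sphere R n w -> 0 < r w)
  (hr : forall w k, sphere R n w -> has_complex_derivative (fun z => Q k (z, w)) 0 ((r w)%:C * w 0 k)).

(** The leaf does not move, so only the factor [1 + s * e] of the parameter counts. *)
Lemma dilation_first_order (e : C) (D : 'I_n -> C -> C) (c : 'I_n -> C) :
  (forall k, is_variation (fun s => 1 + s%:C * e) (fun=> v) v (Q k) (D k)) ->
  (forall k, has_complex_derivative (D k) 0 (c k)) ->
  forall k, c k = (r v)%:C * (e * v 0 k).
Proof.
move=> hD hc k; have hv := variation_derivative (dilation_curve e sv) (hQ k) (hD k)
  (fun w sw => hr k sw) (hc k).
apply/eqP; rewrite -subr_eq0 -oppr_eq0 opprB; apply/eqP/rn0_eq0/le_anti; rewrite rn_ge0 andbT.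
apply/ler_addgt0Pr => a a0; rewrite add0r; have [d d0 hd] := hv a a0.
have d20 : 0 < d / 2 by lra.
have := hd (d / 2); rewrite d20 => /(_ _) h.
rewrite -(ler_pM2r d20); apply: le_trans (h _); last by apply/andP; split => //; lra.
rewrite -[X in _ * X](gtr0_norm d20) -rn_real mulrC -rnM le_eqVlt; apply/orP; left; apply/eqP.
by congr rn; ring.
Qed.

(** The velocities at the centre are [r w * w]; differentiating along the curve gives
    [r v] times the direction, up to a multiple of [v] that accounts for the speed of the
    curve and for the variation of [r].  The existence of the latter is read off the
    coordinate [j0], where the direction vanishes. *)
Lemma stereo_first_order (j j0 : 'I_n) (e : C) (D : 'I_n -> C -> C) (c : 'I_n -> C) :
  rn e = 1 -> j != j0 -> v 0 j0 != 0 ->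
  (forall k, is_variation (fun=> 1) (stereo v j e) v (Q k) (D k)) ->
  (forall k, has_complex_derivative (D k) 0 (c k)) ->
  exists a : C, forall k, c k = a * v 0 k + (r v)%:C * (e * (k == j)%:R).
Proof.
move=> e1 jj0 vj0 hD hc; pose w := v 0 j0; pose a := c j0 / w.
have w0 : 0 < rn w by rewrite rn_gt0.
exists a => k.
have hcurve := stereo_curve j sv e1.
have hv i := variation_derivative hcurve (hQ i) (hD i) (fun w sw => hr i sw) (hc i).
apply/eqP; rewrite -subr_eq0 -oppr_eq0 opprB; apply/eqP/rn0_eq0/le_anti; rewrite rn_ge0 andbT.
apply/ler_addgt0Pr => b b0; rewrite add0r.
set x := e * (k == j)%:R.
have x1 : rn x <= 1 by rewrite rnM e1 mul1r rn_natr; case: (k == j); rewrite ?lexx ?ler01.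
pose M := 1 + rn (v 0 k) / rn w.
have M1 : 1 <= M by rewrite lerDl divr_ge0 ?rn_ge0.
have M0 : 0 < M by lra.
pose b1 := b / (2 * M).
have b10 : 0 < b1 by rewrite divr_gt0 // mulr_gt0.
have [d1 d10 hd1] := hv j0 _ b10; have [d2 d20 hd2] := hv k _ b10.
pose B := rn a + b1 / rn w.
have B0 : 0 <= B by rewrite addr_ge0 ?rn_ge0 // ltW // divr_gt0.
pose K := 8 * B + 6 * r v + 1.
have rv0 : 0 < r v by apply: r0.
have K0 : 0 < K by rewrite /K; lra.
have [s [s0 [s12 sd1 sd2 sK]]] : exists s : R, 0 < s /\
    [/\ s <= 12^-1, s < d1, s < d2 & s * K <= b / 2].
  exists (Num.min (Num.min 12^-1 (d1 / 2)) (Num.min (d2 / 2) (b / 2 / K))).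
  split.
    have p4 : 0 < b / 2 / K by apply: divr_gt0 => //; lra.
    by rewrite !lt_min p4 andbT; apply/andP; split; [apply/andP; split|]; lra.
  have e2 (y : R) : 0 < y -> y / 2 < y by move=> ?; lra.
  split; rewrite -?ler_pdivlMr //.
  - by rewrite !ge_min lexx.
  - by apply: le_lt_trans (e2 _ d10); rewrite !ge_min lexx ?orbT.
  - by apply: le_lt_trans (e2 _ d20); rewrite !ge_min lexx ?orbT.
  - by rewrite !ge_min lexx ?orbT.
have hs : 0 < s < 1 by rewrite s0; lra.
pose sg := stereo v j e s; pose t := stereo_tau v j e s; pose mu := 2 * t - 1.
have ht : `|t - 1| <= 3 * s by apply: stereo_tau_near.
have ssg : sphere R n sg by apply: stereo_sphere.
have sgE i : sg 0 i = mu%:C * v 0 i + (t * s)%:C * (e * (i == j)%:R).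
  by rewrite /sg /stereo !mxE eqxx /=.
have := hd1 s; rewrite s0 => /(_ sd1); rewrite -/sg mul1r sgE eq_sym (negbTE jj0) !mulr0 addr0 => h1.
have := hd2 s; rewrite s0 => /(_ sd2); rewrite -/sg mul1r sgE -/x => h2.
pose u := (r sg)%:C * mu%:C - (r v)%:C - s%:C * a.
have hu : rn u <= b1 / rn w * s.
  rewrite -mulrAC ler_pdivlMr // -rnM; apply: le_trans h1.
  rewrite le_eqVlt; apply/orP; left; apply/eqP; congr rn.
  have -> : c j0 = a * w by rewrite /a divfK // -rn_gt0.
  by rewrite /u /w; ring.
pose y := (r sg)%:C * t%:C * x + a * v 0 k - c k.
have hy : rn y <= b / 2.
  have yE : s%:C * y = ((r sg)%:C * (mu%:C * v 0 k + (t * s)%:C * x) - (r v)%:C * v 0 k - s%:C * c k)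
     - u * v 0 k by rewrite /y /u (rmorphM _ t s) /=; clearbody mu t a x; ring.
  have : rn (s%:C * y) <= b1 * s + b1 / rn w * s * rn (v 0 k).
    rewrite yE; apply: le_trans (rn_triangle _ _) _; rewrite rnN rnM.
    by apply: lerD => //; rewrite ler_wpM2r ?rn_ge0.
  rewrite rnM rn_real gtr0_norm // => h; rewrite -(ler_pM2l s0); apply: le_trans h _.
  have -> : b1 * s + b1 / rn w * s * rn (v 0 k) = s * (b1 * M) by rewrite /M; field; rewrite gt_eqF.
  rewrite ler_pM2l // le_eqVlt; apply/orP; left; apply/eqP; rewrite /b1; field; rewrite gt_eqF //.
have hu2 : `|r sg * mu - r v| <= B * s.
  rewrite -rn_real rmorphB rmorphM /=.
  have -> : (r sg)%:C * mu%:C - (r v)%:C = u + s%:C * a by rewrite /u; ring.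
  apply: le_trans (rn_triangle _ _) _; rewrite rnM rn_real gtr0_norm // /B.
  by rewrite mulrDl addrC (mulrC s) lerD.
have hrt : `|r sg * t - r v| <= b / 2.
  have : mu * `|r sg * t - r v| <= 4 * B * s + 3 * r v * s.
    have mu0 : 0 <= mu by move: ht; rewrite ler_norml /mu => /andP[]; lra.
    rewrite -{1}(ger0_norm mu0) -normrM.
    have -> : mu * (r sg * t - r v) = t * (r sg * mu - r v) + r v * (1 - t).
      by rewrite /mu; ring.
    apply: le_trans (ler_normD _ _) _; rewrite (normrM t) (normrM (r v)) (gtr0_norm rv0) (distrC 1).
    have t4 : `|t| <= 4.
      by move: ht; rewrite !ler_norml => /andP[? ?]; apply/andP; split; lra.
    have : `|t| * `|r sg * mu - r v| <= 4 * (B * s) by apply: ler_pM.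
    have : r v * `|t - 1| <= r v * (3 * s) by rewrite ler_pM2l.
    lra.
  have mu2 : 2^-1 <= mu by move: ht; rewrite ler_norml /mu => /andP[]; lra.
  have := normr_ge0 (r sg * t - r v); rewrite /K in sK; move: `|_ - _| => p p0 hp.
  have : p / 2 <= mu * p by nra.
  lra.
have -> : a * v 0 k + (r v)%:C * x - c k = y - (r sg * t - r v)%:C * x.
  by rewrite /y rmorphB (rmorphM _ (r sg) t) /=; clearbody mu t a x; ring.
apply: le_trans (rn_triangle _ _) _; rewrite rnN rnM rn_real.
have : `|r sg * t - r v| * rn x <= b / 2 * 1 by apply: ler_pM; rewrite ?rn_ge0.
lra.
Qed.

End RadialDerivative.
End FirstOrder.

(** * Polynomials in the variables and their conjugates *)

Section PolynomialTerms.
Context {R : realType} {n : nat}.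
Local Notation C := R[i].
Local Notation V := 'rV[C]_n.

Definition bimonomial (al be : 'I_n -> nat) (z : V) : C :=
  (\prod_j z 0 j ^+ al j) * (\prod_j (z 0 j)^*%C ^+ be j).

(* a coefficient, the exponents of the variables, those of their conjugates *)
Local Notation term := (C * ('I_n -> nat) * ('I_n -> nat))%type.

Definition hol_degree (x : term) : nat := \sum_j x.1.2 j.
Definition conj_degree (x : term) : nat := \sum_j x.2 j.
Definition eval_term (x : term) (z : V) : C := x.1.1 * bimonomial x.1.2 x.2 z.

Lemma prod_exp_scale (c : C) (al : 'I_n -> nat) (F : 'I_n -> C) :
  \prod_j (c * F j) ^+ al j = c ^+ (\sum_j al j) * \prod_j F j ^+ al j.
Proof.
rewrite -prodrXr -big_split /=; apply: eq_bigr => j _; exact: exprMn.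
Qed.

Lemma eval_term_scale (c : C) x z :
  eval_term x (c *: z) = c ^+ hol_degree x * c^*%C ^+ conj_degree x * eval_term x z.
Proof.
rewrite /eval_term /bimonomial.
have -> : \prod_j (c *: z) 0 j ^+ x.1.2 j = \prod_j (c * z 0 j) ^+ x.1.2 j.
  by apply: eq_bigr => j _; rewrite mxE.
have -> : \prod_j ((c *: z) 0 j)^*%C ^+ x.2 j = \prod_j (c^*%C * (z 0 j)^*%C) ^+ x.2 j.
  by apply: eq_bigr => j _; rewrite mxE rmorphM.
by rewrite !prod_exp_scale -/(hol_degree x) -/(conj_degree x); ring.
Qed.

Lemma rn_eval_term x z :
  rn (eval_term x z) <= rn x.1.1 * rn z ^+ (hol_degree x + conj_degree x).
Proof.
rewrite /eval_term /bimonomial !rnM; apply: ler_wpM2l; first exact: rn_ge0.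
have H (F : 'I_n -> C) (al : 'I_n -> nat) : (forall j, rn (F j) <= rn z) ->
    rn (\prod_j F j ^+ al j) <= rn z ^+ (\sum_j al j).
  move=> hF; rewrite -prodrXr (big_morph _ (@rnM R) (@rn1 R)).
  apply: ler_prod => j _; rewrite rn_ge0 rnX /=.
  by rewrite lerXn2r ?nnegrE ?rn_ge0.
rewrite exprD; apply: ler_pM; rewrite ?rn_ge0 //.
  by apply: H => j; apply: rn_coord.
by apply: H => j; rewrite rn_conj rn_coord.
Qed.

Lemma eval_term_strict x z0 : strictly_differentiable setT (eval_term x) z0.
Proof.
apply: strictly_differentiableM => //; first exact: strictly_differentiable_cst.
have H (F : 'I_n -> V -> C) (al : 'I_n -> nat) :
    (forall j, strictly_differentiable setT (F j) z0) ->
    strictly_differentiable setT (fun z => \prod_j F j z ^+ al j) z0.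
  move=> hF; elim: (index_enum _) => [|j r IH].
    under eq_fun do rewrite big_nil; exact: strictly_differentiable_cst.
  under eq_fun do rewrite big_cons; apply: strictly_differentiableM => //.
  elim: (al j) => [|k IHk].
    under eq_fun do rewrite expr0; exact: strictly_differentiable_cst.
  by under eq_fun do rewrite exprS; apply: strictly_differentiableM.
apply: strictly_differentiableM => //; apply: H => j; apply: strictly_differentiable_linear.
  exact: coord_linear.
split=> [u v|a u|]; rewrite ?mxE ?rmorphD //.
  by rewrite rmorphM; congr (_ * _); exact: conjc_real.
by exists 1 => // u; rewrite mul1r rn_conj rn_coord.
Qed.

Lemma eval_terms_continuous (s : seq term) (P : pred term) z0 (e : R) : 0 < e ->
  exists2 d : R, 0 < d & forall z, rn (z - z0) < d ->
    rn (\sum_(x <- s | P x) eval_term x z - \sum_(x <- s | P x) eval_term x z0) <= e.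
Proof.
move=> e0; have : strictly_differentiable setT (fun z => \sum_(x <- s | P x) eval_term x z) z0.
  elim: s => [|x s IH].
    under eq_fun do rewrite big_nil; exact: strictly_differentiable_cst.
  have [Px|nPx] := boolP (P x).
    under eq_fun do rewrite big_cons Px.
    by apply: strictly_differentiableD => //; apply: eval_term_strict.
  by under eq_fun do rewrite big_cons (negbTE nPx).
move=> /strict_lipschitz[K [d [K0 d0 hd]]].
exists (Num.min d (e / K)) => [|z]; first by rewrite lt_min d0 divr_gt0.
rewrite lt_min ltr_pdivlMr // => /andP[z1 z2].
have := hd z0 z I I; rewrite subrr rn0 => /(_ d0 z1) h; apply: le_trans h _.
by rewrite mulrC ltW.
Qed.

Lemma eval_conj_terms (p : mpoly.mpoly (n + n) C) :
  exists s : seq term, forall z : V, eval_conj p z = \sum_(x <- s) eval_term x z.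
Proof.
exists [seq (mpoly.mcoeff m p, (fun j => mpoly.fun_of_multinom m (lshift n j)), (fun j => mpoly.fun_of_multinom m (rshift n j))) | m <- mpoly.msupp p] => z.
rewrite /eval_conj mpoly.mevalE [RHS]big_map; apply: eq_bigr => m _.
rewrite /eval_term /bimonomial /=; congr (_ * _).
rewrite big_split_ord /=; congr (_ * _); apply: eq_bigr => j _.
  by rewrite row_mxEl.
by rewrite row_mxEr mxE.
Qed.

End PolynomialTerms.

(** * The Taylor polynomials of a function holomorphic along the leaves *)

Section HolomorphicJet.
Context {R : realType} {n : nat}.
Local Notation C := R[i].
Local Notation V := 'rV[C]_n.
Local Notation term := (C * ('I_n -> nat) * ('I_n -> nat))%type.

Definition total_degree (x : term) : nat := hol_degree x + conj_degree x.

Definition little_o_at0 (f : V -> C) (k : nat) := forall e : R, 0 < e ->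
  exists2 d : R, 0 < d & forall z : V, rn z < d -> rn (f z) <= e * rn z ^+ k.

Lemma rn_hermitian (z : V) : rn (hermitian_norm z) <= n%:R * rn z.
Proof.
rewrite -(@ler_pXn2r _ 2) ?nnegrE ?mulr_ge0 ?rn_ge0 // -rnX /hermitian_norm sqrtCK.
apply: le_trans (rn_sum _ _ _) _.
apply: (@le_trans _ _ (\sum_(j < n) rn z ^+ 2)).
  apply: ler_sum => j _.
  have -> : rn (`|z 0 j| ^+ 2) = rn (z 0 j) ^+ 2 by rewrite rnX /rn normr_id.
  by rewrite lerXn2r ?nnegrE ?rn_ge0 // rn_coord.
rewrite sumr_const card_ord exprMn -[leLHS]mulr_natl ler_wpM2r ?sqr_ge0 // -natrX ler_nat.
by case: (n) => // k; rewrite -mulnn leq_pmull.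
Qed.

Lemma smooth_at0_terms (f : V -> C) (k : nat) : smooth_at0 f -> (0 < k)%N ->
  exists s : seq term, little_o_at0 (fun z => f z - \sum_(x <- s) eval_term x z) k.
Proof.
move=> hf k0; have [p /eqoP hp] := hf k k0.
have [s hs] := eval_conj_terms p; exists s => e e0.
pose N : R := (n%:R ^+ k) + 1.
have N0 : 0 < N by rewrite ltr_wpDl // exprn_ge0.
have eN : 0 < (e / N)%:C by rewrite ltcR divr_gt0.
have /near_rn[d d0 hd] := hp _ eN.
exists d => // z hz; have := hd z; rewrite subr0 => /(_ hz).
rewrite -!rnE -rmorphM lecR hs => h; apply: le_trans h _.
rewrite rnX; apply: le_trans (_ : e / N * (n%:R * rn z) ^+ k <= _).
  apply: ler_wpM2l; first by rewrite divr_ge0 // ltW.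
  by rewrite lerXn2r ?nnegrE ?rn_ge0 ?mulr_ge0 ?rn_ge0 // rn_hermitian.
rewrite exprMn mulrA ler_wpM2r ?exprn_ge0 ?rn_ge0 //.
by rewrite mulrAC ler_pdivrMr // ler_pM2l // lerDl.
Qed.

Lemma eval_term_real_scale (t : R) x (z : V) :
  eval_term x (t%:C *: z) = (t ^+ total_degree x)%:C * eval_term x z.
Proof.
rewrite eval_term_scale; have -> : (t%:C)^*%C = t%:C by exact: conjc_real.
by rewrite -exprD rmorphXn.
Qed.

(** Blowing up at 0: if all homogeneous components of degree less than [m] vanish, the
    one of degree [m] governs the values at [t *: w] as [t] tends to 0 and [w] to [z0]. *)
Lemma lowest_terms (s : seq term) (P : pred term) (m : nat) (z0 : V) :
  (forall l (z : V), (l < m)%N -> \sum_(x <- s | P x && (total_degree x == l)) eval_term x z = 0) ->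
  forall e : R, 0 < e -> exists2 d : R, 0 < d & forall t (w : V), 0 < t < d -> rn (w - z0) < d ->
    rn (\sum_(x <- s | P x) eval_term x (t%:C *: w)
        - (t ^+ m)%:C * \sum_(x <- s | P x && (total_degree x == m)) eval_term x z0) <= e * t ^+ m.
Proof.
move=> low e e0; have e20 : 0 < e / 2 by lra.
have [d1 d10 hd1] := eval_terms_continuous s (fun x => P x && (total_degree x == m)) z0 e20.
pose B := \sum_(x <- s | P x && (m < total_degree x)%N) rn x.1.1 * (rn z0 + 1) ^+ total_degree x.
have B0 : 0 <= B.
  by apply: sumr_ge0 => x _; rewrite mulr_ge0 ?exprn_ge0 ?addr_ge0 ?rn_ge0.
have [d [d0 [dd1 d11 dB]]] : exists d : R, 0 < d /\ [/\ d <= d1, d <= 1 & d * (2 * (B + 1)) <= e].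
  have B1 : 0 < 2 * (B + 1) by lra.
  exists (Num.min d1 (Num.min 1 (e / (2 * (B + 1))))).
  split; first by rewrite !lt_min d10 ltr01 divr_gt0.
  by split; rewrite -?ler_pdivlMr // !ge_min lexx ?orbT.
exists d => // t w /andP[t0 td] hw.
have tm0 : 0 <= t ^+ m by rewrite exprn_ge0 // ltW.
have t1 : t <= 1 by lra.
have wb : rn w <= rn z0 + 1.
  by have := rn_triangle (w - z0) z0; rewrite subrK; lra.
rewrite (bigID (fun x => (total_degree x < m)%N)) /=.
have -> : \sum_(x <- s | P x && (total_degree x < m)%N) eval_term x (t%:C *: w) = 0.
  rewrite big_mkcond /=.
  rewrite (eq_bigr (fun x => \sum_(l < m) if P x && (total_degree x == l) then eval_term x (t%:C *: w) else 0)).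
    rewrite exchange_big /= big1 // => l _; rewrite -big_mkcond; exact: low.
  move=> x _; have [xm|xm] := ltnP (total_degree x) m; last first.
    rewrite andbF big1 // => l _; rewrite (gtn_eqF (leq_trans (ltn_ord l) xm)) andbF //.
  rewrite andbT (bigD1 (Ordinal xm)) //= eqxx andbT big1 ?addr0 // => l lx.
  have -> : (total_degree x == l) = false by apply/negbTE; rewrite eq_sym.
  by rewrite andbF.
rewrite add0r (bigID (fun x => (total_degree x == m))) /=.
have E1 : \sum_(x <- s | P x && ~~ (total_degree x < m)%N && (total_degree x == m)) eval_term x (t%:C *: w)
   = (t ^+ m)%:C * \sum_(x <- s | P x && (total_degree x == m)) eval_term x w.
  rewrite mulr_sumr; apply: eq_big => [x|x /andP[_ /eqP xm]].
    by case: eqP => [->|_]; rewrite ?ltnn ?andbT ?andbF.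
  by rewrite eval_term_real_scale xm.
rewrite {}E1 addrAC -mulrBr.
apply: le_trans (rn_triangle _ _) _.
have h1 : rn ((t ^+ m)%:C * (\sum_(x <- s | P x && (total_degree x == m)) eval_term x w -
   \sum_(x <- s | P x && (total_degree x == m)) eval_term x z0)) <= t ^+ m * (e / 2).
  rewrite rnM rn_real ger0_norm // ler_wpM2l //; apply: hd1; lra.
have h2 : rn (\sum_(x <- s | P x && ~~ (total_degree x < m)%N && (total_degree x != m)) eval_term x (t%:C *: w))
    <= t ^+ m * (t * B).
  apply: le_trans (rn_sum _ _ _) _; rewrite mulrA mulr_sumr.
  have eqP' x : P x && ~~ (total_degree x < m)%N && (total_degree x != m) = P x && (m < total_degree x)%N.
    by rewrite -andbA -leqNgt (ltn_neqAle m) andbC (andbC (m <= _)%N) eq_sym andbC.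
  rewrite (eq_bigl _ _ eqP'); apply: ler_sum => x /andP[_ xm].
  rewrite eval_term_real_scale rnM rn_real ger0_norm ?exprn_ge0 ?(ltW t0) //.
  apply: ler_pM; rewrite ?rn_ge0 ?exprn_ge0 ?(ltW t0) //.
    by rewrite -exprSr ler_wiXn2l // ltW.
  apply: le_trans (rn_eval_term _ _) _; rewrite -/(total_degree x).
  by rewrite ler_wpM2l ?rn_ge0 // lerXn2r ?nnegrE ?rn_ge0 // addr_ge0 ?rn_ge0.
have h3 : t ^+ m * (t * B) <= t ^+ m * (e / 2).
  rewrite ler_wpM2l //.
  have : t * (B + 1) <= d * (B + 1) by rewrite ler_wpM2r //; lra.
  lra.
lra.
Qed.

(** A holomorphic function with a radial limit of order [m] in every direction
    has a monomial as its principal part. *)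
Lemma radial_limit_monomial (g : C -> C) (m : nat) (L : C -> C) : disc_holo g ->
  (forall ze : C, rn ze = 1 -> forall e : R, 0 < e -> exists2 d : R, 0 < d & forall t : R, 0 < t < d ->
     rn (g (t%:C * ze) - (t ^+ m)%:C * L ze) <= e * t ^+ m) ->
  exists c, forall ze : C, rn ze = 1 -> L ze = c * ze ^+ m.
Proof.
move=> hg hL; have h2 : 0 < (2^-1 : R) < 1 by apply/andP; split; lra.
have [r0 _] := andP h2.
have [A A0 hA] := approx_bounded (hg _ h2).
have [c [_ hc]] := taylor_expansion r0 (hg _ h2) hA.
have low k : (k < m)%N -> c k = 0.
  case: m hL => // m hL; rewrite ltnS; apply: taylor_coef_flat r0 hc _ k => e e0.
  have [d d0 hd] := hL 1 (rn1 : rn (1 : C) = 1) 1 ltr01.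
  pose M := rn (L 1) + 1.
  have M0 : 0 < M by rewrite ltr_wpDl ?rn_ge0.
  exists (Num.min d (e / M)) => [|t /andP[t0]]; first by rewrite lt_min d0 divr_gt0.
  rewrite lt_min ltr_pdivlMr // => /andP[td tM].
  have := hd t; rewrite t0 td mulr1 mul1r => /(_ isT) h.
  have := rn_triangle (g t%:C - (t ^+ m.+1)%:C * L 1) ((t ^+ m.+1)%:C * L 1).
  rewrite subrK rnM rn_real gtr0_norm ?exprn_gt0 // => h'.
  have tm0 : 0 < t ^+ m by rewrite exprn_gt0.
  have : t ^+ m.+1 * M <= e * t ^+ m by rewrite exprS mulrAC ler_pM2r // ltW.
  rewrite /M; lra.
exists (c m) => ze z1; apply/eqP; rewrite -subr_eq0; apply/eqP/rn0_eq0/le_anti; rewrite rn_ge0 andbT.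
apply/ler_addgt0Pr => e e0; rewrite add0r; have e20 : 0 < e / 2 by lra.
have [d d0 hd] := hL ze z1 _ e20.
pose B := 2 * A / 2^-1 ^+ m.+1.
have B0 : 0 < B by rewrite divr_gt0 ?mulr_gt0 ?exprn_gt0.
have [t [t0 [td t4 tB]]] : exists t : R, 0 < t /\ [/\ t < d, t <= 2^-1 / 2 & t * (2 * B) <= e].
  exists (Num.min (d / 2) (Num.min (2^-1 / 2) (e / (2 * B)))).
  have BB : 0 < e / (2 * B) by rewrite divr_gt0 // mulr_gt0.
  split; first by rewrite !lt_min BB andbT; apply/andP; split; lra.
  split; rewrite -?ler_pdivlMr ?mulr_gt0 //.
  - by apply: (@le_lt_trans _ _ (d / 2)); [rewrite !ge_min lexx | lra].
  - by rewrite !ge_min lexx ?orbT.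
  - by rewrite !ge_min lexx ?orbT.
have rt : rn (t%:C * ze) = t by rewrite rnM z1 mulr1 rn_real gtr0_norm.
have := hc m.+1 (t%:C * ze); rewrite rt => /(_ t4).
rewrite big_ord_recr /= big1 => [|i _]; last by rewrite low ?mul0r.
rewrite add0r expr_div_n mulrA mulrAC -/B => h1.
have := hd t; rewrite t0 td => /(_ isT) h2'.
have := rn_sub_triangle ((t ^+ m)%:C * L ze) (g (t%:C * ze)) (c m * (t%:C * ze) ^+ m).
have -> : (t ^+ m)%:C * L ze - c m * (t%:C * ze) ^+ m = (t ^+ m)%:C * (L ze - c m * ze ^+ m).
  by rewrite exprMn rmorphXn /=; ring.
rewrite rnM rn_real gtr0_norm ?exprn_gt0 // (rn_distC ((t ^+ m)%:C * _)) => h3.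
have tm0 : 0 < t ^+ m by rewrite exprn_gt0.
rewrite -(ler_pM2l tm0); apply: le_trans h3 _.
have : B * t ^+ m.+1 <= t ^+ m * (e / 2).
  rewrite exprSr mulrCA ler_pM2l // mulrC; lra.
lra.
Qed.

(** Rotating by roots of unity: an expression all of whose terms contain a
    conjugate variable cannot equal [c * ze ^+ m] on the circle unless it is zero. *)
Lemma no_pure_conj_monomial (s : seq term) (v : V) (m : nat) (c : C) :
  (forall ze : C, rn ze = 1 ->
    \sum_(x <- s | (conj_degree x != 0) && (total_degree x == m)) eval_term x (ze *: v) = c * ze ^+ m) ->
  \sum_(x <- s | (conj_degree x != 0) && (total_degree x == m)) eval_term x v = 0.
Proof.
move=> hc.
suff c0 : c = 0 by have := hc 1 rn1; rewrite scale1r c0 mul0r.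
have [N [w [N1 wprim rw _]]] := fine_primitive_root (m + m) (@ltr01 R).
have N0 : (0 < N)%N by apply: leq_ltn_trans N1.
have wN : w ^+ N = 1 by apply: prim_expr_order.
have w0 : w != 0 by rewrite -rn_gt0 rw.
have wc : w^*%C = w^-1.
  by rewrite invc_norm -rnE rw expr1n invr1 mul1r.
have : \sum_(j < N) c = 0.
  have step (j : 'I_N) : c = \sum_(x <- s | (conj_degree x != 0) && (total_degree x == m))
       eval_term x v * (w ^- (2 * conj_degree x)) ^+ j.
      have wj0 : w ^+ j ^+ m != 0 by rewrite !expf_neq0.
      have rwj : rn (w ^+ j) = 1 by rewrite rnX rw expr1n.
      apply: (mulIf wj0); rewrite -(hc _ rwj) mulr_suml; apply: eq_bigr => x /andP[_ /eqP xm].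
      rewrite eval_term_scale rmorphXn /= wc -xm /total_degree.
      set a := hol_degree x; set b := conj_degree x.
      have -> : (w ^- (2 * b)) ^+ j = (w ^+ j) ^- b * (w ^+ j) ^- b.
        by rewrite exprVn -invfM -exprD -!exprM addnn -mul2n [(2 * b * j)%N]mulnC.
      have -> : (w ^-1 ^+ j) ^+ b = (w ^+ j) ^- b by rewrite exprVn exprVn.
      rewrite exprD; have wb0 : w ^+ j ^+ b != 0 by rewrite !expf_neq0.
      by field.
  rewrite (eq_bigr _ (fun j _ => step j)) exchange_big /= big1_seq // => x /andP[/andP[xb /eqP xm] _].
  rewrite -mulr_sumr sum_powers_root ?mulr0 //.
    by rewrite exprVn -exprM mulnC exprM wN expr1n invr1.
  rewrite invr_eq1 -(prim_order_dvd wprim); apply/negP => /dvdn_leq.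
  rewrite muln_gt0 /= lt0n xb => /(_ isT); rewrite leqNgt => /negP; apply.
  by apply: leq_ltn_trans N1; rewrite -xm /total_degree mul2n -addnn leq_add // leq_addl.
rewrite sumr_const card_ord => /eqP; rewrite mulrn_eq0 -leqn0 leqNgt N0 /= => /eqP //.
Qed.

End HolomorphicJet.

Section HolomorphicJetOfFoliated.
Context {R : realType} {n : nat}.
Local Notation C := R[i].
Local Notation V := 'rV[C]_n.
Local Notation term := (C * ('I_n -> nat) * ('I_n -> nat))%type.

Lemma leafwise_prod (I : Type) (s : seq I) (Q : I -> C * V -> C) (al : I -> nat) :
  (forall j, leafwise (Q j)) -> leafwise (fun p => \prod_(j <- s) Q j p ^+ al j).
Proof.
move=> hQ; elim: s => [|j s IH].
  under eq_fun do rewrite big_nil; exact: leafwise_cst.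
under eq_fun do rewrite big_cons; apply: leafwiseM => //.
elim: (al j) => [|k IHk].
  under eq_fun do rewrite expr0; exact: leafwise_cst.
by under eq_fun do rewrite exprS; apply: leafwiseM.
Qed.

Lemma hol_termE (x : term) (z : V) : conj_degree x = 0%N ->
  eval_term x z = x.1.1 * \prod_j z 0 j ^+ x.1.2 j.
Proof.
move=> x0; rewrite /eval_term /bimonomial [X in _ * (_ * X)]big1 ?mulr1 // => j _.
move/eqP: x0; rewrite /conj_degree sum_nat_eq0 => /forallP/(_ j)/eqP ->.
exact: expr0.
Qed.

Lemma eval_term0 (x : term) : total_degree x != 0%N -> eval_term x 0 = 0.
Proof.
move=> x0; apply: rn0_eq0; apply/le_anti; rewrite rn_ge0 andbT.
apply: le_trans (rn_eval_term _ _) _; rewrite -/(total_degree x).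
by rewrite rn0 expr0n (negbTE x0) mulr0.
Qed.

(** Setting the conjugate variables to 0. *)
Definition hol_part (s : seq term) (z : V) : C :=
  \sum_(x <- s | conj_degree x == 0%N) eval_term x z.

Section WithFoliation.
Variables (h : C -> V -> V) (f : V -> C).
Hypotheses (foliation : disc_foliation h)
  (lf : leafwise (fun p : C * V => f (h p.1 p.2))) (sf : smooth_at0 f).

Lemma leafwise_hol_part s : leafwise (fun p : C * V => hol_part s (h p.1 p.2)).
Proof.
rewrite /hol_part; elim: s => [|x s IH].
  under eq_fun do rewrite big_nil; exact: leafwise_cst.
have [/eqP x0|nx] := boolP (conj_degree x == 0%N); last first.
  by under eq_fun do rewrite big_cons (negbTE nx).
under eq_fun do rewrite big_cons x0 eqxx hol_termE //.
apply: leafwiseD => //; apply: leafwiseM; first exact: leafwise_cst.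
by apply: leafwise_prod => j; apply: coordinate_leafwise.
Qed.

(** The Taylor polynomials of [f] at 0 contain no conjugate variable.  On the leaf
    of [v] the lowest homogeneous component of the part containing conjugates is the
    principal part of a holomorphic function, hence a monomial [c * ze ^+ m] on the
    circle, hence zero. *)
Lemma holomorphic_jet (k : nat) : (0 < k)%N ->
  exists s : seq term, little_o_at0 (fun z => f z - hol_part s z) k.
Proof.
move=> k0; have [s hs] := smooth_at0_terms sf k0.
pose E (P : pred term) z := \sum_(x <- s | P x) eval_term x z.
pose conjp : pred term := fun x => conj_degree x != 0%N.
have splitE z : \sum_(x <- s) eval_term x z = hol_part s z + E conjp z.
  by rewrite (bigID (fun x => conj_degree x == 0%N)).
have [r hr] := foliation_radius foliation.
have low m : (m <= k)%N -> forall z, E (fun x => conjp x && (total_degree x == m)) z = 0.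
  elim/ltn_ind: m => m IH mk.
  have sphere_case v : sphere R n v -> E (fun x => conjp x && (total_degree x == m)) v = 0.
    move=> sv; have [rv0 h0 hder] := hr v sv.
    pose g z := f (h z v) - hol_part s (h z v).
    have hg : disc_holo g.
      apply: (leafwise_disc_holo (Q := fun p => f (h p.1 p.2) - hol_part s (h p.1 p.2))) => //.
      by apply: leafwiseB => //; apply: leafwise_hol_part.
    pose L ze : C := E (fun x => conjp x && (total_degree x == m)) ((ze * (r v)%:C) *: v).
    have [|c hc] := @radial_limit_monomial R g m L hg; last first.
      have rC : (r v)%:C != 0 :> C by rewrite -rn_gt0 rn_real gtr0_norm.
      have : E (fun x => conjp x && (total_degree x == m)) ((r v)%:C *: v) = 0.
        apply: (@no_pure_conj_monomial R n s ((r v)%:C *: v) m c) => ze z1.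
        rewrite -hc // /L /E; apply: eq_bigr => x _; by rewrite scalerA.
      rewrite /E; under eq_bigr => x /andP[_ /eqP xm] do rewrite eval_term_real_scale xm.
      rewrite -mulr_sumr => /eqP; rewrite mulf_eq0 => /orP[|/eqP //].
      by rewrite rmorphXn expf_eq0 (negbTE rC) andbF.
    move=> ze z1 e e0; have e20 : 0 < e / 2 by lra.
    have [|d1 d10 hd1] := @lowest_terms R n s conjp m ((ze * (r v)%:C) *: v) _ _ e20.
      by move=> l z lm; apply: IH => //; apply: leq_trans (ltnW lm) mk.
    pose B := r v * rn v + 1.
    have B0 : 0 < B by rewrite ltr_wpDl // mulr_ge0 ?rn_ge0 // ltW.
    have eB : 0 < e / 2 / B ^+ k by rewrite divr_gt0 // exprn_gt0.
    have [d2 d20 hd2] := hs _ eB.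
    have e30 : 0 < Num.min 1 (d1 / 2) by rewrite lt_min ltr01 divr_gt0.
    have [d3 d30 hd3] := hder _ e30.
    exists (Num.min (Num.min d1 1) (Num.min (d2 / B) d3)) => [|t /andP[t0]].
      by rewrite !lt_min d10 ltr01 d30 divr_gt0.
    rewrite !lt_min ltr_pdivlMr // => /andP[/andP[td1 t1] /andP[td2 td3]].
    have rt : rn (t%:C * ze) = t by rewrite rnM z1 mulr1 rn_real gtr0_norm.
    have tC : t%:C != 0 :> C by rewrite -rn_gt0 rn_real gtr0_norm.
    set y := h (t%:C * ze) v; pose w := t%:C^-1 *: y.
    have yw : y = t%:C *: w by rewrite /w scalerA divff // scale1r.
    have hy : rn (y - (t%:C * ze) *: ((r v)%:C *: v)) <= Num.min 1 (d1 / 2) * t.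
      by have := hd3 (t%:C * ze); rewrite rt addr0 h0 subr0; apply.
    have hw : rn (w - (ze * (r v)%:C) *: v) <= Num.min 1 (d1 / 2).
      rewrite -(ler_pM2l t0); apply: le_trans (_ : Num.min 1 (d1 / 2) * t <= _); last by rewrite mulrC.
      apply: le_trans hy; rewrite -{1}(gtr0_norm t0) -rn_real -rnZ.
      by rewrite scalerBr -yw scalerA scalerA mulrA.
    have wd : rn (w - (ze * (r v)%:C) *: v) < d1.
      apply: le_lt_trans hw _; apply: (@le_lt_trans _ _ (d1 / 2)); first by rewrite ge_min lexx orbT.
      by lra.
    have yB : rn y <= t * B.
      have := rn_triangle (y - (t%:C * ze) *: ((r v)%:C *: v)) ((t%:C * ze) *: ((r v)%:C *: v)).
      rewrite subrK (rnZ (t%:C * ze)) (rnZ (r v)%:C) rt rn_real gtr0_norm // => h1.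
      have : Num.min 1 (d1 / 2) * t <= 1 * t by rewrite ler_wpM2r ?(ltW t0) // ge_min lexx.
      rewrite /B; lra.
    have a1 : rn (E conjp y - (t ^+ m)%:C * L ze) <= e / 2 * t ^+ m.
      by rewrite yw; apply: hd1; rewrite ?t0.
    have a2 : rn (f y - \sum_(x <- s) eval_term x y) <= e / 2 * t ^+ m.
      apply: le_trans (hd2 y (le_lt_trans yB td2)) _.
      apply: le_trans (_ : e / 2 / B ^+ k * (t * B) ^+ k <= _).
        by apply: ler_wpM2l; [exact: ltW | rewrite lerXn2r ?nnegrE ?rn_ge0 // mulr_ge0 // ltW].
      rewrite exprMn mulrCA divfK; last by rewrite expf_neq0 // gt_eqF.
      by rewrite mulrC ler_pM2l // ler_wiXn2l // ltW.
    have -> : g (t%:C * ze) - (t ^+ m)%:C * L ze =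
       (f y - \sum_(x <- s) eval_term x y) + (E conjp y - (t ^+ m)%:C * L ze).
      by rewrite /g -/y splitE; ring.
    apply: le_trans (rn_triangle _ _) _; lra.
  move=> z; pose a := \sum_j rn (z 0 j) ^+ 2.
  have a0 : 0 <= a by apply: sumr_ge0 => j _; apply: exprn_ge0; apply: rn_ge0.
  have [az|an] := eqVneq a 0.
    have -> : z = 0 by [
      apply/rowP => j; rewrite mxE; apply: rn0_eq0; apply/eqP; rewrite -sqrf_eq0;
      move: az => /eqP; rewrite psumr_eq0 => [/allP/(_ j)|i _]; rewrite ?mem_index_enum ?sqr_ge0 //;
      apply].
    apply: big1 => x /andP[xc _]; apply: eval_term0.
    by rewrite addn_eq0 negb_and; apply/orP; right.
  pose t := Num.sqrt a.
  have t0 : 0 < t by rewrite sqrtr_gt0 lt_neqAle eq_sym an.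
  have tC : t%:C != 0 :> C by rewrite -rn_gt0 rn_real gtr0_norm.
  have sz : sphere R n (t%:C^-1 *: z).
    apply/sphereP; under eq_bigr => j _ do rewrite mxE rnM rnV rn_real gtr0_norm // exprMn.
    by rewrite -mulr_sumr -/a exprVn sqr_sqrtr // mulVf.
  have -> : z = t%:C *: (t%:C^-1 *: z) by rewrite scalerA divff // scale1r.
  rewrite /E; under eq_bigr => x /andP[_ /eqP xm] do rewrite eval_term_real_scale xm.
  by have := sphere_case _ sz; rewrite -mulr_sumr /E => ->; rewrite mulr0.
exists s => e e0; have e20 : 0 < e / 2 by lra.
have [d1 d10 hd1] := hs _ e20.
have [|d2 d20 hd2] := @lowest_terms R n s conjp k.+1 0 _ 1 ltr01.
  by move=> l z lk; apply: low.
have E0 (P : pred term) : (forall x, P x -> conjp x) -> E P 0 = 0.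
  move=> hP; apply: big1 => x /hP xc; apply: eval_term0.
  by rewrite addn_eq0 negb_and; apply/orP; right.
pose M := (2 / d2) ^+ k.+1.
have M0 : 0 < M by rewrite exprn_gt0 // divr_gt0.
have [d [d0 [dd1 dd2 dM]]] : exists d : R, 0 < d /\ [/\ d <= d1, d * 2 <= d2 * d2 & d * (2 * M) <= e].
  have p1 : 0 < d2 * d2 / 2 by rewrite divr_gt0 // mulr_gt0.
  have p2 : 0 < e / (2 * M) by rewrite divr_gt0 // mulr_gt0.
  exists (Num.min d1 (Num.min (d2 * d2 / 2) (e / (2 * M)))).
  split; first by rewrite !lt_min d10 p1.
  by split; rewrite -?ler_pdivlMr ?mulr_gt0 // !ge_min lexx ?orbT.
exists d => // z hz.
have -> : f z - hol_part s z = (f z - \sum_(x <- s) eval_term x z) + E conjp z by rewrite splitE; ring.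
apply: le_trans (rn_triangle _ _) _.
have a1 := hd1 z (lt_le_trans hz dd1).
suff : rn (E conjp z) <= e / 2 * rn z ^+ k by lra.
have [->|z0] := eqVneq z 0.
  by rewrite E0 // !rn0; apply: mulr_ge0; [lra | exact: exprn_ge0].
have rz : 0 < rn z.
  by rewrite lt_neqAle rn_ge0 andbT eq_sym; apply: contra z0 => /eqP/rn0_eq0 ->.
(* the dilation factor keeps z / t at half the distance allowed from 0 *)
pose t := 2 / d2 * rn z.
have t0 : 0 < t by rewrite mulr_gt0 // divr_gt0.
have tC : t%:C != 0 :> C by rewrite -rn_gt0 rn_real gtr0_norm.
have td : 0 < t < d2.
  rewrite t0 /t mulrAC ltr_pdivrMr //; lra.
have := hd2 t (t%:C^-1 *: z) td; rewrite subr0 rnZ rnV rn_real gtr0_norm //.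
have -> : t^-1 * rn z = d2 / 2 by rewrite /t; field; rewrite !gt_eqF.
rewrite scalerA divff // scale1r mul1r => /(_ _).
have -> : \sum_(x <- s | conjp x && (total_degree x == k.+1)) eval_term x 0 = 0.
  by apply: (E0 (fun x => conjp x && (total_degree x == k.+1))) => x /andP[].
rewrite mulr0 subr0 => hE; apply: le_trans (hE _) _; first by lra.
rewrite /t exprMn -/M exprS mulrA ler_wpM2r ?exprn_ge0 ?rn_ge0 //.
have : rn z * (2 * M) <= d * (2 * M) by rewrite ler_wpM2r // ?mulr_ge0 // ltW.
lra.
Qed.

End WithFoliation.
End HolomorphicJetOfFoliated.

(** * The chain rule along a variation *)

Section ChainRule.
Context {R : realType} {n : nat}.
Local Notation C := R[i].
Local Notation V := 'rV[C]_n.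

Lemma finite_common_radius (I : finType) (P : I -> R -> Prop) :
  (forall i, exists2 d : R, 0 < d & forall s : R, 0 < s < d -> P i s) ->
  exists2 d : R, 0 < d & forall s : R, 0 < s < d -> forall i, P i s.
Proof.
move=> hP; suff [d d0 hd] : exists2 d : R, 0 < d &
    forall s : R, 0 < s < d -> forall i, i \in enum I -> P i s.
  by exists d => // s hs i; apply: hd; rewrite ?mem_enum.
elim: (enum I) => [|i r [d d0 hd]]; first by exists 1.
have [d' d'0 hd'] := hP i.
exists (Num.min d d') => [|s /andP[s0]]; first by rewrite lt_min d0.
rewrite lt_min => /andP[s1 s2] k; rewrite inE => /orP[/eqP ->|kr].
  by apply: hd'; rewrite s0.
by apply: hd => //; rewrite s0.
Qed.

(** The difference quotients of [F] along the family converge both to [D z] and to the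
    value of [L] at the variation of the leaf. *)
Lemma variation_chain (h : C -> V -> V) (lam : R -> C) (sig : R -> V) (v : V) (z : C)
    (H : 'I_n -> C -> C) (F : V -> C) (D : C -> C) (L : V -> C) :
  (forall k, is_variation lam sig v (fun p => h p.1 p.2 0 k) (H k)) ->
  is_variation lam sig v (fun p => F (h p.1 p.2)) D ->
  rn z < 1 -> bounded_real_linear L ->
  (forall e : R, 0 < e -> exists2 d : R, 0 < d & forall y, rn (y - h z v) < d ->
     rn (F y - F (h z v) - L (y - h z v)) <= e * rn (y - h z v)) ->
  D z = L (\row_k H k z).
Proof.
move=> hH hD hz bL hL; have [LD LZ [K K0 hK]] := bL.
set u := \row_k H k z; set x := h z v in hL *.
apply/eqP; rewrite -subr_eq0; apply/eqP/rn0_eq0/le_anti; rewrite rn_ge0 andbT.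
apply/ler_addgt0Pr => e e0; rewrite add0r.
have e30 : 0 < e / 3 by lra.
pose M := rn u + 1.
have M0 : 0 < M by rewrite ltr_wpDl ?rn_ge0.
have eM : 0 < e / 3 / M by rewrite divr_gt0.
have [d1 d10 hd1] := hL _ eM.
have [b [b0 b1 bK]] : exists b : R, [/\ 0 < b, b <= 1 & b * K <= e / 3].
  exists (Num.min 1 (e / 3 / K)); split; rewrite -?ler_pdivlMr ?ge_min ?lexx ?orbT //.
  by rewrite lt_min ltr01 divr_gt0.
have [d2 d20 hd2] := finite_common_radius (fun k => variation_pointwise (hH k) hz b0).
have [d3 d30 hd3] := variation_pointwise hD hz e30.
have [s [s0 s2 s3 sM]] : exists s : R, [/\ 0 < s, s < d2, s < d3 & s * M < d1].
  exists (Num.min (d2 / 2) (Num.min (d3 / 2) (d1 / 2 / M))).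
  have p : 0 < d1 / 2 / M by apply: divr_gt0 => //; lra.
  have e2 (y : R) : 0 < y -> y / 2 < y by move=> ?; lra.
  split.
  - by rewrite !lt_min p andbT; apply/andP; split; lra.
  - by apply: le_lt_trans (e2 _ d20); rewrite !ge_min lexx.
  - by apply: le_lt_trans (e2 _ d30); rewrite !ge_min lexx ?orbT.
  - rewrite -ltr_pdivlMr //; apply: (@le_lt_trans _ _ (d1 / 2 / M)); first by rewrite !ge_min lexx ?orbT.
    by rewrite ltr_pM2r ?invr_gt0 // e2.
have hs2 : 0 < s < d2 by rewrite s0.
have hs3 : 0 < s < d3 by rewrite s0.
set y := h (z * lam s) (sig s).
have hy : rn (y - x - s%:C *: u) <= b * s.
  apply: rn_row_le => [|k]; first by rewrite mulr_ge0 // ltW.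
  by have := hd2 s hs2 k; rewrite !mxE.
have ry : rn (y - x) <= s * M.
  have := rn_triangle (y - x - s%:C *: u) (s%:C *: u).
  rewrite subrK rnZ rn_real gtr0_norm // /M => h1.
  have : b * s <= 1 * s by rewrite ler_pM2r.
  lra.
have a1 := hd1 y (le_lt_trans ry sM).
have a2 : e / 3 / M * rn (y - x) <= e / 3 * s.
  apply: le_trans (_ : e / 3 / M * (s * M) <= _); first by rewrite ler_pM2l.
  by rewrite mulrCA divfK ?gt_eqF // mulrC.
have a3 := hd3 s hs3; rewrite /= -/y -/x in a3.
have a4 : rn (L (y - x) - s%:C * L u) <= e / 3 * s.
  have -> : s%:C * L u = L (s%:C *: u) by rewrite LZ.
  rewrite -bounded_real_linearB //; apply: le_trans (hK _) _.
  apply: le_trans (_ : K * (b * s) <= _); first by rewrite ler_pM2l.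
  by rewrite mulrA ler_pM2r // mulrC.
rewrite -(ler_pM2l s0) -{1}(gtr0_norm s0) -rn_real -rnM mulrBr.
apply: le_trans (rn_sub_triangle _ (F y - F x) _) _.
rewrite rn_distC in a3.
have := rn_sub_triangle (F y - F x) (L (y - x)) (s%:C * L u); lra.
Qed.

Lemma hol_part_differentiable s (x : V) : differentiable (hol_part s : V -> C) x.
Proof.
rewrite /hol_part; elim: s => [|y s IH].
  under eq_fun do rewrite big_nil; exact: differentiable_cst.
have [/eqP y0|ny] := boolP (conj_degree y == 0%N); last first.
  by under eq_fun do rewrite big_cons (negbTE ny).
under eq_fun do rewrite big_cons y0 eqxx hol_termE //.
apply: (@differentiableD _ _ _ (fun z : V => y.1.1 * \prod_j z 0 j ^+ y.1.2 j)) => //.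
apply: (@differentiableM _ _ (fun=> y.1.1) (fun z : V => \prod_j z 0 j ^+ y.1.2 j)).
  exact: differentiable_cst.
elim: (index_enum _) => [|j r IHr].
  under eq_fun do rewrite big_nil; exact: differentiable_cst.
under eq_fun do rewrite big_cons.
apply: (@differentiableM _ _ (fun z : V => z 0 j ^+ y.1.2 j)) => //.
elim: (y.1.2 j) => [|k IHk].
  under eq_fun do rewrite expr0; exact: differentiable_cst.
under eq_fun do rewrite exprS.
by apply: (@differentiableM _ _ (fun z : V => z 0 j)) => //; apply: differentiable_coord.
Qed.

Lemma hol_part_gradient s (x : V) : exists al : 'I_n -> C,
  forall e : R, 0 < e -> exists2 d : R, 0 < d & forall y, rn (y - x) < d ->
    rn (hol_part s y - hol_part s x - \sum_k al k * (y - x) 0 k) <= e * rn (y - x).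
Proof.
have dP := hol_part_differentiable s x.
exists (fun k => 'd (hol_part s : V -> C) x (delta_mx 0 k)) => e e0.
have eC : 0 < e%:C by rewrite ltcR.
have /near_rn[d d0 hd] := diff_estimate dP eC.
exists d => // y hy; have := hd (y - x); rewrite subr0 => /(_ hy).
rewrite subrK -!rnE -rmorphM lecR => h.
suff -> : \sum_k 'd (hol_part s : V -> C) x (delta_mx 0 k) * (y - x) 0 k = 'd (hol_part s : V -> C) x (y - x) by [].
rewrite {2}(row_sum_delta (y - x)) linear_sum; apply: eq_bigr => k _.
by rewrite linearZ /= mulrC.
Qed.

End ChainRule.

(** * The matrix of the variations *)

Section VariationMatrix.
Context {R : realType} {n : nat}.
Local Notation C := R[i].
Local Notation V := 'rV[C]_n.

(** Row [j] of the matrix varies the leaf in the real direction [delta_j], row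
    [n + j] in the direction ['i *: delta_j]; the coordinate [j0] is reserved for
    the variations of the parameter along the leaf itself. *)
Definition row_dir (i : 'I_(n + n)) : C * 'I_n :=
  match fintype.split i with inl j => (1, j) | inr j => ('i, j) end.

Definition row_scale (j0 : 'I_n) i (s : R) : C :=
  if (row_dir i).2 == j0 then 1 + s%:C * (row_dir i).1 else 1.

Definition row_leaf (v : V) (j0 : 'I_n) i (s : R) : V :=
  if (row_dir i).2 == j0 then v else stereo v (row_dir i).2 (row_dir i).1 s.

Lemma rn_row_dir i : rn (row_dir i).1 = 1.
Proof. by rewrite /row_dir; case: fintype.split => j /=; [exact: rn1|exact: rn_i]. Qed.

Lemma row_curve (v : V) j0 i : sphere R n v -> exists (lam1 : C) (sig1 : V),
  leaf_curve (row_scale j0 i) (row_leaf v j0 i) v lam1 sig1.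
Proof.
move=> sv; rewrite /row_scale /row_leaf; case: eqP => _.
  by exists (row_dir i).1, 0; apply: dilation_curve.
by exists 0, ((row_dir i).1 *: delta_mx 0 (row_dir i).2 -
  (complex.Re ((v 0 (row_dir i).2)^*%C * (row_dir i).1))%:C *: v); apply: stereo_curve => //; apply: rn_row_dir.
Qed.

(** Columns [l] and [n + l] carry a coordinate of the variation and its conjugate, so
    that this matrix applied to the [dz_k] and [dzbar_k] components of a differential
    gives the derivatives along the variations.  Its entries are holomorphic, and they
    have the announced values at real [z] only. *)
Definition variation_mx (H : 'I_(n + n) -> 'I_n -> C -> C) (z : C) : 'M[C]_(n + n) :=
  \matrix_(i, l) match fintype.split l with inl k => H i k z | inr k => reflect_conj (H i k) z end.

Lemma variation_mx_holo H : (forall i k, disc_holo (H i k)) ->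
  forall i l, disc_holo (fun z => variation_mx H z i l).
Proof.
move=> hH i l.
apply: (@disc_holo_eq R (fun z => match fintype.split l with inl k => H i k z | inr k => reflect_conj (H i k) z end)).
  by move=> z _; rewrite mxE.
by case: (fintype.split l) => k //; apply: disc_holo_conj.
Qed.

Lemma reflect_conj_real (g : C -> C) (t : R) : reflect_conj g t%:C = (g t%:C)^*%C.
Proof. by rewrite /reflect_conj; congr (g _)^*%C; exact: conjc_real. Qed.

Definition tends_to (F : R -> C) (l : C) := forall e : R, 0 < e ->
  exists2 d : R, 0 < d & forall t, 0 < t < d -> rn (F t - l) <= e.

Lemma tends_cst (c : C) : tends_to (fun=> c) c.
Proof. by move=> e e0; exists 1 => // t _; rewrite subrr rn0 ltW. Qed.

Lemma tendsD F G a b : tends_to F a -> tends_to G b -> tends_to (fun t => F t + G t) (a + b).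
Proof.
move=> hF hG e e0; have e20 : 0 < e / 2 by lra.
have [d1 d10 hd1] := hF _ e20; have [d2 d20 hd2] := hG _ e20.
exists (Num.min d1 d2) => [|t /andP[t0]]; first by rewrite lt_min d10.
rewrite lt_min => /andP[t1 t2]; rewrite opprD addrACA.
apply: le_trans (rn_triangle _ _) _.
have := hd1 t; have := hd2 t; rewrite t0 t1 t2 => /(_ isT) ? /(_ isT) ?; lra.
Qed.

Lemma tendsM F G a b : tends_to F a -> tends_to G b -> tends_to (fun t => F t * G t) (a * b).
Proof.
move=> hF hG e e0.
pose M := rn a + rn b + 1.
have M0 : 0 < M by rewrite /M; have := rn_ge0 a; have := rn_ge0 b; lra.
have [k [k0 k1 kM]] : exists k : R, [/\ 0 < k, k <= 1 & k * M <= e].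
  exists (Num.min 1 (e / M)); split; rewrite -?ler_pdivlMr // ?ge_min ?lexx ?orbT //.
  by rewrite lt_min ltr01 divr_gt0.
have [d1 d10 hd1] := hF _ k0; have [d2 d20 hd2] := hG _ k0.
exists (Num.min d1 d2) => [|t /andP[t0]]; first by rewrite lt_min d10.
rewrite lt_min => /andP[t1 t2].
have := hd1 t; have := hd2 t; rewrite t0 t1 t2 => /(_ isT) h2 /(_ isT) h1.
have -> : F t * G t - a * b = (F t - a) * (G t - b) + (a * (G t - b) + (F t - a) * b) by ring.
apply: le_trans (rn_triangle _ _) _.
have := rn_triangle (a * (G t - b)) ((F t - a) * b); rewrite !rnM.
have := rn_ge0 (F t - a); have := rn_ge0 (G t - b); have := rn_ge0 a; have := rn_ge0 b.
rewrite /M in kM; move: (rn a) (rn b) (rn (F t - a)) (rn (G t - b)) kM h1 h2.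
move=> A B x y kM xk yk B0 A0 y0 x0.
have : x * y <= k * 1 by apply: ler_pM => //; lra.
have : A * y <= A * k by rewrite ler_wpM2l.
have : x * B <= k * B by rewrite ler_wpM2r.
lra.
Qed.

Lemma tends_det m (N : R -> 'M[C]_m) (N0 : 'M[C]_m) :
  (forall i j, tends_to (fun t => N t i j) (N0 i j)) -> tends_to (fun t => \det (N t)) (\det N0).
Proof.
move=> hN; rewrite /determinant; elim: (index_enum _) => [|s r IH].
  under eq_fun do rewrite big_nil; rewrite big_nil; exact: tends_cst.
under eq_fun do rewrite big_cons; rewrite big_cons; apply: tendsD => //.
apply: tendsM; first exact: tends_cst.
elim: (index_enum _) => [|i q IHq].
  under eq_fun do rewrite big_nil; rewrite big_nil; exact: tends_cst.
by under eq_fun do rewrite big_cons; rewrite big_cons; apply: tendsM.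
Qed.

(** The two equations come from the directions [1] and ['i], which separate the
    complex-linear from the conjugate-linear unknown. *)
Lemma real_independent (x y : C) : x + y = 0 -> 'i * x - 'i * y = 0 -> x = 0 /\ y = 0.
Proof.
move=> h1 h2; have i0 : ('i : C) != 0 by rewrite -rn_gt0 rn_i.
have xy : x = y.
  by apply/eqP; rewrite -subr_eq0; move/eqP: h2; rewrite -mulrBr mulf_eq0 (negbTE i0).
move: h1; rewrite -xy => /eqP; rewrite -mulr2n mulrn_eq0 /= => /eqP ->; by [].
Qed.

Lemma conj_i : ('i : C)^*%C = - 'i.
Proof. by apply/eqP; rewrite eq_complex /= oppr0 !eqxx. Qed.

Lemma conjcM (x y : C) : (x * y)^*%C = x^*%C * y^*%C.
Proof. exact: rmorphM. Qed.

Lemma conjcD (x y : C) : (x + y)^*%C = x^*%C + y^*%C.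
Proof. exact: rmorphD. Qed.

Section FixedLeaf.
Variables (h : C -> V -> V) (v : V) (j0 : 'I_n) (H : 'I_(n + n) -> 'I_n -> C -> C).
Hypotheses (foliation : disc_foliation h) (sv : sphere R n v) (vj0 : v 0 j0 != 0)
  (hH : forall i k, is_variation (row_scale j0 i) (row_leaf v j0 i) v
          (fun p => h p.1 p.2 0 k) (H i k)).

Lemma coordinate_variation_holo i k : disc_holo (H i k).
Proof.
have [lam1 [sig1 hc]] := row_curve j0 i sv.
exact: variation_disc_holo hc (coordinate_leafwise foliation k) (hH i k).
Qed.

Lemma coordinate_variation_at0 i k : H i k 0 = 0.
Proof.
have [r hr] := foliation_radius foliation.
have [lam1 [sig1 [_ ssig _]]] := row_curve j0 i sv.
apply: rn0_eq0; apply/le_anti; rewrite rn_ge0 andbT; apply/ler_addgt0Pr => e e0; rewrite add0r.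
have [|d d0 hd] := variation_pointwise (z := 0) (hH i k) _ e0; first by rewrite rn0.
pose s := Num.min 1 d / 2.
have s0 : 0 < s by rewrite divr_gt0 // lt_min ltr01.
have s1 : s < 1 by rewrite /s ltr_pdivrMr // gt_min; apply/orP; left; lra.
have sd : s < d by rewrite /s ltr_pdivrMr // gt_min; apply/orP; right; lra.
have ss : sphere R n (row_leaf v j0 i s) by apply: ssig; rewrite s0.
have [_ h1 _] := hr _ ss; have [_ h2 _] := hr _ sv.
have := hd s; rewrite s0 sd /= mul0r h1 h2 mxE subrr sub0r rnN rnM rn_real gtr0_norm // => /(_ isT).
by rewrite mulrC ler_pM2r.
Qed.

(** To first order at the centre of the disc the matrix is [z] times an invertible one. *)
Lemma variation_mx_det_neq0 :
  exists2 d : R, 0 < d & forall t : R, 0 < t < d -> \det (variation_mx H t%:C) != 0.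
Proof.
have [r hr] := foliation_radius foliation.
have r0 w : sphere R n w -> 0 < r w by move=> /hr[].
have hrk w k : sphere R n w -> has_complex_derivative (fun z => h z w 0 k) 0 ((r w)%:C * w 0 k).
  by move=> /hr[_ _ /complex_derivative_coord-/(_ k)]; rewrite mxE.
have ex i : exists c : 'I_n -> C, forall k, has_complex_derivative (H i k) 0 (c k).
  have hk k : exists c : C, has_complex_derivative (H i k) 0 c.
    by have [c [B [hc _]]] := disc_holo_first_order (coordinate_variation_holo i k); exists c.
  by have [c hc] := choice hk; exists c.
have [c hc] := choice ex.
have cE i : if (row_dir i).2 == j0 then forall k, c i k = (r v)%:C * ((row_dir i).1 * v 0 k)
   else exists a : C, forall k, c i k = a * v 0 k + (r v)%:C * ((row_dir i).1 * (k == (row_dir i).2)%:R).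
  have hQ := coordinate_leafwise foliation.
  have := hH i; rewrite /row_scale /row_leaf; case: eqP => [_|/eqP ne] hv.
    exact: (dilation_first_order sv hQ hrk hv (hc i)).
  exact: (stereo_first_order sv hQ r0 hrk (rn_row_dir i) ne vj0 hv (hc i)).
pose M0 : 'M[C]_(n + n) := \matrix_(i, l) match fintype.split l with inl k => c i k | inr k => (c i k)^*%C end.
have M0det : \det M0 != 0.
  rewrite -det_tr; apply/det0P => -[u u0 hu].
  pose al k := u 0 (lshift n k); pose be k := u 0 (rshift n k).
  have eqn i : \sum_k al k * c i k + \sum_k be k * (c i k)^*%C = 0.
    have := congr1 (fun A : 'rV[C]_(n + n) => A 0 i) hu; rewrite !mxE big_split_ord /= => hE.
    rewrite -[RHS]hE; congr (_ + _); apply: eq_bigr => k _; rewrite !mxE.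
      by rewrite -/(unsplit (inl k)) unsplitK.
    by rewrite -/(unsplit (inr k)) unsplitK.
  have dl j : row_dir (lshift n j) = (1, j) by rewrite /row_dir -/(unsplit (inl j)) unsplitK.
  have dr j : row_dir (rshift n j) = ('i, j) by rewrite /row_dir -/(unsplit (inr j)) unsplitK.
  have rC : (r v)%:C != 0 :> C by rewrite -rn_gt0 rn_real gtr0_norm ?r0.
  have rcj : ((r v)%:C)^*%C = (r v)%:C :> C by exact: conjc_real.
  pose A := \sum_k al k * v 0 k; pose B := \sum_k be k * (v 0 k)^*%C.
  (* for u in the kernel, the rows of the leaf itself kill v on both halves of u; then
     the rows of direction j annihilate the two entries of index j, and what remains
     of A = 0 and B = 0 is the entry of index j0 *)
  have leaf e i : row_dir i = (e, j0) -> e * A + e^*%C * B = 0.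
    move=> di; have := eqn i; have := cE i; rewrite di /= eqxx => ci.
    rewrite (eq_bigr (fun k => (r v)%:C * e * (al k * v 0 k))); last first.
      by move=> k _; rewrite ci; ring.
    rewrite -mulr_sumr -/A.
    rewrite (eq_bigr (fun k => (r v)%:C * e^*%C * (be k * (v 0 k)^*%C))); last first.
      by move=> k _; rewrite ci !conjcM rcj; ring.
    rewrite -mulr_sumr -/B -!mulrA -mulrDr => /eqP.
    by rewrite mulf_eq0 (negbTE rC) => /eqP.
  have [A0 B0] : A = 0 /\ B = 0.
    apply: real_independent.
      by have := leaf _ _ (dl j0); rewrite conjc1 !mul1r.
    by have := leaf _ _ (dr j0); rewrite conj_i mulNr.
  have side e i j : row_dir i = (e, j) -> j != j0 -> e * al j + e^*%C * be j = 0.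
    move=> di jj0; have := eqn i; have := cE i; rewrite di /= (negbTE jj0) => -[a ci].
    have -> : \sum_k al k * c i k = a * A + (r v)%:C * (e * al j).
      rewrite /A mulr_sumr [e * al j](_ : _ = \sum_k al k * (e * (k == j)%:R)); last first.
        rewrite (bigD1 j) //= eqxx mulr1 big1 ?addr0 1?mulrC // => k /negbTE ->.
        by rewrite !mulr0.
      by rewrite mulr_sumr -big_split /=; apply: eq_bigr => k _; rewrite ci; ring.
    have -> : \sum_k be k * (c i k)^*%C = a^*%C * B + (r v)%:C * (e^*%C * be j).
      rewrite /B mulr_sumr [e^*%C * be j](_ : _ = \sum_k be k * (e^*%C * (k == j)%:R)); last first.
        rewrite (bigD1 j) //= eqxx mulr1 big1 ?addr0 1?mulrC // => k /negbTE ->.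
        by rewrite !mulr0.
      rewrite mulr_sumr -big_split /=; apply: eq_bigr => k _.
      by rewrite ci conjcD !conjcM rcj conjc_nat; ring.
    rewrite A0 B0 !mulr0 !add0r -mulrDr => /eqP.
    by rewrite mulf_eq0 (negbTE rC) => /eqP.
  have ab j : j != j0 -> al j = 0 /\ be j = 0.
    move=> jj0; apply: real_independent.
      by have := side _ _ _ (dl j) jj0; rewrite conjc1 !mul1r.
    by have := side _ _ _ (dr j) jj0; rewrite conj_i mulNr.
  have al0 : al j0 = 0.
    move: A0; rewrite /A (bigD1 j0) //= big1 ?addr0 => [/eqP|j /ab[-> _]]; last by rewrite mul0r.
    by rewrite mulf_eq0 (negbTE vj0) orbF => /eqP.
  have be0 : be j0 = 0.
    move: B0; rewrite /B (bigD1 j0) //= big1 ?addr0 => [/eqP|j /ab[_ ->]]; last by rewrite mul0r.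
    by rewrite mulf_eq0 conjc_eq0 (negbTE vj0) orbF => /eqP.
  move/eqP: u0; apply; apply/rowP => l; rewrite mxE -[l]splitK.
  case: (fintype.split l) => k; rewrite /unsplit.
    by have [->|kj] := eqVneq k j0; [exact: al0 | case: (ab k kj)].
  by have [->|kj] := eqVneq k j0; [exact: be0 | case: (ab k kj)].
have lim : tends_to (fun t => \det (t%:C^-1 *: variation_mx H t%:C)) (\det M0).
  apply: tends_det => i l.
  have lim0 k : tends_to (fun t => t%:C^-1 * H i k t%:C) (c i k).
    move=> e e0; have [d d0 hd] := hc i k e e0; exists d => // t /andP[t0 td].
    have rt : rn (t%:C : C) = t by rewrite rn_real gtr0_norm.
    have tC : t%:C != 0 :> C by rewrite -rn_gt0 rt.
    have := hd t%:C; rewrite rt addr0 coordinate_variation_at0 subr0 => /(_ td) h1.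
    rewrite -(ler_pM2l t0) -{1}rt -rnM mulrBr mulrA divff // mul1r mulrC [t * e]mulrC.
    by move: h1; rewrite /GRing.scale /= [t%:C * _]mulrC.
  move=> e e0; rewrite /M0 /variation_mx.
  case El : (fintype.split l) => [k|k].
    have [d d0 hd] := lim0 k e e0; exists d => // t /hd; by rewrite !mxE El.
  have [d d0 hd] := lim0 k e e0; exists d => // t /hd; rewrite !mxE El.
  rewrite reflect_conj_real -rn_conj rmorphB rmorphM => h1.
  by have -> : t%:C^-1 = (t%:C^-1)^*%C :> C by rewrite conjc_inv; congr (_^-1); exact/esym/conjc_real.
have dM : 0 < rn (\det M0) / 2 by rewrite divr_gt0 // rn_gt0.
have [d d0 hd] := lim _ dM; exists d => // t /hd ht; apply/eqP => dt0.
move: ht; rewrite detZ dt0 mulr0 sub0r rnN.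
have : 0 < rn (\det M0) by rewrite rn_gt0.
lra.
Qed.

End FixedLeaf.
End VariationMatrix.

(** * Vanishing of the antiholomorphic derivatives *)

Section Conclusion.
Context {R : realType} {n : nat}.
Local Notation C := R[i].
Local Notation V := 'rV[C]_n.

Definition del_part (L : V -> C) (l : 'I_n) : C :=
  (L (delta_mx 0 l) - 'i * L ('i *: delta_mx 0 l)) / 2.
Definition dbar_part (L : V -> C) (l : 'I_n) : C :=
  (L (delta_mx 0 l) + 'i * L ('i *: delta_mx 0 l)) / 2.

Lemma del_dbar (L : V -> C) : bounded_real_linear L -> forall w,
  L w = \sum_l (del_part L l * w 0 l + dbar_part L l * (w 0 l)^*%C).
Proof.
move=> bL w; have [LD LZ _] := bL.
have Lsum I (r : seq I) (F : I -> V) : L (\sum_(i <- r) F i) = \sum_(i <- r) L (F i).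
  elim: r => [|i r IH]; first by rewrite !big_nil real_linear0.
  by rewrite !big_cons LD IH.
rewrite {1}(row_sum_delta w) Lsum; apply: eq_bigr => l _.
have wE : w 0 l *: (delta_mx 0 l : V) = (complex.Re (w 0 l))%:C *: delta_mx 0 l
      + (complex.Im (w 0 l))%:C *: ('i *: delta_mx 0 l).
  by rewrite scalerA -scalerDl {1}(complexE (w 0 l)) ['i * _]mulrC.
have key (c x y : C) : (complex.Re c)%:C * x + (complex.Im c)%:C * y =
    (x - 'i * y) / 2 * c + (x + 'i * y) / 2 * c^*%C.
  case: c => p q; rewrite [complex.Re _]/= [complex.Im _]/=.
  have -> : p +i* q = p%:C + 'i * q%:C by rewrite {1}(complexE (p +i* q)).
  have -> : (p%:C + 'i * q%:C)^*%C = p%:C - 'i * q%:C.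
    by rewrite conjcD conjcM conj_i mulNr; congr (_ - _ * _); exact: conjc_real.
  have ii : ('i : C) * 'i = -1 by rewrite -expr2 sqr_i.
  have -> : (x - 'i * y) / 2 * (p%:C + 'i * q%:C) + (x + 'i * y) / 2 * (p%:C - 'i * q%:C)
     = p%:C * x - ('i * 'i) * (q%:C * y) by field.
  by rewrite ii mulN1r opprK.
by rewrite {1}wE LD !LZ; exact: key.
Qed.

Section WithFoliation.
Variable h : C -> V -> V.
Hypothesis foliation : disc_foliation h.

Lemma leaf_growth v : sphere R n v -> exists B d : R, [/\ 0 < B, 0 < d &
  forall z, rn z < d -> rn (h z v) <= B * rn z].
Proof.
move=> sv; have [r hr] := foliation_radius foliation; have [r0 h0 hd] := hr v sv.
have [d d0 hd1] := hd 1 ltr01.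
exists (1 + r v * rn v), d; split => // [|z /hd1].
  by rewrite ltr_wpDr // mulr_ge0 ?rn_ge0 // ltW.
rewrite addr0 h0 subr0 mul1r => h1.
have := rn_triangle (h z v - z *: ((r v)%:C *: v)) (z *: ((r v)%:C *: v)).
rewrite subrK (rnZ z) (rnZ (r v)%:C) rn_real gtr0_norm // => h2.
lra.
Qed.

Lemma small_along_leaf (F : V -> C) k v (a : C) : little_o_at0 F k -> sphere R n v ->
  flat_to k (fun z => F (h (z * a) v)).
Proof.
move=> hF sv e e0; have [B [d [B0 d0 hB]]] := leaf_growth sv.
pose A := B * (rn a + 1).
have a1 : 0 < rn a + 1 by rewrite ltr_wpDl ?rn_ge0.
have A0 : 0 < A by rewrite mulr_gt0.
have eA : 0 < e / A ^+ k by rewrite divr_gt0 // exprn_gt0.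
have [d1 d10 hd1] := hF _ eA.
exists (Num.min (d / (rn a + 1)) (d1 / A)) => [|t /andP[t0]]; first by rewrite lt_min !divr_gt0.
rewrite lt_min !ltr_pdivlMr // => /andP[t1 t2].
have rt : rn (t%:C * a) = t * rn a by rewrite rnM rn_real gtr0_norm.
have hA : rn (h (t%:C * a) v) <= A * t.
  apply: le_trans (hB _ _) _.
    by rewrite rt; apply: le_lt_trans t1; rewrite ler_pM2l // lerDl.
  rewrite rt /A -mulrA ler_pM2l // mulrC ler_pM2r // lerDl //.
apply: le_trans (hd1 _ _) _; first by apply: le_lt_trans hA _; rewrite mulrC.
apply: le_trans (_ : e / A ^+ k * (A * t) ^+ k <= _).
  by apply: ler_wpM2l; [exact: ltW | rewrite lerXn2r ?nnegrE ?rn_ge0 // mulr_ge0 // ltW].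
by rewrite (exprMn k A t) mulrA divfK // expf_neq0 // gt_eqF.
Qed.

(** Schwarz's lemma is applied to the difference quotients, whose bound on the disc of
    radius 1/2 does not depend on [s]. *)
Lemma variation_flat lam sig v (lam1 : C) (sig1 : V) (F : V -> C) (D : C -> C) k :
  leaf_curve lam sig v lam1 sig1 -> leafwise (fun p : C * V => F (h p.1 p.2)) ->
  is_variation lam sig v (fun p : C * V => F (h p.1 p.2)) D -> little_o_at0 F k ->
  exists2 A : R, 0 < A & forall z, rn z <= 4^-1 -> rn (D z) <= A * rn z ^+ k.+1.
Proof.
move=> hcurve hQ hD hF; have [sv ssig _] := hcurve.
have h2 : 0 < (2^-1 : R) < 1 by apply/andP; split; lra.
have [r0 r1] := andP h2.
have [A A0 hA] := approx_bounded (variation_disc_holo hcurve hQ hD h2).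
pose B := 2 * (A + 1) * 2 ^+ k.+1.
have B0 : 0 < B by rewrite !mulr_gt0 ?exprn_gt0 //; lra.
exists B => // z hz.
have hz2 : rn z <= 2^-1 / 2 by lra.
apply/ler_addgt0Pr => e e0.
have e10 : 0 < Num.min 1 e by rewrite lt_min ltr01.
have [d1 d10 hd1] := variation_uniform hD r1 e10.
have [d2 d20 hd2] := leafwise_family_approx hcurve hQ h2.
have [s [s0 s1 sd1 sd2]] : exists s : R, [/\ 0 < s, s < 1, s < d1 & s < d2].
  pose m := Num.min 1 (Num.min d1 d2).
  have m0 : 0 < m by rewrite !lt_min ltr01 d10.
  exists (m / 2); split; first by lra.
  - by apply: (@lt_le_trans _ _ m); [lra | rewrite !ge_min lexx].
  - by apply: (@lt_le_trans _ _ m); [lra | rewrite !ge_min lexx ?orbT].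
  - by apply: (@lt_le_trans _ _ m); [lra | rewrite !ge_min lexx ?orbT].
have sC : s%:C != 0 :> C by rewrite -rn_gt0 rn_real gtr0_norm.
have hs1 : 0 < s < d1 by rewrite s0.
pose g z := (F (h (z * lam s) (sig s)) + (-1) * F (h z v)) * s%:C^-1.
have gD y : rn y <= 2^-1 -> rn (g y - D y) <= Num.min 1 e.
  move=> hy; have := hd1 y s hy hs1 => /=.
  have -> : F (h (y * lam s) (sig s)) - F (h y v) - s%:C * D y = (g y - D y) * s%:C.
    by rewrite /g; field.
  by rewrite rnM rn_real gtr0_norm // ler_pM2r.
have ag : approx_by_polys (2^-1) g.
  have ac a : approx_by_polys (2^-1) (fun=> a : C).
    by apply: approx_eq (approx_poly _ a%:P) => y _; rewrite hornerC.
  apply: approxM => //; apply: approxD; first by apply: hd2; rewrite s0.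
  by apply: approxM => //; apply: (leafwise_disc_holo hQ sv h2).
have bg y : rn y <= 2^-1 -> rn (g y) <= A + 1.
  move=> hy; have := gD y hy; have := hA y hy; have := rn_triangle (g y - D y) (D y).
  rewrite subrK; have : Num.min 1 e <= 1 by rewrite ge_min lexx.
  lra.
have fg : flat_to k g.
  move=> b b0; have ss : sphere R n (sig s) by apply: ssig; rewrite s0.
  have bs : 0 < b * s / 2 by rewrite divr_gt0 // mulr_gt0.
  have [d3 d30 hd3] := small_along_leaf (lam s) hF ss bs.
  have [d4 d40 hd4] := small_along_leaf 1 hF sv bs.
  exists (Num.min d3 d4) => [|t /andP[t0]]; first by rewrite lt_min d30.
  rewrite lt_min => /andP[t3 t4].
  have := hd3 t; have := hd4 t; rewrite t0 t3 t4 mulr1 => /(_ isT) u1 /(_ isT) u2.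
  rewrite /g rnM rnV rn_real gtr0_norm // ler_pdivrMr //.
  apply: le_trans (rn_triangle _ _) _; rewrite mulN1r rnN; lra.
have := schwarz r0 ag bg fg hz2.
rewrite invrK exprMn => hg.
have := gD z; have hz3 : rn z <= 2^-1 by lra.
move=> /(_ hz3); rewrite rn_distC => hgD.
have := rn_triangle (D z - g z) (g z); rewrite subrK.
have : Num.min 1 e <= e by rewrite ge_min lexx orbT.
rewrite /B; lra.
Qed.

Section FixedLeaf.
Variables (Omega : set V) (f : V -> C) (v : V).
Hypotheses (image_sub : [set h z v | z in disc R & v in sphere R n] `<=` Omega)
  (fC1 : real_C1_open Omega f)
  (fhol : forall v, sphere R n v -> holomorphic_on (disc R) (fun z => f (h z v)))
  (fsmooth : smooth_at0 f) (sv : sphere R n v).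

Let lf : leafwise (fun p : C * V => f (h p.1 p.2)) := pullback_leafwise foliation image_sub fC1 fhol.

Lemma leaf_in_Omega z : rn z < 1 -> Omega (h z v).
Proof. by move=> hz; apply: image_sub; exists z; [exact/discP | exists v]. Qed.

Lemma diff_f x : Omega x -> @has_differential R (realified V) (realified C) f x.
Proof. by case: fC1 => _ + _; exact. Qed.

Definition dbar_along (l : 'I_n) (z : C) : C := dbar_part (real_diff f (h z v)) l.

(** By Cramer's rule [\det M * dbar_l f] is holomorphic on the real axis of the leaf,
    and it is flat at 0, because [f] can be replaced by [f] minus any of its Taylor
    polynomials. *)
Lemma det_dbar_vanishes (j0 : 'I_n) (H : 'I_(n + n) -> 'I_n -> C -> C) :
  (forall i k, is_variation (row_scale j0 i) (row_leaf v j0 i) v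
          (fun p => h p.1 p.2 0 k) (H i k)) ->
  forall l (t : R), `|t| < 1 -> \det (variation_mx H t%:C) * dbar_along l t%:C = 0.
Proof.
move=> hH l.
have hcurve i := row_curve j0 i sv.
have holo_M := variation_mx_holo (coordinate_variation_holo foliation sv hH).
have exY i : exists D, is_variation (row_scale j0 i) (row_leaf v j0 i) v
          (fun p => f (h p.1 p.2)) D.
  by have [lam1 [sig1 hc]] := hcurve i; exact: variation_exists hc lf.
have [Y hY] := choice exY.
pose G z := \sum_i \adj (variation_mx H z) (rshift n l) i * Y i z.
have holo_G : disc_holo G.
  apply: disc_holo_sum => i _; apply: disc_holoM; first exact: disc_holo_adj.
  by have [lam1 [sig1 hc]] := hcurve i; exact: variation_disc_holo hc lf (hY i).
have cramer (t : R) (a b : 'I_n -> C) (y : 'I_(n + n) -> C) :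
    (forall i, y i = \sum_k (a k * H i k t%:C + b k * (H i k t%:C)^*%C)) ->
    \sum_i \adj (variation_mx H t%:C) (rshift n l) i * y i = \det (variation_mx H t%:C) * b l.
  move=> hy; pose X : 'cV[C]_(n + n) := \col_c match fintype.split c with inl k => a k | inr k => b k end.
  have yX : \col_i y i = variation_mx H t%:C *m X.
    apply/colP => i; rewrite !mxE hy big_split big_split_ord /=; congr (_ + _); apply: eq_bigr => k _.
      by rewrite !mxE -/(unsplit (inl k)) unsplitK mulrC.
    by rewrite !mxE -/(unsplit (inr k)) unsplitK reflect_conj_real mulrC.
  have : (\adj (variation_mx H t%:C) *m \col_i y i) (rshift n l) 0 =
      (\det (variation_mx H t%:C) *: X) (rshift n l) 0.
    by rewrite yX mulmxA mul_adj_mx mul_scalar_mx.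
  rewrite mxE [RHS]mxE [X _ _]mxE -/(unsplit (inr l)) unsplitK => <-.
  by apply: eq_bigr => i _; rewrite [(\col_i y i) i 0]mxE.
have Yf i z : rn z < 1 -> Y i z = real_diff f (h z v) (\row_k H i k z).
  move=> hz; have df := diff_f (leaf_in_Omega hz).
  apply: variation_chain (hH i) (hY i) hz (real_diff_linear df) _ => e e0.
  have [d d0 hd] := real_diff_estimate df e0; exists d => // y /hd.
  by rewrite subrK.
have G_real (t : R) : `|t| < 1 -> G t%:C = \det (variation_mx H t%:C) * dbar_along l t%:C.
  move=> ht; have hz : rn (t%:C : C) < 1 by rewrite rn_real.
  apply: (cramer t (del_part (real_diff f (h t%:C v)))) => i.
  rewrite Yf // del_dbar; last exact/real_diff_linear/diff_f/leaf_in_Omega.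
  by apply: eq_bigr => k _; rewrite mxE.
move=> t ht; rewrite -G_real //; apply: flat_vanishes => // m.
have [s hs] := holomorphic_jet foliation lf fsmooth (ltn0Sn m).
pose F z := f z - hol_part s z.
have lF : leafwise (fun p : C * V => F (h p.1 p.2)).
  by apply: leafwiseB => //; apply: leafwise_hol_part.
have exD i : exists D, is_variation (row_scale j0 i) (row_leaf v j0 i) v
          (fun p => F (h p.1 p.2)) D.
  by have [lam1 [sig1 hc]] := hcurve i; exact: variation_exists hc lF.
have [D hD] := choice exD.
have G_D (u : R) : `|u| < 1 -> G u%:C = \sum_i \adj (variation_mx H u%:C) (rshift n l) i * D i u%:C.
  move=> hu; rewrite G_real //; have hz : rn (u%:C : C) < 1 by rewrite rn_real.
  have df := diff_f (leaf_in_Omega hz).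
  have [al hal] := hol_part_gradient s (h u%:C v).
  pose L := real_diff f (h u%:C v).
  have bL : bounded_real_linear L by exact: real_diff_linear.
  have bLD : bounded_real_linear (fun w => L w - \sum_k al k * w 0 k).
    have [LD LZ [K K0 hK]] := bL; split => [x y|a x|].
    - rewrite LD (_ : \sum_k al k * (x + y) 0 k = \sum_k al k * x 0 k + \sum_k al k * y 0 k).
        by rewrite opprD addrACA.
      by rewrite -big_split; apply: eq_bigr => k _; rewrite mxE mulrDr.
    - rewrite LZ scalerBr; congr (_ - _); rewrite scaler_sumr; apply: eq_bigr => k _.
      by rewrite mxE /GRing.scale /= mulrCA.
    - exists (K + \sum_k rn (al k)) => [|x].
        by rewrite ltr_wpDr // sumr_ge0 // => k _; apply: rn_ge0.
      rewrite mulrDl; apply: le_trans (rn_triangle _ _) _; rewrite rnN; apply: lerD => //.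
      apply: le_trans (rn_sum _ _ _) _; rewrite mulr_suml; apply: ler_sum => k _.
      by rewrite rnM ler_wpM2l ?rn_ge0 // rn_coord.
  apply/esym/(cramer u (fun k => del_part L k - al k)) => i.
  rewrite (variation_chain (hH i) (hD i) hz bLD) => [|e e0].
    rewrite del_dbar // -sumrB; apply: eq_bigr => k _; rewrite !mxE; ring.
  have e20 : 0 < e / 2 by lra.
  have [d1 d10 hd1] := real_diff_estimate df e20; have [d2 d20 hd2] := hal _ e20.
  exists (Num.min d1 d2) => [|y]; first by rewrite lt_min d10.
  rewrite lt_min => /andP[/hd1 + /hd2]; rewrite subrK /F -/L => u1 u2.
  set p := f y - _ - _ in u1; set q := hol_part s y - _ - _ in u2.
  rewrite (_ : _ - _ - _ = p - q); last by rewrite /p /q; ring.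
  apply: le_trans (rn_triangle _ _) _; rewrite rnN; lra.
have h4 : 0 < (4^-1 : R) < 1 by apply/andP; split; lra.
have exA i : exists A : R, 0 < A /\ forall z, rn z <= 4^-1 ->
    rn (\adj (variation_mx H z) (rshift n l) i * D i z) <= A * rn z ^+ m.+2.
  have [lam1 [sig1 hc]] := hcurve i.
  have [A A0 hA] := variation_flat hc lF (hD i) hs.
  have [B B0 hB] := approx_bounded (disc_holo_adj holo_M (rshift n l) i h4).
  exists (B * A); split => [|z hz]; first exact: mulr_gt0.
  by rewrite rnM -mulrA; apply: ler_pM; rewrite ?rn_ge0 //; [apply: hB | apply: hA].
have [A hA] := choice exA.
pose S := \sum_i A i.
have S0 : 0 <= S by apply: sumr_ge0 => i _; apply: ltW; case: (hA i).
have S1 : 0 < S + 1 by lra.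
move=> e e0; exists (Num.min 4^-1 (e / (S + 1))) => [|u /andP[u0]].
  by rewrite lt_min divr_gt0 // andbT; lra.
rewrite lt_min ltr_pdivlMr // => /andP[u4 uS].
have ru : rn (u%:C : C) = u by rewrite rn_real gtr0_norm.
rewrite G_D; last by rewrite gtr0_norm //; lra.
apply: le_trans (rn_sum _ _ _) _.
apply: (@le_trans _ _ (S * u ^+ m.+2)).
  rewrite mulr_suml; apply: ler_sum => i _; rewrite -{3}ru.
  by apply: (hA i).2; rewrite ru ltW.
have um : 0 < u ^+ m by apply: exprn_gt0.
rewrite !exprS !mulrA ler_pM2r //.
have : S * u <= e by lra.
have : 0 <= S * u by rewrite mulr_ge0 // ltW.
nra.
Qed.

Lemma dbar_continuous l (t : R) (e : R) : `|t| < 1 -> 0 < e ->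
  exists2 d : R, 0 < d & forall s : R, `|s - t| < d ->
    rn (dbar_along l s%:C - dbar_along l t%:C) <= e.
Proof.
move=> ht e0; have hz : rn (t%:C : C) < 1 by rewrite rn_real.
have [_ _ dc] := fC1.
have e10 : 0 < e / 2 by lra.
pose K := rn (delta_mx 0 l : V) + 1.
have K0 : 0 < K by rewrite ltr_wpDl ?rn_ge0.
have eK : 0 < e / K by rewrite divr_gt0.
have /near_rn[d1 d10 hd1] := dc _ (leaf_in_Omega hz) _ eK.
have [c hder] : exists c : V, has_complex_derivative (h ^~ v) t%:C c.
  by eexists; exact: complex_derivative_holomorphic (foliation_holomorphic foliation sv) hz.
have [d2 d20 hd2] := hder 1 ltr01.
pose M := 1 + rn c.
have M0 : 0 < M by rewrite ltr_wpDr ?rn_ge0.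
exists (Num.min d2 (d1 / M)) => [|s]; first by rewrite lt_min d20 divr_gt0.
rewrite lt_min ltr_pdivlMr // => /andP[s2 s1].
have rst : rn ((s - t)%:C : C) = `|s - t| by rewrite rn_real.
have hs : rn (h s%:C v - h t%:C v) < d1.
  have := hd2 (s - t)%:C; rewrite rst => /(_ s2); rewrite -rmorphD subrK mul1r => h1.
  apply: le_lt_trans s1.
  have := rn_triangle (h s%:C v - h t%:C v - (s - t)%:C *: c) ((s - t)%:C *: c).
  rewrite subrK rnZ rst /M; lra.
have hu := hd1 _ hs.
have h1 : rn (real_diff f (h s%:C v) (delta_mx 0 l) - real_diff f (h t%:C v) (delta_mx 0 l)) <= e.
  apply: le_trans (hu (delta_mx 0 l)) _; rewrite realified_norm.
  by rewrite mulrAC ler_pdivrMr // ler_pM2l // lerDl.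
have h2 : rn (real_diff f (h s%:C v) ('i *: delta_mx 0 l) - real_diff f (h t%:C v) ('i *: delta_mx 0 l)) <= e.
  apply: le_trans (hu ('i *: delta_mx 0 l)) _; rewrite realified_norm rnZ rn_i mul1r.
  by rewrite mulrAC ler_pdivrMr // ler_pM2l // lerDl.
have half (x y x' y' : C) : rn (x - x') <= e -> rn (y - y') <= e ->
    rn ((x + 'i * y) / 2 - (x' + 'i * y') / 2) <= e.
  move=> hx hy; rewrite -mulrBl opprD addrACA -mulrBr rnM rnV rn_natr ler_pdivrMr //.
  by apply: le_trans (rn_triangle _ _) _; rewrite rnM rn_i mul1r; lra.
exact: half h1 h2.
Qed.

(** Zeros of the determinant are isolated, so every point of the leaf is a limit of
    points where [det_dbar_vanishes] gives [dbar_along l = 0]. *)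
Lemma dbar_vanishes_on_leaf l (t : R) : `|t| < 1 -> dbar_along l t%:C = 0.
Proof.
move=> ht; have [j0 vj0] := sphere_coord_neq0 sv.
have exH i : exists Hi : 'I_n -> C -> C, forall k, is_variation (row_scale j0 i) (row_leaf v j0 i) v
          (fun p => h p.1 p.2 0 k) (Hi k).
  have [lam1 [sig1 hc]] := row_curve j0 i sv.
  have ex k := variation_exists hc (coordinate_leafwise foliation k).
  by have [Hi hHi] := choice ex; exists Hi.
have [H hH] := choice exH.
have holo_M := variation_mx_holo (coordinate_variation_holo foliation sv hH).
have [d0 d00 hd0] := variation_mx_det_neq0 foliation sv vj0 hH.
have [d d_gt0 hd] := isolated_zeros (disc_holo_det holo_M) d00 hd0 ht.
apply: rn0_eq0; apply/le_anti; rewrite rn_ge0 andbT; apply/ler_addgt0Pr => e e0; rewrite add0r.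
have [d1 d10 hd1] := dbar_continuous l ht e0.
have [s [s0 sd sd1 s1]] : exists s : R, [/\ 0 < s, s < d, s < d1 & s < 1 - `|t|].
  pose m := Num.min d (Num.min d1 (1 - `|t|)).
  have m0 : 0 < m by rewrite !lt_min d_gt0 d10 subr_gt0.
  exists (m / 2); split; first by lra.
  - by apply: (@lt_le_trans _ _ m); [lra | rewrite !ge_min lexx].
  - by apply: (@lt_le_trans _ _ m); [lra | rewrite !ge_min lexx ?orbT].
  - by apply: (@lt_le_trans _ _ m); [lra | rewrite !ge_min lexx ?orbT].
have st : `|t + s - t| = s by rewrite addrAC subrr add0r gtr0_norm.
have ts1 : `|t + s| < 1 by apply: le_lt_trans (ler_normD _ _) _; rewrite (gtr0_norm s0); lra.
have nz : \det (variation_mx H (t + s)%:C) != 0 by apply: hd; rewrite st s0.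
have := det_dbar_vanishes hH l ts1 => /eqP; rewrite mulf_eq0 (negbTE nz) /= => /eqP z0.
by have := hd1 (t + s); rewrite st z0 sub0r rnN; apply.
Qed.

End FixedLeaf.
End WithFoliation.
End Conclusion.

(** * The theorem *)

Section ComplexDifferentiability.
Context {R : realType} {n : nat}.
Local Notation C := R[i].
Local Notation V := 'rV[C]_n.

(** Cauchy-Riemann: without its conjugate-linear part the real differential is linear
    over [R[i]]. *)
Lemma complex_differentiable (f : V -> C) (x : V) :
  @has_differential R (realified V) (realified C) f x ->
  (forall l, dbar_part (real_diff f x) l = 0) -> differentiable f x.
Proof.
move=> df hdbar; have bL := real_diff_linear df; have [_ _ [K K0 hK]] := bL.
pose a : 'cV[C]_n := \col_l del_part (real_diff f x) l.
have LE w : real_diff f x w = (w *m a) 0 0.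
  rewrite del_dbar // !mxE; apply: eq_bigr => l _.
  by rewrite hdbar mul0r addr0 mxE mulrC.
have lin : linear (real_diff f x : V -> C).
  by move=> c u w; rewrite !LE mulmxDl -scalemxAl !mxE.
pose L : {linear V -> C} := HB.pack (real_diff f x : V -> C) (GRing.isLinear.Build C V C _ (real_diff f x) lin).
have cL : continuous L.
  apply/linear_bounded_continuous/linear_boundedP.
  exists K%:C; split; first by rewrite ger0_real // lecR ltW.
  move=> k kK w; apply: le_trans (_ : K%:C * `|w| <= _); last by rewrite ler_wpM2r // ltW.
  by rewrite -!rnE -rmorphM lecR; exact: hK.
have est : f \o shift x = cst (f x) + L +o_ (0 : V) id.
  apply/eqaddoP => e e0.
  have er : e = (complex.Re e)%:C by rewrite RRe_real // gtr0_real.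
  have e0r : 0 < complex.Re e by rewrite -ltcR -er.
  have [d d0 hd] := real_diff_estimate df e0r.
  have : \forall w \near (0 : V), rn (f (w + x) - f x - real_diff f x w) <= complex.Re e * rn w.
    by apply: (iffRL (near_rn _ _)); exists d => // w; rewrite subr0 => /hd.
  apply: filterS => w hw; rewrite !fctE /= /cst /= opprD addrA.
  by rewrite er -!rnE -rmorphM lecR.
have dE := diff_unique cL est.
by apply/diff_locallyP; rewrite dE.
Qed.

End ComplexDifferentiability.

Theorem theorem2p2 (R : realType) (n : nat) (Omega : set 'rV[R[i]]_n)
    (h : R[i] -> 'rV[R[i]]_n -> 'rV[R[i]]_n) (f : 'rV[R[i]]_n -> R[i]) :
  (0 < n)%N ->
  domain Omega ->
  disc_foliation h ->
  [set h z v | z in disc R & v in sphere R n] `<=` Omega ->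
  smooth_at0 f ->
  real_C1_open Omega f ->
  (forall v, sphere R n v -> holomorphic_on (disc R) (fun z => f (h z v))) ->
  exists U : set 'rV[R[i]]_n,
    [/\ open U, U 0 & holomorphic_on (Omega `&` U) f].
Proof.
move=> _ _ foliation image_sub fsmooth fC1 fhol.
have [_ [_ _ cover _ rotate]] := foliation.
exists (interior [set h z v | z in disc R & v in sphere R n]); split.
- exact: open_interior.
- exact: cover.
move=> x [Ox /interior_subset[z /discP hz [v sv hx]]].
have [theta zE] := polar z.
have sw : sphere R n (expi theta *: v).
  apply/sphereP; rewrite -[RHS](iffLR (sphereP v) sv); apply: eq_bigr => k _.
  by rewrite mxE rnM rn_expi mul1r.
have dt : disc R (rn z)%:C by apply/discP; rewrite rn_real ger0_norm ?rn_ge0.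
have xE : x = h (rn z)%:C (expi theta *: v) by rewrite rotate // mulrC -zE.
apply: complex_differentiable; first by case: fC1 => _ + _; exact.
move=> l; rewrite xE; apply: (dbar_vanishes_on_leaf foliation image_sub fC1 fhol fsmooth sw).
by rewrite ger0_norm ?rn_ge0.
Qed.
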